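(* Let $n\ge2$, $K\ge1$, and suppose that $f=(f_1,\ldots,f_n)$ is an invariant harmonic $K$-quasiregular mapping of $\mathbf{B}^n$ into $\mathbb{R}^n$. If there is an index $j\in\{1,\ldots,n\}$ such that $f_j\in\mathbb{H}^p(\mathbf{B}^n,\mathbb{R})$ for some $p>p_0=1$, then $f\in\mathbb{H}^p(\mathbf{B}^n,\mathbb{R}^n)$. Furthermore, the constant $p_0=1$ is sharp, that is, for no constant $p_0<1$ does this implication hold for all such $n,K,f,j$ and all $p>p_0$. Moreover, the following estimates hold. ($\mathscr{B}_1$) For $p\in(1,2]$, if $f_j\in\mathbb{H}^p(\mathbf{B}^n,\mathbb{R})$ for some $j\in\{1,\ldots,n\}$, then $$\|f\|_p^p\le|f(0)|^p+\left(\frac{1+(n-1)K^2}{p-1}\right)\left(\|f_j\|_p^p-|f_j(0)|^p\right).$$ ($\mathscr{B}_2$) For $p\in(2,\infty)$, there is a positive constant $\tau_2=\tau_2(n,p)$, depending only on $n$ and $p$, such that if $f_j\in\mathbb{H}^p(\mathbf{B}^n,\mathbb{R})$ for some $j\in\{1,\ldots,n\}$, then $$\|f\|_p\le\big(\tau_2K(n-1)+1\big)\|f_j\|_p-|f_j(0)|+\sqrt{n}\,|f(0)|.$$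
   Context: $\mathbf{B}^n$ is the open unit ball of $\mathbb{R}^n$, $\mathbf{S}^{n-1}$ its boundary, $d\sigma$ the normalized surface measure on $\mathbf{S}^{n-1}$, and $|\cdot|$ the Euclidean norm. Hardy type space: for $p\in(0,\infty)$, $m\ge1$, $\mathbb{H}^p(\mathbf{B}^n,\mathbb{R}^m)$ is the set of measurable $f:\mathbf{B}^n\to\mathbb{R}^m$ such that $M_p(r,f)=\left(\int_{\mathbf{S}^{n-1}}|f(r\zeta)|^p\,d\sigma(\zeta)\right)^{1/p}$ exists for all $r\in[0,1)$ and $\|f\|_p=\sup_{0<r<1}M_p(r,f)<\infty$. Quasiregular: a continuous $f:\Omega\subset\mathbb{R}^n\to\mathbb{R}^n$ is $K$-quasiregular ($K\ge1$ a constant) if $f\in W^1_{n,\mathrm{loc}}(\Omega)$ (the distributional first partial derivatives of the coordinates of $f$ are locally in $L^n(\Omega)$) and $|f'(x)|^n\le K J_f(x)$ for almost every $x\in\Omega$, where $|f'(x)|$ is the operator norm of the derivative and $J_f$ is the Jacobian determinant. Invariant harmonic: for a $C^2$ function $u:\mathbf{B}^n\to\mathbb{R}$, the invariant Laplacian is $\Delta_hu(x)=(1-|x|^2)^2\Delta u(x)+2(n-2)(1-|x|^2)\langle\nabla u(x),x\rangle$; $u$ is invariant harmonic if $\Delta_hu=0$ in $\mathbf{B}^n$. An invariant harmonic $K$-quasiregular mapping $f=(f_1,\ldots,f_n):\mathbf{B}^n\to\mathbb{R}^n$ is a $K$-quasiregular mapping each of whose coordinate functions is invariant harmonic. *)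

(* Defs.v *)
From HB Require Import structures.
From mathcomp Require Import all_boot all_order all_algebra.
From mathcomp Require Import all_classical all_reals all_analysis.
From mathcomp Require Import measurable_realfun.

Set Implicit Arguments.
Unset Strict Implicit.
Unset Printing Implicit Defensive.

Import Order.TTheory GRing.Theory Num.Theory.
Import numFieldNormedType.Exports.

Local Open Scope classical_set_scope.
Local Open Scope ring_scope.

(* R^n is 'rV[R]_n.  The library norm on matrices is the sup norm, which yields
   the usual topology; the Euclidean norm has to be introduced separately. *)
Section euclidean.
Context {R : realType}.

Definition dotp n (x y : 'rV[R]_n) : R := \sum_(i < n) x 0 i * y 0 i.

Definition enorm n (x : 'rV[R]_n) : R := Num.sqrt (dotp x x).

Definition eball n : set 'rV[R]_n := [set x | enorm x < 1].

Definition esphere n : set 'rV[R]_n := [set x | enorm x = 1].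

Definition basis_vec n (i : 'I_n) : 'rV[R]_n := delta_mx 0 i.

(* Matrices act on row vectors by v |-> v *m A, as in the library's 'J f. *)
Definition opnorm n (A : 'M[R]_n) : R :=
  sup [set enorm (v *m A) | v in [set v : 'rV[R]_n | enorm v <= 1]].

End euclidean.
Arguments eball {R} n.
Arguments esphere {R} n.
Arguments basis_vec {R n} i.

(* The product sigma-algebra on R^n, i.e. its Borel sigma-algebra. *)
Section measurable_rV.
Context {R : realType} (n : nat).

Let coord (i : 'I_n) (x : 'rV[R]_n) : R := x 0 i.

Let rV_set0 : g_sigma_preimage coord set0.
Proof. exact: sigma_algebra0. Qed.

Let rV_setC A : g_sigma_preimage coord A -> g_sigma_preimage coord (~` A).
Proof. exact: sigma_algebraC. Qed.

Let rV_bigcup (F : _^nat) : (forall i, g_sigma_preimage coord (F i)) ->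
  g_sigma_preimage coord (\bigcup_i F i).
Proof. exact: sigma_algebra_bigcup. Qed.

HB.instance Definition _ := @isMeasurable.Build default_measure_display
  'rV[R]_n (g_sigma_preimage coord) rV_set0 rV_setC rV_bigcup.

End measurable_rV.

Section measurable_rV_lemmas.
Context {R : realType}.

Lemma measurable_coord n (i : 'I_n) :
  measurable_fun [set: 'rV[R]_n] (fun x : 'rV[R]_n => x 0 i).
Proof.
move=> _ Y mY; rewrite setTI; apply: sub_sigma_algebra => /=.
rewrite -bigcup_seq/=; exists i => /=; first by rewrite mem_index_enum.
by exists Y => //; rewrite setTI.
Qed.

Lemma measurable_fun_rV d (T : measurableType d) n (f : T -> 'rV[R]_n) :
  (forall i, measurable_fun setT (fun x => f x 0 i)) -> measurable_fun setT f.
Proof.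
move=> mf.
pose G := \big[setU/set0]_(i < n)
  preimage_set_system setT (fun x : 'rV[R]_n => x 0 i) measurable.
apply: (@measurability _ _ T 'rV[R]_n setT f G); first by [].
move=> _ [B + <-]; rewrite /G -bigcup_seq => -[i _ [C mC <-]].
by have := mf i measurableT _ mC; rewrite !setTI.
Qed.

Lemma measurable_enorm n : measurable_fun setT (@enorm R n).
Proof.
rewrite (_ : @enorm R n = (@Num.sqrt R) \o (fun x => dotp x x))//.
apply: measurableT_comp.
  by apply: continuous_measurable_fun => x; exact: sqrt_continuous.
by apply: measurable_sum => i; apply: measurable_funM; exact: measurable_coord.
Qed.

Lemma measurable_eball n : measurable (@eball R n).
Proof.
rewrite (_ : eball n = (@enorm R n) @^-1` `]-oo, 1[); last first.
  by apply/seteqP; split => x /=; rewrite in_itv.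
by rewrite -[X in measurable X]setTI; apply: measurable_enorm.
Qed.

End measurable_rV_lemmas.

Section lebesgue_rV.
Context {R : realType}.

Definition cons_rV n (x : measurableTypeR R * 'rV[R]_n) : 'rV[R]_n.+1 :=
  row_mx (x.1%:M : 'rV_1) x.2.

Definition uncons_rV n (x : 'rV[R]_n.+1) : measurableTypeR R * 'rV[R]_n :=
  (x 0 0, rsubmx (x : 'rV_(1 + n))).

Lemma cons_rVK n : cancel (@cons_rV n) (@uncons_rV n).
Proof.
move=> [a v]; rewrite /uncons_rV /cons_rV /= row_mxKr; congr pair.
have -> : (0 : 'I_n.+1) = lshift n (0 : 'I_1) by exact/val_inj.
apply: (etrans (row_mxEl (a%:M : 'rV[R]_1) v 0 0)).
by rewrite mxE eqxx.
Qed.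

Lemma measurable_cons_rV n : measurable_fun setT (@cons_rV n).
Proof.
apply: measurable_fun_rV => i.
case: (split_ordP (i : 'I_(1 + n))) => j ->.
  rewrite (_ : (fun _ => _) = fst); first exact: measurable_fst.
  apply/funext => x; apply: (etrans (row_mxEl (x.1%:M : 'rV[R]_1) x.2 0 j)).
  by rewrite mxE ord1 eqxx.
rewrite (_ : (fun _ => _) = (fun v : 'rV[R]_n => v 0 j) \o snd).
  exact: (measurableT_comp (measurable_coord j) measurable_snd).
by apply/funext => x; exact: (row_mxEr (x.1%:M : 'rV[R]_1) x.2 0 j).
Qed.

Lemma measurable_uncons_rV n : measurable_fun setT (@uncons_rV n).
Proof.
apply/measurable_fun_pair; first exact: measurable_coord.
apply: measurable_fun_rV => i; under eq_fun do rewrite mxE.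
exact: measurable_coord.
Qed.

HB.instance Definition _ n :=
  isMeasurableFun.Build _ _ _ _ (@cons_rV n) (@measurable_cons_rV n).

Section step.
Context n (mu : {sigma_finite_measure set 'rV[R]_n -> \bar R}).

Definition lebesgue_step : set 'rV[R]_n.+1 -> \bar R :=
  pushforward (@lebesgue_measure R \x mu)%E (@cons_rV n).

Let step0 : lebesgue_step set0 = 0%E.
Proof. exact: measure0. Qed.

Let step_ge0 A : (0 <= lebesgue_step A)%E.
Proof. exact: measure_ge0. Qed.

Let step_sigma_additive : semi_sigma_additive lebesgue_step.
Proof. exact: measure_semi_sigma_additive. Qed.

HB.instance Definition _ := isMeasure.Build _ _ _ lebesgue_step
  step0 step_ge0 step_sigma_additive.

Let step_sigma_finite : sigma_finite setT lebesgue_step.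
Proof.
have /sigma_finiteP[F [TF ndF Foo]] := sigma_finiteT (@lebesgue_measure R).
have /sigma_finiteP[G [TG ndG Goo]] := sigma_finiteT mu.
exists (fun k => @uncons_rV n @^-1` (F k `*` G k)).
  rewrite -preimage_bigcup (_ : \bigcup_k _ = setT) ?preimage_setT//.
  apply/seteqP; split => // -[x y] _.
  have [k _ Fkx] : (\bigcup_k F k) x by rewrite -TF.
  have [l _ Gly] : (\bigcup_l G l) y by rewrite -TG.
  exists (maxn k l) => //; split.
  - by move: x Fkx; exact/subsetPset/ndF/leq_maxl.
  - by move: y Gly; exact/subsetPset/ndG/leq_maxr.
move=> k; have [mF oF] := Foo k; have [mG oG] := Goo k; split.
  rewrite -[X in measurable X]setTI.
  by apply: measurable_uncons_rV => //; exact: measurableX.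
rewrite /lebesgue_step /pushforward -comp_preimage.
rewrite (_ : _ \o _ = id); last by apply/funext => x /=; exact: cons_rVK.
by rewrite preimage_id product_measure1E// lte_mul_pinfty// ge0_fin_numE.
Qed.

HB.instance Definition _ := Measure_isSigmaFinite.Build _ _ _ lebesgue_step
  step_sigma_finite.

End step.

(* n-dimensional Lebesgue measure: R^0 has mass 1, R^(n+1) = R x R^n. *)
Fixpoint lebesgue_rV n : {sigma_finite_measure set 'rV[R]_n -> \bar R} :=
  match n with
  | 0%N => @dirac _ 'rV[R]_0 0 R
  | n.+1 => lebesgue_step (lebesgue_rV n)
  end.

(* Normalized surface measure of the unit sphere, as the normalized cone
   measure: sigma(A) = lambda {x in B^n | x/|x| in A} / lambda(B^n), which is
   what integration in polar coordinates amounts to.  It is a measure on R^n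
   carried by the sphere; the default of mnormalize is never used for n >= 1
   as 0 < lambda(B^n) < oo. *)
Definition direction n (x : 'rV[R]_n) : 'rV[R]_n := (enorm x)^-1 *: x.

Lemma measurable_direction n : measurable_fun setT (@direction n).
Proof.
apply: measurable_fun_rV => i; under eq_fun do rewrite mxE.
apply: measurable_funM; last exact: measurable_coord.
under eq_fun do rewrite -powR_inv1 ?sqrtr_ge0//.
exact: (measurableT_comp (measurable_powR (-1)) (@measurable_enorm R n)).
Qed.

HB.instance Definition _ n :=
  isMeasurableFun.Build _ _ _ _ (@direction n) (@measurable_direction n).

Section cone.
Context (n : nat).

Definition cone_measure : set 'rV[R]_n -> \bar R :=
  pushforward (mrestr (lebesgue_rV n) (@measurable_eball R n)) (@direction n).

Let cone0 : cone_measure set0 = 0%E.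
Proof. exact: measure0. Qed.

Let cone_ge0 A : (0 <= cone_measure A)%E.
Proof. exact: measure_ge0. Qed.

Let cone_sigma_additive : semi_sigma_additive cone_measure.
Proof. exact: measure_semi_sigma_additive. Qed.

HB.instance Definition _ := isMeasure.Build _ _ _ cone_measure
  cone0 cone_ge0 cone_sigma_additive.

End cone.

Definition surface_measure n : probability 'rV[R]_n R :=
  mnormalize (@cone_measure n) (@dirac _ 'rV[R]_n 0 R).

End lebesgue_rV.
Arguments lebesgue_rV {R} n.
Arguments surface_measure {R} n.

(* Functions on an open subset of R^n are represented by total functions, of
   which only the values on that subset matter. *)

Section hardy.
Context {R : realType}.
Local Open Scope ereal_scope.

Definition Mp n m (p : R) (f : 'rV[R]_n -> 'rV[R]_m) (r : R) : \bar R :=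
  (\int[surface_measure n]_(z in esphere n) (enorm (f (r *: z)) `^ p)%:E)
    `^ p^-1.

Definition hardy_norm n m (p : R) (f : 'rV[R]_n -> 'rV[R]_m) : \bar R :=
  ereal_sup [set Mp p f r | r in `]0%R, 1%R[%classic].

Definition hardy n m (p : R) (f : 'rV[R]_n -> 'rV[R]_m) : Prop :=
  [/\ measurable_fun (eball n) f,
      (forall r : R, (0 <= r < 1)%R -> (surface_measure n).-integrable
         (esphere n) (fun z => (enorm (f (r *: z)) `^ p)%:E)) &
      hardy_norm p f < +oo].

End hardy.

Section component.
Context {R : realType}.

Definition component n m (f : 'rV[R]_n -> 'rV[R]_m) (j : 'I_m) (x : 'rV[R]_n) : R :=
  f x 0 j.

(* R is identified with R^1 when a real function is viewed in a Hardy space. *)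
Definition to_rV1 n (u : 'rV[R]_n -> R) (x : 'rV[R]_n) : 'rV[R]_1 := (u x)%:M.

End component.

Section smooth.
Context {R : realType} (n : nat).

Fixpoint Ck (k : nat) (Omega : set 'rV[R]_n) (u : 'rV[R]_n -> R) : Prop :=
  match k with
  | 0%N => forall x, Omega x -> {for x, continuous u}
  | k.+1 => (forall x, Omega x -> {for x, continuous u}) /\
      forall i : 'I_n, (forall x, Omega x -> derivable u x (basis_vec i)) /\
        Ck k Omega ('D_(basis_vec i) u)
  end.

Definition test_fun (Omega : set 'rV[R]_n) (phi : 'rV[R]_n -> R) : Prop :=
  [/\ forall k, Ck k setT phi,
      compact (closure [set x | phi x != 0]) &
      closure [set x | phi x != 0] `<=` Omega].

Definition grad (u : 'rV[R]_n -> R) (x : 'rV[R]_n) : 'rV[R]_n :=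
  \row_i 'D_(basis_vec i) u x.

Definition laplacian (u : 'rV[R]_n -> R) (x : 'rV[R]_n) : R :=
  \sum_(i < n) 'D_(basis_vec i) ('D_(basis_vec i) u) x.

Definition inv_laplacian (u : 'rV[R]_n -> R) (x : 'rV[R]_n) : R :=
  (1 - enorm x ^+ 2) ^+ 2 * laplacian u x +
  2 * (n%:R - 2) * (1 - enorm x ^+ 2) * dotp (grad u x) x.

Definition invariant_harmonic (u : 'rV[R]_n -> R) : Prop :=
  Ck 2 (eball n) u /\ forall x, eball n x -> inv_laplacian u x = 0.

End smooth.

Section quasiregular.
Context {R : realType} (n : nat).

Definition Lp_loc (p : R) (Omega : set 'rV[R]_n) (u : 'rV[R]_n -> R) : Prop :=
  measurable_fun Omega u /\
  forall C : set 'rV[R]_n, compact C -> C `<=` Omega ->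
    (lebesgue_rV n).-integrable C (fun x => (`|u x| `^ p)%:E).

Definition weak_partial (Omega : set 'rV[R]_n) (i : 'I_n)
    (u g : 'rV[R]_n -> R) : Prop :=
  forall phi, test_fun Omega phi ->
    \int[lebesgue_rV n]_(x in Omega) (u x * 'D_(basis_vec i) phi x) =
    - \int[lebesgue_rV n]_(x in Omega) (g x * phi x).

(* f belongs to W^1_{p,loc}(Omega) with derivative A, where (A x) i j is the
   distributional partial derivative of f_j in the i-th variable. *)
Definition sobolev_loc (p : R) (Omega : set 'rV[R]_n)
    (f : 'rV[R]_n -> 'rV[R]_n) (A : 'rV[R]_n -> 'M[R]_n) : Prop :=
  (forall j, Lp_loc p Omega (component f j)) /\
  forall i j, weak_partial Omega i (component f j) (fun x => A x i j) /\
    Lp_loc p Omega (fun x => A x i j).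

Definition quasiregular (K : R) (Omega : set 'rV[R]_n)
    (f : 'rV[R]_n -> 'rV[R]_n) : Prop :=
  (forall x, Omega x -> {for x, continuous f}) /\
  exists A, sobolev_loc n%:R Omega f A /\
    {ae lebesgue_rV n, forall x, Omega x ->
       opnorm (A x) ^+ n <= K * \det (A x)}.

Definition inv_harmonic_quasiregular (K : R) (f : 'rV[R]_n -> 'rV[R]_n) : Prop :=
  quasiregular K (eball n) f /\
  forall j, invariant_harmonic (component f j).

End quasiregular.

(* Main.v *)
From HB Require Import structures.
Require Import Defs.
From mathcomp Require Import all_boot all_order all_algebra.
From mathcomp Require Import all_classical all_reals all_analysis.
From mathcomp Require Import measurable_realfun.
From mathcomp Require Import ring lra.

Set Implicit Arguments.
Unset Strict Implicit.
Unset Printing Implicit Defensive.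

Import Order.TTheory GRing.Theory Num.Theory.
Import numFieldNormedType.Exports.

Local Open Scope classical_set_scope.
Local Open Scope ring_scope.

(* Write Delta_h for the invariant Laplacian.  The r-derivative of the mean of u
   over the sphere of radius r is a positive multiple of the flux of
   (1 - |x|^2)^(2-n) grad u, a field whose divergence is a positive multiple of
   Delta_h u; so u(0) is at most the spherical means of u when Delta_h u >= 0.
   Hadamard's inequality turns |f'|^n <= K J_f into |grad f_i| <= K |grad f_j|.
   For p <= 2 this makes
     C (f_j^2 + e)^(p/2) - (sum_i f_i^2 + e)^(p/2),  C = (1 + (n-1) K^2) / (p-1),
   subharmonic for Delta_h, and the mean value inequality with e -> 0 is (B_1).
   For p > 2 put u = (f_i - f_i(0)) / K, X = (f_j^2 + e^2)^(1/2) and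
   Y = (u^2 + e^2)^(1/2).  Burkholder's function p X (X+Y)^(p-1) - (X+Y)^p is
   subharmonic, nonnegative at 0, and at most c X^p - Y^p / 2; its mean therefore
   bounds the L^p norm of u by that of f_j, and Minkowski's inequality gives (B_2).
   For the sharpness, 1 / (1 - z) is conformal on the disc, its real part is
   positive and harmonic, hence in H^1, but it is not in H^1 itself. *)

(** * Topology and Euclidean geometry of R^n *)

(** The surface measure is only given as a normalized cone measure, so neither charts nor a
    divergence theorem are at hand on spheres. A spherical mean is therefore read as a volume mean
    of a function constant along rays, and the one fact drawn from integration by parts is that the
    rotation fields [z_i d_j - z_j d_i] have mean zero: they kill every radial function, hence also
    the cutoffs needed near the origin and the boundary. Applied to [z_i D_j u(r z)] and summed,
    this is the polar form of the Laplacian in the mean. The distortion inequality holds almost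
    everywhere and for weak derivatives, whereas the gradient comparison is needed at every point.
    The coordinates are [C^2], so weak and classical derivatives agree almost everywhere, and
    continuity does the rest. Powers of absolute values need not be [C^2] at zeros; this is why a
    positive [e] regularizes them. In the first estimate, [p - 1] is the least convexity that
    remains of [|f_j|^p], and [1 + (n-1) K^2] compares the full squared gradient with that of
    [f_j]. *)

Section rV_topology.
Context {R : realType}.

Lemma norm_rVE n (x : 'rV[R]_n) :
  `|x| = \big[Num.max/0]_(i : 'I_1 * 'I_n) `|x i.1 i.2|.
Proof. exact: mx_normrE. Qed.

Lemma ball_rVP n (x y : 'rV[R]_n) (e : R) : 0 < e ->
  ball x e y <-> forall i, `|x 0 i - y 0 i| < e.
Proof.
move=> e0; rewrite mx_norm_ball /ball_ /= norm_rVE; split.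
  move=> H i; apply: le_lt_trans H.
  by have := le_bigmax 0 (fun i => `|(x - y) i.1 i.2|) (0, i); rewrite !mxE.
move=> H; apply/bigmax_ltP; split => // -[k i] _ /=.
by rewrite ord1 !mxE.
Qed.

Lemma coord_le_norm n (x : 'rV[R]_n) i : `|x 0 i| <= `|x|.
Proof.
rewrite norm_rVE.
exact: (le_bigmax 0 (fun i : 'I_1 * 'I_n => `|x i.1 i.2|) (0, i)).
Qed.

Lemma measurable_ball_rV n (x : 'rV[R]_n) (e : R) : 0 < e -> measurable (ball x e).
Proof.
move=> e0.
rewrite (_ : ball x e = \big[setI/setT]_(i < n)
   ((fun y : 'rV[R]_n => y 0 i) @^-1` ball (x 0 i) e)); last first.
  apply/seteqP; split => y; rewrite -bigcap_seq/=.
    by move/(ball_rVP _ _ e0) => H i _; exact: H.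
  by move=> H; apply/(ball_rVP _ _ e0) => i; apply: (H i); rewrite /= mem_index_enum.
apply: bigsetI_measurable => i _; rewrite -[X in measurable X]setTI.
by apply: measurable_coord => //; exact: measurable_ball.
Qed.

(** The sigma-algebra is generated by the coordinates, so open sets must be reached by a countable
    process: [A] is the union of the sup-norm balls with rational centre and radius [1/(k+1)] that
    it contains. *)
Lemma open_measurable_rV n (A : set 'rV[R]_n) : open A -> measurable A.
Proof.
move=> oA.
pose F (q : 'rV[rat]_n * nat) : set 'rV[R]_n :=
  [set y | ball (map_mx ratr q.1 : 'rV[R]_n) q.2.+1%:R^-1 y /\
    ball (map_mx ratr q.1 : 'rV[R]_n) q.2.+1%:R^-1 `<=` A].
rewrite (_ : A = \bigcup_q F q); last first.
  apply/seteqP; split => x; last by move=> [q _ [xq]]; exact.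
  move=> Ax; have /nbhs_ballP[e /= e0 xeA] := open_nbhs_nbhs (conj oA Ax).
  (* A ball of radius below [e / 2] that contains [x] lies within [e] of [x], whatever its
     centre. *)
  have [k ke] : exists k, k.+1%:R^-1 < e / 2.
    have e20 : 0 < e / 2 by rewrite divr_gt0.
    have [k _ kP] := near_infty_natSinv_lt (PosNum e20).
    by exists k; exact: (kP k (leqnn k)).
  have k0 : (0 : R) < k.+1%:R^-1 by rewrite invr_gt0.
  have /choice[q qP] : forall i, exists q : rat, `|ratr q - x 0 i| < k.+1%:R^-1.
    move=> i.
    have Hne : ball (x 0 i) (k.+1%:R^-1) !=set0 by exists (x 0 i); exact: ballxx.
    have [z [Hb [q _ Eq]]] := @dense_rat R _ Hne (ball_open (x 0 i) k.+1%:R^-1).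
    by exists q; move: Hb; rewrite -Eq /ball/= distrC.
  exists (\row_i q i, k) => //; split => /=.
    by apply/ball_rVP => // i; rewrite !mxE.
  apply: subset_trans xeA => y yq; apply/ball_rVP => // i.
  move/(ball_rVP _ _ k0) : yq => /(_ i); rewrite !mxE => yq.
  have -> : x 0 i - y 0 i = (x 0 i - ratr (q i)) + (ratr (q i) - y 0 i) by ring.
  apply: le_lt_trans (ler_normD _ _) _.
  rewrite (splitr e) ltrD//; last exact: lt_trans yq ke.
  by rewrite distrC (lt_trans (qP i)).
apply: countable_bigcupT_measurable; first exact: countableP.
move=> q; rewrite /F.
have [sA|nsA] := pselect (ball (map_mx ratr q.1 : 'rV[R]_n) q.2.+1%:R^-1 `<=` A).
  rewrite (_ : [set _ | _] = ball (map_mx ratr q.1 : 'rV[R]_n) q.2.+1%:R^-1).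
    by apply: measurable_ball_rV; rewrite invr_gt0.
  by apply/seteqP; split => y //= [].
by rewrite (_ : [set _ | _] = set0)//; apply/seteqP; split => y //= [].
Qed.

(** Continuity is meant in the ambient space at the points of [D], so within [D] the preimage of an
    open interval coincides with the interior of that preimage. This covers thin sets such as the
    sphere. *)
Lemma continuous_at_measurable n (D : set 'rV[R]_n) (f : 'rV[R]_n -> R) :
  measurable D -> (forall x, D x -> {for x, continuous f}) -> measurable_fun D f.
Proof.
move=> mD cf; apply: (measurability _ (RGenOpens.measurableE R)).
move=> _ [_ [a [b ->]] <-].
rewrite (_ : D `&` _ = D `&` (f @^-1` `]a, b[)°).
  by apply: measurableI => //; apply: open_measurable_rV; exact: open_interior.
apply/seteqP; split => x [Dx fx]; split => //; last exact: interior_subset fx.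
by apply: cf => //; apply: open_nbhs_nbhs; split => //; exact: interval_open.
Qed.

Lemma continuous_measurable_rV n (f : 'rV[R]_n -> R) :
  continuous f -> measurable_fun setT f.
Proof. by move=> cf; apply: continuous_at_measurable => *; [exact: measurableT|exact: cf]. Qed.

End rV_topology.

Section geometry.
Context {R : realType}.

Lemma dotpC n (x y : 'rV[R]_n) : dotp x y = dotp y x.
Proof. by apply: eq_bigr => i _; rewrite mulrC. Qed.

Lemma dotp_ge0 n (x : 'rV[R]_n) : 0 <= dotp x x.
Proof. by apply: sumr_ge0 => i _; rewrite -expr2 sqr_ge0. Qed.

Lemma enorm_ge0 n (x : 'rV[R]_n) : 0 <= enorm x.
Proof. exact: sqrtr_ge0. Qed.

Lemma sqr_enorm n (x : 'rV[R]_n) : enorm x ^+ 2 = dotp x x.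
Proof. by rewrite sqr_sqrtr// dotp_ge0. Qed.

Lemma dotpZl n (a : R) (x y : 'rV[R]_n) : dotp (a *: x) y = a * dotp x y.
Proof. by rewrite mulr_sumr; apply: eq_bigr => i _; rewrite mxE mulrA. Qed.

Lemma dotpZr n (a : R) (x y : 'rV[R]_n) : dotp x (a *: y) = a * dotp x y.
Proof. by rewrite dotpC dotpZl dotpC. Qed.

Lemma dotpDl n (x y z : 'rV[R]_n) : dotp (x + y) z = dotp x z + dotp y z.
Proof. by rewrite -big_split; apply: eq_bigr => i _; rewrite mxE mulrDl. Qed.

Lemma dotpDr n (x y z : 'rV[R]_n) : dotp z (x + y) = dotp z x + dotp z y.
Proof. by rewrite dotpC dotpDl !(dotpC z). Qed.

Lemma dotpBl n (x y z : 'rV[R]_n) : dotp (x - y) z = dotp x z - dotp y z.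
Proof. by rewrite -scaleN1r dotpDl dotpZl mulN1r. Qed.

Lemma dotpBr n (x y z : 'rV[R]_n) : dotp z (x - y) = dotp z x - dotp z y.
Proof. by rewrite dotpC dotpBl !(dotpC z). Qed.

Lemma enormZ n (a : R) (x : 'rV[R]_n) : enorm (a *: x) = `|a| * enorm x.
Proof. by rewrite /enorm dotpZl dotpZr mulrA -expr2 sqrtrM ?sqr_ge0// sqrtr_sqr. Qed.

Lemma dotp0 n (x : 'rV[R]_n) : dotp 0 x = 0.
Proof. by rewrite /dotp big1// => i _; rewrite mxE mul0r. Qed.

Lemma enorm0 n : enorm (0 : 'rV[R]_n) = 0.
Proof. by rewrite /enorm dotp0 sqrtr0. Qed.

Lemma coord_le_enorm n (x : 'rV[R]_n) i : `|x 0 i| <= enorm x.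
Proof.
rewrite -ler_sqr ?nnegrE ?enorm_ge0// sqr_enorm /dotp (bigD1 i)//= -normrX expr2.
by rewrite ger0_norm -?expr2 ?sqr_ge0// lerDl sumr_ge0// => j _; rewrite -expr2 sqr_ge0.
Qed.

Lemma norm_le_enorm n (x : 'rV[R]_n) : `|x| <= enorm x.
Proof.
rewrite norm_rVE; apply/bigmax_leP; split; first exact: enorm_ge0.
by move=> [k i] _ /=; rewrite ord1 coord_le_enorm.
Qed.

Lemma enorm_eq0 n (x : 'rV[R]_n) : (enorm x == 0) = (x == 0).
Proof.
apply/eqP/eqP => [x0|->]; last exact: enorm0.
by apply/eqP; rewrite -normr_eq0 eq_le normr_ge0 andbT -x0 norm_le_enorm.
Qed.

Lemma enorm_gt0 n (x : 'rV[R]_n) : (0 < enorm x) = (x != 0).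
Proof. by rewrite lt_neqAle enorm_ge0 andbT eq_sym enorm_eq0. Qed.

Lemma cauchy_schwarz n (x y : 'rV[R]_n) : `|dotp x y| <= enorm x * enorm y.
Proof.
rewrite -ler_sqr ?nnegrE ?mulr_ge0 ?enorm_ge0// exprMn !sqr_enorm -normrX.
rewrite ger0_norm ?sqr_ge0//.
have [y0|y0] := eqVneq (dotp y y) 0.
  have /eqP : enorm y = 0 by rewrite /enorm y0 sqrtr0.
  by rewrite enorm_eq0 => /eqP ->; rewrite (dotpC x) !dotp0 expr0n mulr0.
have yp : 0 < dotp y y by rewrite lt_neqAle eq_sym y0 dotp_ge0.
(* The squared norm of [|y|^2 x - <x, y> y] is [|y|^2] times the Gram determinant of [x] and [y]. *)
have := dotp_ge0 (dotp y y *: x - dotp x y *: y).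
rewrite !(dotpBl, dotpBr, dotpZl, dotpZr) (dotpC y x).
set a := dotp x x; set b := dotp x y; set c := dotp y y => H.
have : 0 <= c * (a * c - b ^+ 2) by apply: le_trans H _; rewrite le_eqVlt; apply/orP; left; apply/eqP; ring.
by rewrite pmulr_rge0// subr_ge0.
Qed.

Lemma coord_continuous_rV n (i : 'I_n) : continuous (fun x : 'rV[R]_n => x 0 i).
Proof. exact: coord_continuous. Qed.

Lemma add_continuous (T : topologicalType) (f g : T -> R) x :
  {for x, continuous f} -> {for x, continuous g} ->
  {for x, continuous (fun y => f y + g y)}.
Proof. by move=> cf cg; apply: cvgD. Qed.

Lemma mul_continuous (T : topologicalType) (f g : T -> R) x :
  {for x, continuous f} -> {for x, continuous g} ->
  {for x, continuous (fun y => f y * g y)}.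
Proof. by move=> cf cg; apply: cvgM. Qed.

Lemma opp_continuous_fun (T : topologicalType) (f : T -> R) x :
  {for x, continuous f} -> {for x, continuous (fun y => - f y)}.
Proof. by move=> cf; apply: cvgN. Qed.

Lemma norm_continuous_fun (T : topologicalType) (f : T -> R) x :
  {for x, continuous f} -> {for x, continuous (fun y => `|f y|)}.
Proof. by move=> cf; apply: cvg_norm. Qed.

Lemma sum_continuous (T : topologicalType) n (f : 'I_n -> T -> R) x :
  (forall i, {for x, continuous (f i)}) ->
  {for x, continuous (fun y => \sum_(i < n) f i y)}.
Proof.
move=> cf; elim: n f cf => [|n ih] f cf.
  rewrite (_ : (fun _ => _) = cst 0); first exact: cst_continuous.
  by apply/funext => y; rewrite big_ord0.
rewrite (_ : (fun _ => _) =
  (fun y => \sum_(i < n) f (widen_ord (leqnSn n) i) y + f ord_max y)); last first.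
  by apply/funext => y; rewrite big_ord_recr.
by apply: cvgD; [apply: ih => i; exact: cf|exact: cf].
Qed.

Lemma dotp_continuous n : continuous (fun x : 'rV[R]_n => dotp x x).
Proof.
move=> x; apply: sum_continuous => i.
by apply: mul_continuous; exact: coord_continuous_rV.
Qed.

Lemma enorm_continuous n : continuous (@enorm R n).
Proof.
move=> x; apply: (@continuous_comp _ _ _ (fun x => dotp x x) (@Num.sqrt R)).
  exact: dotp_continuous.
exact: sqrt_continuous.
Qed.

Lemma open_enorm_lt n (r : R) : open [set x : 'rV[R]_n | enorm x < r].
Proof.
have /continuousP := @enorm_continuous n.
by move=> /(_ [set x | x < r]); apply; exact: open_lt.
Qed.

Lemma open_eball n : open (@eball R n).
Proof. exact: open_enorm_lt. Qed.

Lemma eball0 n : eball n (0 : 'rV[R]_n).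
Proof. by rewrite /eball/= enorm0 ltr01. Qed.

Lemma eballZ n (r : R) (x : 'rV[R]_n) : 0 <= r < 1 -> enorm x <= 1 -> eball n (r *: x).
Proof.
move=> /andP[r0 r1] x1; rewrite /eball/= enormZ ger0_norm//.
by apply: le_lt_trans r1; rewrite -[leRHS]mulr1 ler_wpM2l.
Qed.

Lemma compact_enorm_le n (r : R) : compact [set x : 'rV[R]_n | enorm x <= r].
Proof.
apply: bounded_closed_compact.
  exists r; split; first exact: num_real.
  by move=> M rM x /= xr; apply: le_trans (norm_le_enorm x) _; exact: le_trans (ltW rM).
move/continuous_closedP : (@enorm_continuous n) => /(_ [set x | x <= r]).
by apply; exact: closed_le.
Qed.

Lemma compact_esphere n : compact (@esphere R n).
Proof.
apply: (subclosed_compact _ (@compact_enorm_le n 1)).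
  move/continuous_closedP : (@enorm_continuous n) => /(_ [set 1]).
  by apply; exact: closed_eq.
by move=> x /= ->.
Qed.

Lemma measurable_esphere n : measurable (@esphere R n).
Proof.
rewrite -[esphere n]setCK; apply: measurableC; apply: open_measurable_rV.
apply: closed_openC; apply: compact_closed; first exact: norm_hausdorff.
exact: compact_esphere.
Qed.

Lemma closed_measurable_rV n (A : set 'rV[R]_n) : closed A -> measurable A.
Proof.
move=> cA; rewrite -[A]setCK; apply: measurableC; apply: open_measurable_rV.
exact: closed_openC.
Qed.

Lemma compact_measurable_rV n (A : set 'rV[R]_n) : compact A -> measurable A.
Proof.
move=> cA; apply: closed_measurable_rV; exact: compact_closed.
Qed.

Lemma compact_bounded_fun n (C : set 'rV[R]_n) (f : 'rV[R]_n -> R) :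
  compact C -> (forall x, C x -> {for x, continuous f}) ->
  exists2 M, 0 <= M & forall x, C x -> `|f x| <= M.
Proof.
move=> cC cf.
have [->|/set0P C0] := eqVneq C set0; first by exists 0.
have cfC : {within C, continuous (fun x => `|f x|)}.
  apply: continuous_in_subspaceT => x; rewrite inE => Cx.
  by apply: norm_continuous_fun; exact: cf.
have [c _ cP] := EVT_max_rV C0 cC cfC.
by exists `|f c| => // x Cx; apply: cP; rewrite inE.
Qed.

End geometry.

(** * Lebesgue measure on R^n *)

Section bounded_support.
Context d (T : measurableType d) (R : realType) (mu : {measure set T -> \bar R}).

Lemma bounded_support_integrable (f : T -> R) (A : set T) (M : R) :
  measurable A -> (mu A < +oo)%E -> measurable_fun setT f ->
  (forall x, A x -> `|f x| <= M) -> (forall x, ~ A x -> f x = 0) ->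
  mu.-integrable setT (EFin \o f).
Proof.
move=> mA Aoo mf fM fA.
have fE : f = f \_ A.
  apply/funext => x; rewrite patchE; case: ifPn => // /negP.
  by rewrite inE => /fA.
have -> : EFin \o f = (EFin \o f) \_ A.
  by rewrite [in LHS]fE restrict_EFin.
apply/(integrable_mkcond _ mA).
apply: measurable_bounded_integrable => //; first exact: measurable_funTS.
exists M; split; first exact: num_real.
by move=> N MN x /fM; move=> h; exact: le_trans h (ltW MN).
Qed.

End bounded_support.

Section lebesgue_rV_theory.
Context {R : realType}.

Lemma cons_rV_ord0 n (a : measurableTypeR R) (v : 'rV[R]_n) :
  cons_rV (a, v) 0 ord0 = a.
Proof. by have := congr1 fst (cons_rVK (a, v)). Qed.

Lemma cons_rV_lift n (a : measurableTypeR R) (v : 'rV[R]_n) (i : 'I_n) :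
  cons_rV (a, v) 0 (lift ord0 i) = v 0 i.
Proof.
have := congr1 (fun p : _ * 'rV[R]_n => p.2 0 i) (cons_rVK (a, v)); rewrite /= mxE => <-.
by congr (cons_rV _ _ _); apply/val_inj.
Qed.

(** One unfolding of the recursion behind [lebesgue_rV]; iterating it evaluates the volume of any
    box. *)
Lemma lebesgue_rV_boxS n (A : 'I_n.+1 -> set R) :
  (forall i, measurable (A i)) ->
  lebesgue_rV n.+1 [set x | forall i, A i (x 0 i)] =
  (lebesgue_measure (A ord0) *
   lebesgue_rV n [set v : 'rV[R]_n | forall i : 'I_n, A (lift ord0 i) (v 0%R i)])%E.
Proof.
move=> mA; rewrite -product_measure1E; last 2 first.
- exact: mA.
- rewrite (_ : [set _ | _] = \big[setI/setT]_(i < n)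
     ((fun y : 'rV[R]_n => y 0 i) @^-1` A (lift ord0 i))); last first.
    apply/seteqP; split => y; rewrite -bigcap_seq/=; first by move=> H i _; exact: H.
    by move=> H i; apply: (H i); rewrite /= mem_index_enum.
  apply: bigsetI_measurable => i _; rewrite -[X in measurable X]setTI.
  by apply: measurable_coord => //; exact: mA.
rewrite /= /lebesgue_step /pushforward; apply: (congr1 (lebesgue_measure \x lebesgue_rV n)%E).
apply/seteqP; split => -[a v] /= => [H|[H0 H] i].
  split; first by have := H ord0; rewrite cons_rV_ord0.
  by move=> i; have := H (lift ord0 i); rewrite cons_rV_lift.
have [j ->|->] := unliftP ord0 i; first by rewrite cons_rV_lift; exact: H.
by rewrite cons_rV_ord0.
Qed.

Lemma lebesgue_rV0 : lebesgue_rV 0 (setT : set 'rV[R]_0) = 1%E.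
Proof. by rewrite /= diracT. Qed.

Lemma lebesgue_rV_box_lty n (A : 'I_n -> set R) :
  (forall i, measurable (A i)) -> (forall i, (lebesgue_measure (A i) < +oo)%E) ->
  (lebesgue_rV n [set x : 'rV[R]_n | forall i, A i (x 0%R i)] < +oo)%E.
Proof.
elim: n A => [|n ih] A mA Aoo.
  rewrite (_ : [set _ | _] = setT); first by rewrite lebesgue_rV0 ltry.
  by apply/seteqP; split => // x _ [].
rewrite lebesgue_rV_boxS; last exact: mA.
rewrite lte_mul_pinfty//.
  by rewrite ge0_fin_numE.
exact: (ih (fun i => A (lift ord0 i))).
Qed.

Lemma lebesgue_rV_box_gt0 n (A : 'I_n -> set R) :
  (forall i, measurable (A i)) -> (forall i, (0 < lebesgue_measure (A i))%E) ->
  (0 < lebesgue_rV n [set x : 'rV[R]_n | forall i, A i (x 0%R i)])%E.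
Proof.
elim: n A => [|n ih] A mA A0.
  rewrite (_ : [set _ | _] = setT); first by rewrite lebesgue_rV0.
  by apply/seteqP; split => // x _ [].
rewrite lebesgue_rV_boxS; last exact: mA.
by rewrite mule_gt0//; exact: (ih (fun i => A (lift ord0 i))).
Qed.

Definition cube n (M : R) : set 'rV[R]_n := [set x | forall i, `|x 0 i| <= M].
Arguments cube n M : clear implicits.

Lemma cubeE n M : cube n M = [set x | forall i, (x 0 i) \in `[- M, M]].
Proof.
by apply/seteqP; split => x /= H i; have := H i; rewrite in_itv/= -ler_norml.
Qed.

Lemma compact_cube n M : compact (cube n M).
Proof. by rewrite cubeE; apply: (@rV_compact _ _ (fun=> [set` `[- M, M]])) => i; exact: segment_compact. Qed.

Lemma measurable_cube n M : measurable (cube n M).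
Proof. by apply: compact_measurable_rV; exact: compact_cube. Qed.

Lemma lebesgue_cube n M : (lebesgue_rV n (cube n M) < +oo)%E.
Proof.
rewrite cubeE; apply: (@lebesgue_rV_box_lty n (fun=> [set` `[- M, M]])) => i; first exact: measurable_itv.
by rewrite lebesgue_measure_itv/=; case: ifPn => _; rewrite ltry.
Qed.

(** A sup-norm ball inside [A] is a product of intervals of positive length. This is what later
    extracts a point of an open set from an almost everywhere statement. *)
Lemma lebesgue_open_gt0 n (A : set 'rV[R]_n) x :
  open A -> A x -> (0 < lebesgue_rV n A)%E.
Proof.
move=> oA Ax; have /nbhs_ballP[e /= e0 xeA] := open_nbhs_nbhs (conj oA Ax).
have xeE : ball x e = [set y | forall i, ball (x 0 i) e (y 0 i)].
  by apply/seteqP; split => y /(ball_rVP _ _ e0).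
apply: (@lt_le_trans _ _ (lebesgue_rV n (ball x e))).
  rewrite xeE; apply: (@lebesgue_rV_box_gt0 n (fun i => ball (x 0 i) e)) => i; first exact: measurable_ball.
  by rewrite lebesgue_measure_ball ?ltW// lte_fin pmulrn_lgt0.
by apply: le_measure => //; rewrite inE; [exact: measurable_ball_rV|exact: open_measurable_rV].
Qed.

Lemma eball_cube n : eball n `<=` cube n (1 : R).
Proof. by move=> x /ltW x1 i; exact: le_trans (coord_le_enorm _ _) x1. Qed.

Lemma lebesgue_eball_lty n : (lebesgue_rV n (@eball R n) < +oo)%E.
Proof.
apply: le_lt_trans (lebesgue_cube n 1); apply: le_measure; rewrite ?inE.
- exact: measurable_eball.
- exact: measurable_cube.
- exact: eball_cube.
Qed.

Lemma lebesgue_eball_gt0 n : (0 < lebesgue_rV n (@eball R n))%E.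
Proof. exact: (lebesgue_open_gt0 (@open_eball R n) (eball0 n)). Qed.

(** Along [w] the map [c] moves with constant velocity [v], so both difference quotients are the
    same function of [h]. *)
Lemma is_derive_line (U V W : normedModType R) (c : U -> V) (F : V -> W) a w v d :
  (forall h : R, c (h *: w + a) = h *: v + c a) ->
  is_derive (c a) v F d -> is_derive a w (F \o c) d.
Proof.
move=> Hc [dF Fd].
have E : (fun h : R => h^-1 *: (((F \o c) \o shift a) (h *: w) - (F \o c) a)) =
    (fun h => h^-1 *: ((F \o shift (c a)) (h *: v) - F (c a))).
  by apply/funext => h /=; rewrite Hc.
by split; [rewrite /derivable E|rewrite /derive E].
Qed.

(** The fundamental theorem of calculus on an interval whose endpoints lie where [F] vanishes. *)
Lemma integral_derive0 (F G : R -> R) (M : R) :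
  continuous G -> (forall x : R, is_derive x 1 F (G x)) ->
  (forall x, M < `|x| -> F x = 0) ->
  (\int[lebesgue_measure]_x (G x)%:E = 0)%E.
Proof.
move=> cG FG F0.
have G0 x : M < `|x| -> G x = 0.
  move=> Mx; have : is_derive x 1 F 0.
    apply: (@near_eq_is_derive R R R (cst 0) F x 1 0).
    have : \forall y \near x, M < `|y|.
      exact: (cvgr_gt _ (@norm_continuous _ _ x)).
    by apply: filterS => y /F0.
  by move=> H; have := FG x => /@derive_val <-; exact: derive_val.
(* The absolute value keeps [[-N, N]] nondegenerate when [M] is negative. *)
pose N := `|M| + 1.
have MN : M < N by rewrite (le_lt_trans (ler_norm _))// ltrDl.
have N0 : 0 < N by apply: lt_le_trans ltr01 _; rewrite lerDr.
have GE : EFin \o G = ((EFin \o G) \_ `[- N, N]).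
  apply/funext => x; rewrite patchE; case: ifPn => //= /negP.
  rewrite inE/= in_itv/= -ler_norml => /negP; rewrite -ltNge => Nx.
  by rewrite G0// (lt_trans MN).
rewrite (_ : (fun x => (G x)%:E) = EFin \o G)// GE -integral_mkcond.
have dF x : derivable F x 1 by have [] := FG x.
have cF x : F @ x --> F x.
  by apply: differentiable_continuous; exact/derivable1_diffP.
rewrite (@continuous_FTC2 _ G F).
- by rewrite !F0 ?subee// ?normrN ger0_norm// ltW.
- lra.
- exact: continuous_subspaceT.
- split => //.
  + exact: cvg_at_right_filter.
  + exact: cvg_at_left_filter.
- by move=> x _; rewrite derive1E; exact: derive_val.
Qed.

End lebesgue_rV_theory.
Arguments cube {R} n M.

Section integral_partial.
Context {R : realType}.

Lemma continuous_consl n (v : 'rV[R]_n) :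
  continuous (fun a : R => cons_rV (a, v) : 'rV[R]_n.+1).
Proof.
move=> a /= A /nbhs_ballP[e /= e0 eA]; apply/nbhs_ballP; exists e => //= b ab.
apply: eA; apply/ball_rVP => // i; have [j ->|->] := unliftP ord0 i.
  by rewrite !cons_rV_lift subrr normr0.
by rewrite !cons_rV_ord0.
Qed.

Lemma continuous_consr n (a : R) :
  continuous (fun v : 'rV[R]_n => cons_rV (a, v) : 'rV[R]_n.+1).
Proof.
move=> v /= A /nbhs_ballP[e /= e0 eA]; apply/nbhs_ballP; exists e => //= w vw.
apply: eA; apply/ball_rVP => // i; have [j ->|->] := unliftP ord0 i.
  by rewrite !cons_rV_lift; exact: (ball_rVP v w e0).1.
by rewrite !cons_rV_ord0 subrr normr0.
Qed.

Lemma cons_rVD0 n (h a : R) (v : 'rV[R]_n) :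
  cons_rV (h *: 1 + a, v) = h *: basis_vec ord0 + cons_rV (a, v).
Proof.
apply/rowP => i.
have E (x y : 'rV[R]_n.+1) : (h *: x + y) 0 i = h * x 0 i + y 0 i by rewrite !mxE.
rewrite {}E /basis_vec.
have [j ->|->] := unliftP ord0 i.
  by rewrite !cons_rV_lift mxE eqxx/= mulr0 add0r.
by rewrite !cons_rV_ord0 mxE !eqxx /=.
Qed.

Lemma cons_rVDlift n (h a : R) (v : 'rV[R]_n) (j : 'I_n) :
  cons_rV (a, h *: basis_vec j + v) = h *: basis_vec (lift ord0 j) + cons_rV (a, v).
Proof.
apply/rowP => i.
have E (x y : 'rV[R]_n.+1) : (h *: x + y) 0 i = h * x 0 i + y 0 i by rewrite !mxE.
rewrite {}E /basis_vec.
have [k ->|->] := unliftP ord0 i.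
  by rewrite !cons_rV_lift !mxE eqxx/= (inj_eq (@lift_inj _ _)).
by rewrite !cons_rV_ord0 mxE eqxx/= mulr0 add0r.
Qed.

Lemma integrable_rVS n (g : 'rV[R]_n.+1 -> R) M B : measurable_fun setT g ->
  (forall x, cube n.+1 M x -> `|g x| <= B) ->
  (forall x, ~ cube n.+1 M x -> g x = 0) ->
  (lebesgue_measure \x lebesgue_rV n)%E.-integrable setT
    (fun p => (g (cons_rV p))%:E).
Proof.
move=> mg gB g0.
apply: (@bounded_support_integrable _ _ _ _ (g \o @cons_rV R n)
  (@cons_rV R n @^-1` cube n.+1 M) B) => //=.
- rewrite -[X in measurable X]setTI; apply: measurable_cons_rV => //.
  exact: measurable_cube.
- exact: (lebesgue_cube n.+1 M).
- by apply: measurableT_comp => //; exact: measurable_cons_rV.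
- by move=> p; exact: gB.
- by move=> p; exact: g0.
Qed.

Lemma integral_rVS n (g : 'rV[R]_n.+1 -> R) M B : measurable_fun setT g ->
  (forall x, cube n.+1 M x -> `|g x| <= B) ->
  (forall x, ~ cube n.+1 M x -> g x = 0) ->
  (\int[lebesgue_rV n.+1]_x (g x)%:E =
   \int[lebesgue_measure \x lebesgue_rV n]_p (g (cons_rV p))%:E)%E.
Proof.
move=> mg gB g0; apply: (@integral_pushforward _ _ _ _ _ _ (@measurable_cons_rV R n)
  (lebesgue_measure \x lebesgue_rV n)%E setT (EFin \o g)).
- exact/measurable_EFinP.
- exact: integrable_rVS gB g0.
- exact: measurableT.
Qed.

Lemma partial_off_cube n (i : 'I_n) (F G : 'rV[R]_n -> R) (M : R) :
  (forall x, is_derive x (basis_vec i) F (G x)) ->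
  (forall x, ~ cube n M x -> F x = 0) -> forall x, ~ cube n M x -> G x = 0.
Proof.
move=> FG F0 x xM; have : is_derive x (basis_vec i) F 0.
  apply: (@near_eq_is_derive R 'rV[R]_n R (cst 0) F x (basis_vec i) 0).
  have : nbhs x (~` cube n M).
    apply: open_nbhs_nbhs; split => //; apply: closed_openC.
    by apply: compact_closed; [exact: norm_hausdorff|exact: compact_cube].
  by apply: filterS => y /F0.
by move=> H; have := FG x => /@derive_val <-; exact: derive_val.
Qed.

(** Induction on the dimension by Fubini on [R x R^n]. If [i] is the first coordinate, it is
    integrated first and the one-variable statement applies; otherwise the first coordinate is
    frozen and the induction hypothesis applies to the slice. *)
Lemma integral_partial0 n (i : 'I_n) (F G : 'rV[R]_n -> R) (M : R) :
  continuous G -> (forall x, is_derive x (basis_vec i) F (G x)) ->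
  (forall x, ~ cube n M x -> F x = 0) ->
  (\int[lebesgue_rV n]_x (G x)%:E = 0)%E.
Proof.
elim: n => [|n ih] in i F G *; first by case: i.
move=> cG FG F0; have G0 := partial_off_cube FG F0.
have mG := continuous_measurable_rV cG.
have [B B0 GB] := compact_bounded_fun (@compact_cube R n.+1 M) (fun x _ => cG x).
have iG := integrable_rVS mG GB G0.
rewrite (integral_rVS mG GB G0).
have [j ij|i0] := unliftP ord0 i.
  rewrite -integral12_prod_meas1//=; apply: integral0_eq => a _.
  rewrite /fubini_F /=; apply: (ih j (fun v => F (cons_rV (a, v)))).
  - move=> v; apply: (@continuous_comp _ _ _ (fun v : 'rV[R]_n => cons_rV (a, v)) G).
      exact: continuous_consr.
    exact: cG.
  - move=> v; apply: (@is_derive_line _ _ _ _ (fun v : 'rV[R]_n => cons_rV (a, v)) F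
      v (basis_vec j) (basis_vec i)) => // h.
    by rewrite ij cons_rVDlift.
  - move=> v vM; apply: F0 => avM; apply: vM => k.
    by have := avM (lift ord0 k); rewrite cons_rV_lift.
rewrite -integral21_prod_meas1//=; apply: integral0_eq => v _.
rewrite /fubini_G /=; apply: (@integral_derive0 _ (fun a => F (cons_rV (a, v))) _ M).
- move=> a; apply: (@continuous_comp _ _ _ (fun a : R => cons_rV (a, v)) G).
    exact: continuous_consl.
  exact: cG.
- move=> a; apply: (@is_derive_line _ _ _ _ (fun a : R => cons_rV (a, v)) F
    a 1 (basis_vec i)) => // h.
  by rewrite i0 cons_rVD0.
- move=> a Ma; apply: F0 => avM.
  by have := avM ord0; rewrite cons_rV_ord0 leNgt Ma.
Qed.

End integral_partial.

(** * Differential calculus *)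

Section total_derivative.
Context {R : realType}.

(** The coordinates of an increment vector have either sign, hence a mean value theorem between [0]
    and [a] that does not fix their order. *)
Lemma MVT_signed (f df : R -> R) (a : R) :
  (forall t : R, `|t| <= `|a| -> is_derive t 1 f (df t)) ->
  exists2 c, `|c| <= `|a| & f a - f 0 = df c * a.
Proof.
move=> fdf.
have cf (b c : R) : (forall t, b <= t <= c -> `|t| <= `|a|) ->
    {within `[b, c], continuous f}.
  move=> bc; apply: derivable_within_continuous => t; rewrite in_itv/= => /bc.
  by move=> /fdf[].
have [a0|a0] := leP 0 a.
  have aE := ger0_norm a0.
  have H t : 0 <= t <= a -> `|t| <= `|a|.
    by move=> /andP[t0 ta]; rewrite aE ger0_norm.
  have [||c cab E] := @MVT_segment R f df 0 a a0.
  - move=> t; rewrite in_itv/= => /andP[/ltW t0 /ltW ta].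
    by apply: fdf; rewrite H// t0.
  - exact: cf.
  - by exists c; [apply: H; move: cab; rewrite in_itv|rewrite E subr0].
have aE := ltr0_norm a0.
have H t : a <= t <= 0 -> `|t| <= `|a|.
  by move=> /andP[ta t0]; rewrite aE ler0_norm// lerN2.
have [||c cab E] := @MVT_segment R f df a 0 (ltW a0).
- move=> t; rewrite in_itv/= => /andP[/ltW ta /ltW t0].
  by apply: fdf; rewrite H// t0 ta.
- exact: cf.
- exists c; first by apply: H; move: cab; rewrite in_itv.
  by rewrite -opprB E sub0r mulrN opprK.
Qed.

Lemma is_deriveP1 (V W : normedModType R) (f : V -> W) x v d :
  is_derive x v f d <-> is_derive (0 : R) 1 (fun h : R => f (h *: v + x)) d.
Proof.
have E : (fun h : R => h^-1 *: ((f \o shift x) (h *: v) - f x)) =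
  (fun h : R => h^-1 *: (((fun h : R => f (h *: v + x)) \o shift 0) (h *: 1) -
     f (0 *: v + x))).
  by apply/funext => h /=; rewrite addr0 scale0r add0r [_%:A]mulr1.
split=> -[]; rewrite /derivable /derive ?E => h1 h2.
  by split.
by split; rewrite /derivable /derive E.
Qed.

Section gradient_form.
Variables (n : nat) (g : 'rV[R]_n).

Definition gradform (h : 'rV[R]_n) : R := dotp h g.

Let gradform_linear : linear gradform.
Proof. by move=> a x y; rewrite /gradform dotpDl dotpZl. Qed.

HB.instance Definition _ := GRing.isLinear.Build _ _ _ _ gradform gradform_linear.

Lemma gradform_continuous : continuous gradform.
Proof.
move=> x; apply: sum_continuous => i; apply: mul_continuous.
  exact: coord_continuous_rV.
exact: cst_continuous.
Qed.

End gradient_form.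

Lemma expansion_diff (V W : normedModType R) (f : V -> W) (df : {linear V -> W}) x :
  continuous df ->
  (forall e : R, 0 < e ->
     \forall h \near 0, `|f (h + x) - (f x + df h)| <= e * `|h|) ->
  'd f x = df :> (V -> W) /\ differentiable f x.
Proof.
move=> cdf H.
have E : f \o shift x = cst (f x) + df +o_ 0 id.
  by apply/eqaddoP => e e0; have := H e e0.
have dE := diff_unique cdf E.
by split => //; apply/diff_locallyP; rewrite dE.
Qed.

(* Telescoping over the coordinates, one mean value theorem for each. *)
Lemma C1_expansion n (u : 'rV[R]_n -> R) (x : 'rV[R]_n) :
  (\forall y \near x, forall i, derivable u y (basis_vec i)) ->
  (forall i, {for x, continuous ('D_(basis_vec i) u)}) ->
  forall e : R, 0 < e ->
    \forall h \near (0 : 'rV[R]_n),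
      `|u (h + x) - (u x + gradform (grad u x) h)| <= e * `|h|.
Proof.
move=> du cu e e0.
(* Each of the [n] terms of the telescoping sum gets the share [e'] of [e]; the [+ 1] keeps the
   denominator positive for [n = 0]. *)
pose e' : R := e / (n%:R + 1).
have n0 : 0 < n%:R + 1 :> R by rewrite ltr_wpDl.
have e'0 : 0 < e' by rewrite divr_gt0.
have /nbhs_ballP[d /= d0 Hd] : \forall y \near x,
    forall i, derivable u y (basis_vec i) /\
      `|'D_(basis_vec i) u x - 'D_(basis_vec i) u y| < e'.
  have H2 : \forall y \near x, forall i,
      `|'D_(basis_vec i) u x - 'D_(basis_vec i) u y| < e'.
    apply: (@filter_forall _ _ _ (nbhs x)) => i; have /cvgrPdist_lt := cu i; exact.
  by near=> y => i; split; move: i; near: y.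
apply/nbhs_ballP; exists d => //= h; rewrite mx_norm_ball /ball_/= sub0r normrN => hd.
(* A path from [0] to [h] that switches on one coordinate at a time. *)
pose t (k : nat) : 'rV[R]_n := \row_i (if (i < k)%N then h 0 i else 0).
have t0 : t 0 = 0 by apply/rowP => i; rewrite !mxE.
have tn : t n = h by apply/rowP => i; rewrite !mxE ltn_ord.
have tS (k : 'I_n) : t k.+1 = h 0 k *: basis_vec k + t k.
  apply/rowP => i; rewrite !mxE eqxx/= ltnS leq_eqVlt.
  have [->|ik] := eqVneq i k; first by rewrite eqxx ltnn mulr1 addr0.
  by rewrite (negbTE (_ : (i : nat) != k)) ?mulr0 ?add0r// -(inj_eq val_inj).
have -> : u (h + x) - (u x + gradform (grad u x) h) =
    \sum_(k < n) (u (t k.+1 + x) - u (t k + x) - h 0 k * 'D_(basis_vec k) u x).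
  rewrite sumrB -(big_mkord xpredT (fun k => u (t k.+1 + x) - u (t k + x))).
  rewrite telescope_sumr// t0 tn add0r opprD addrA; congr (_ - _).
  by apply: eq_bigr => k _; rewrite mxE.
apply: le_trans (ler_norm_sum _ _ _) _.
apply: (@le_trans _ _ (\sum_(k < n) `|h| * e')); last first.
  rewrite sumr_const card_ord -mulr_natl mulrCA mulrC ler_wpM2r//.
  by rewrite /e' mulrA ler_pdivrMr//; nra.
apply: ler_sum => k _.
have Hs (s : R) : `|s| <= `|h 0 k| -> ball x d (s *: basis_vec k + (t k + x)).
  move=> shk; apply/ball_rVP => // i; apply: le_lt_trans hd.
  rewrite !mxE eqxx/= addrA opprD addrCA subrr addr0 normrN.
  have [->|ik] := eqVneq i k; first by rewrite ltnn mulr1 addr0 (le_trans shk)// coord_le_norm.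
  by rewrite mulr0 add0r; case: ifPn => _; rewrite ?normr0// coord_le_norm.
have [|c ck E] := @MVT_signed (fun s => u (s *: basis_vec k + (t k + x)))
   (fun s => 'D_(basis_vec k) u (s *: basis_vec k + (t k + x))) (h 0 k).
  move=> s sk; have [dus _] := Hd _ (Hs _ sk) k.
  apply: (@is_derive_line _ _ _ _ (fun s : R => s *: basis_vec k + (t k + x)) u s 1 (basis_vec k)).
    by move=> r; rewrite scalerDl [_%:A]mulr1 -addrA.
  exact: DeriveDef.
rewrite tS -(addrA (_ *: _) _ x); move: E; rewrite scale0r add0r => ->.
rewrite mulrC -mulrBr normrM ler_pM//; first exact: coord_le_norm.
by rewrite distrC ltW//; have [] := Hd _ (Hs _ ck) k.
Unshelve. all: by end_near. Qed.

Lemma C1_differentiable n (u : 'rV[R]_n -> R) (x : 'rV[R]_n) :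
  (\forall y \near x, forall i, derivable u y (basis_vec i)) ->
  (forall i, {for x, continuous ('D_(basis_vec i) u)}) ->
  differentiable u x.
Proof.
move=> du cu; have E := C1_expansion du cu.
by have [] := expansion_diff (@gradform_continuous n (grad u x)) E.
Qed.

Lemma rV_sum_basis n (v : 'rV[R]_n) : v = \sum_i v 0 i *: basis_vec i.
Proof. by rewrite [LHS]row_sum_delta. Qed.

Lemma diff_grad n (u : 'rV[R]_n -> R) x v :
  differentiable u x -> 'd u x v = dotp v (grad u x).
Proof.
move=> du; rewrite {1}(rV_sum_basis v) linear_sum; apply: eq_bigr => i _.
by rewrite linearZ/= -deriveE// mxE.
Qed.

(** Restricted to the line through [x] in direction [v], the map [c] becomes a function of one real
    variable, for which derivable coordinates already give differentiability; then the chain rule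
    for differentials applies. *)
Lemma is_derive_comp_rV (V : normedModType R) n (u : 'rV[R]_n -> R)
    (c : V -> 'rV[R]_n) x v (dc : 'rV[R]_n) :
  differentiable u (c x) -> (forall i, is_derive x v (fun y => c y 0 i) (dc 0 i)) ->
  is_derive x v (u \o c) (dotp dc (grad u (c x))).
Proof.
move=> du dci.
apply/is_deriveP1.
pose c' (h : R) := c (h *: v + x).
have c'0 : c' 0 = c x by rewrite /c' scale0r add0r.
have dc'i i : is_derive (0 : R) 1 (fun h => c' h 0 i) (dc 0 i).
  by have /is_deriveP1 := dci i.
have dc' : derivable c' 0 1.
  by apply/derivable_mxP => k i; rewrite ord1; have [] := dc'i i.
have Dc' : 'D_1 c' 0 = dc.
  rewrite derive_mx//; apply/rowP => i; rewrite mxE.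
  by have /@derive_val := dc'i i.
have diffc' : differentiable c' 0 by exact/derivable1_diffP.
rewrite -[fun h => _]/(u \o c').
have duc' : differentiable u (c' 0) by rewrite c'0.
split; first exact/derivable1_diffP/differentiable_comp.
rewrite deriveE; last exact: differentiable_comp.
have E1 : 'd c' 0 1 = dc by rewrite -deriveE.
by rewrite diff_comp//= E1 c'0 diff_grad.
Qed.

Section derive_rules.
Context {V : normedModType R}.
Implicit Types (f g : V -> R) (x v : V).

Lemma is_derive_comp1 (phi : R -> R) f x v (d e : R) :
  is_derive x v f d -> is_derive (f x) 1 phi e ->
  is_derive x v (fun y => phi (f y)) (e * d).
Proof.
move=> /is_deriveP1 [df Df] [dphi Dphi]; apply/is_deriveP1.
pose f' (h : R) := f (h *: v + x).
have f'0 : f' 0 = f x by rewrite /f' scale0r add0r.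
have diff1 : differentiable f' 0 by exact/derivable1_diffP.
have diff2 : differentiable phi (f' 0) by rewrite f'0; exact/derivable1_diffP.
rewrite -[fun h => _]/(phi \o f').
split; first exact/derivable1_diffP/differentiable_comp.
rewrite deriveE; last exact: differentiable_comp.
rewrite diff_comp//=.
have -> : 'd f' 0 1 = d by rewrite -deriveE.
have -> : 'd phi (f' 0) d = d * 'd phi (f' 0) 1.
  by rewrite -[in LHS](mulr1 d) -[d * 1]/(d *: 1) linearZ.
by rewrite -deriveE// f'0 Dphi mulrC.
Qed.

Lemma is_derive_add f g x v (d e : R) : is_derive x v f d -> is_derive x v g e ->
  is_derive x v (fun y => f y + g y) (d + e).
Proof. by move=> df dg; exact: is_deriveD. Qed.

Lemma is_derive_sub f g x v (d e : R) : is_derive x v f d -> is_derive x v g e ->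
  is_derive x v (fun y => f y - g y) (d - e).
Proof. by move=> df dg; exact: is_deriveB. Qed.

Lemma is_derive_opp f x v (d : R) : is_derive x v f d ->
  is_derive x v (fun y => - f y) (- d).
Proof. by move=> df; exact: is_deriveN. Qed.

Lemma is_derive_mul f g x v (d e : R) : is_derive x v f d -> is_derive x v g e ->
  is_derive x v (fun y => f y * g y) (d * g x + f x * e).
Proof.
move=> df dg; apply: is_derive_eq (is_deriveM df dg) _.
by rewrite addrC [_ *: d]mulrC.
Qed.

Lemma is_derive_const (c : R) x v : is_derive x v (fun=> c) 0.
Proof. exact: is_derive_cst. Qed.

Lemma is_derive_big n (f : 'I_n -> V -> R) (d : 'I_n -> R) x v :
  (forall i, is_derive x v (f i) (d i)) ->
  is_derive x v (fun y => \sum_i f i y) (\sum_i d i).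
Proof.
move=> df; rewrite (_ : (fun _ => _) = \sum_i f i); first exact: is_derive_sum.
by apply/funext => y; rewrite fct_sumE.
Qed.

Lemma is_derive_inv1 (t : R) : t != 0 -> is_derive t 1 (fun s : R => s^-1) (- t ^- 2).
Proof.
move=> t0; have := @is_deriveV R id t 1 1 t0 (is_derive_id _ _).
by rewrite [_ *: _]mulr1.
Qed.

Lemma is_derive_expn (t : R) k : is_derive t 1 (fun s : R => s ^+ k) (k%:R * t ^+ k.-1).
Proof.
rewrite (_ : (fun s : R => s ^+ k) = (id : R -> R) ^+ k); last first.
  by apply/funext => s; rewrite exprfctE.
by apply: is_derive_eq; rewrite [_ *: _]mulr1.
Qed.

End derive_rules.

Lemma is_derive_coord n (x v : 'rV[R]_n) i :
  is_derive x v (fun y : 'rV[R]_n => y 0 i) (v 0 i).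
Proof.
have d : differentiable (fun y : 'rV[R]_n => y 0 i) x by exact: differentiable_coord.
split; first exact: diff_derivable.
have E : (fun h : R => h^-1 *: (((fun y : 'rV[R]_n => y 0 i) \o shift x) (h *: v) - x 0 i))
   = (fun h => h^-1 * (h * v 0 i)).
  by apply/funext => h /=; rewrite !mxE addrK.
rewrite /derive E; apply: cvg_lim => //.
apply: cvg_near_cst; near=> h; rewrite mulKf//.
by near: h; exact: nbhs_dnbhs_neq.
Unshelve. all: by end_near. Qed.

End total_derivative.

(** * Smooth bump functions *)

Section bump.
Context {R : realType}.

(* The index [m] makes the family stable under differentiation. *)
Definition bump (m : nat) (t : R) : R :=
  if 0 < t then t^-1 ^+ m * expR (- t^-1) else 0.

Lemma bump_le0 m t : t <= 0 -> bump m t = 0.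
Proof. by rewrite /bump leNgt => /negbTE ->. Qed.

Lemma bump_gt0 m t : 0 < t -> bump m t = t^-1 ^+ m * expR (- t^-1).
Proof. by rewrite /bump => ->. Qed.

Lemma bump_ge0 m t : 0 <= bump m t.
Proof.
rewrite /bump; case: ifPn => // t0; apply: mulr_ge0; last exact: expR_ge0.
by rewrite exprn_ge0// invr_ge0 ltW.
Qed.

Lemma bump0_le1 t : bump 0 t <= 1.
Proof.
rewrite /bump; case: ifPn => // t0; rewrite expr0 mul1r -expR0 ler_expR.
by rewrite oppr_le0 invr_ge0 ltW.
Qed.

(** From [expR s >= (s / k) ^+ k] with [s = 1 / t] and [k = m + 2]. The order [t^2] forces the
    difference quotients of [bump m] at the origin to tend to zero. *)
Lemma bump_le_sqr m (t : R) : `|bump m t| <= m.+2%:R ^+ m.+2 * t ^+ 2.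
Proof.
rewrite ger0_norm ?bump_ge0//; have [t0|t0] := leP t 0.
  by rewrite bump_le0// mulr_ge0 ?sqr_ge0// exprn_ge0.
rewrite bump_gt0// expRN.
set k := m.+2; have k0 : (0 : R) < k%:R by rewrite ltr0n.
have E : expR t^-1 = expR (t^-1 / k%:R) ^+ k.
  by rewrite -expRM_natl mulrC divfK// gt_eqF//.
have tk0 : 0 < t^-1 / k%:R by rewrite divr_gt0// invr_gt0.
have L : (t^-1 / k%:R) ^+ k <= expR t^-1.
  rewrite E lerXn2r ?nnegrE ?expR_ge0 ?ltW//.
  by apply: lt_le_trans (expR_ge1Dx _); rewrite ltrDr.
have -> : k%:R ^+ k * t ^+ 2 = t^-1 ^+ m * ((t^-1 / k%:R) ^+ k)^-1.
  rewrite -[in RHS]exprVn invfM !invrK exprMn exprVn.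
  rewrite (_ : t ^+ k = t ^+ m * t ^+ 2); last by rewrite -exprD addn2.
  have tm0 : t ^+ m != 0 by rewrite expf_neq0// gt_eqF.
  by field.
rewrite ler_wpM2l ?exprn_ge0 ?invr_ge0 ?(ltW t0)//.
by rewrite lef_pV2 ?posrE ?expR_gt0// exprn_gt0.
Qed.

Lemma is_derive_bump m (t : R) :
  is_derive t 1 (bump m) (bump m.+2 t - m%:R * bump m.+1 t).
Proof.
have [t0|t0|->] := ltgtP t 0.
- rewrite !bump_le0 ?ltW// mulr0 subr0.
  apply: (@near_eq_is_derive R R R (cst 0) (bump m) t 1 0).
  by near=> s; rewrite bump_le0// ltW//; near: s; exact: (cvgr_lt _ (@cvg_id _ (nbhs t))).
- rewrite !bump_gt0//.
  apply: (@near_eq_is_derive R R R (fun t => t^-1 ^+ m * expR (- t^-1)) (bump m) t 1).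
    by near=> s; rewrite bump_gt0//; near: s; exact: (cvgr_gt _ (@cvg_id _ (nbhs t))).
  have tn0 : t != 0 by rewrite gt_eqF.
  have dV := is_derive_inv1 tn0.
  have := is_derive_mul (is_derive_comp1 dV (is_derive_expn _ m))
    (is_derive_comp1 (is_derive_opp dV) (is_derive_expR _)).
  move=> H; apply: is_derive_eq H _.
  by case: m => [|m]; rewrite /= ?exprVn ?exprS; field; rewrite ?expf_neq0.
(* At the origin the quadratic bound makes the quotient at most a constant times [|h|]. *)
- rewrite !bump_le0// mulr0 subr0.
  have E : (fun h : R => h^-1 *: ((bump m \o shift 0) (h *: 1) - bump m 0)) =
           (fun h => h^-1 * bump m h).
    by apply/funext => h /=; rewrite addr0 [_%:A]mulr1 (bump_le0 _ (lexx 0)) subr0.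
  have C : h^-1 * bump m h @[h --> (0 : R)^'] --> (0 : R).
    apply/cvgrPdist_le => e e0; near=> h; rewrite sub0r normrN normrM.
    have h0 : h != 0 by near: h; exact: nbhs_dnbhs_neq.
    apply: (@le_trans _ _ (`|h^-1| * (m.+2%:R ^+ m.+2 * h ^+ 2))).
      by rewrite ler_wpM2l// bump_le_sqr.
    rewrite -[h ^+ 2]real_normK ?num_real// mulrCA normfV expr2 mulKf ?normr_eq0//.
    rewrite -ler_pdivlMl ?exprn_gt0 ?ltr0n//.
    near: h; apply: dnbhs0_le; rewrite mulr_gt0 ?invr_gt0 ?exprn_gt0 ?ltr0n//.
  split; rewrite /derivable /derive E; last exact: cvg_lim.
  by apply/cvg_ex; exists 0.
Unshelve. all: by end_near. Qed.

Lemma bump_continuous m : continuous (bump m).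
Proof.
move=> t; apply: differentiable_continuous; apply/derivable1_diffP.
by have [] := is_derive_bump m t.
Qed.

Lemma bump0_cvg1 (s c : R) : 0 < s ->
  bump 0 (k%:R * s - c) @[k --> \oo] --> (1 : R).
Proof.
move=> s0; apply/cvgrPdist_le => /= e e0.
have [N NP] : exists N, forall k, (N <= k)%N -> e^-1 <= k%:R * s - c.
  exists (Num.truncn `|(e^-1 + c) / s|).+1 => k Nk.
  rewrite lerBrDr -ler_pdivrMr//; apply: le_trans (ler_norm _) _.
  apply: ltW; apply: lt_le_trans (truncnS_gt _) _.
  by rewrite ler_nat.
exists N => // k /= Nk; have tk := NP k Nk.
have ei0 : 0 < e^-1 by rewrite invr_gt0.
set t := k%:R * s - c in tk *; have t0 : 0 < t by exact: lt_le_trans tk.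
rewrite ger0_norm ?subr_ge0 ?bump0_le1// bump_gt0// expr0 mul1r.
have := expR_ge1Dx (- t^-1).
have : t^-1 <= e by rewrite -[leRHS]invrK lef_pV2 ?posrE.
lra.
Qed.

End bump.

Section smooth_functions.
Context {R : realType} (n : nat).

(** A class of functions stable under partial derivatives: class [C^k] for every [k] then follows by
    one induction, without a formula for higher derivatives. *)
Inductive smooth_rV : ('rV[R]_n -> R) -> Prop :=
| smooth_cst c : smooth_rV (fun=> c)
| smooth_bump m a b i : smooth_rV (fun x => bump m (a * x 0 i + b))
| smooth_add f g : smooth_rV f -> smooth_rV g -> smooth_rV (fun x => f x + g x)
| smooth_mul f g : smooth_rV f -> smooth_rV g -> smooth_rV (fun x => f x * g x).

Lemma smooth_continuous f : smooth_rV f -> continuous f.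
Proof.
elim=> [c|m a b i|{}f g _ cf _ cg|{}f g _ cf _ cg] x.
- exact: cst_continuous.
- apply: (@continuous_comp _ _ _ (fun x : 'rV[R]_n => a * x 0 i + b) (bump m)).
    apply: add_continuous; last exact: cst_continuous.
    apply: mul_continuous; first exact: cst_continuous.
    exact: coord_continuous_rV.
  exact: bump_continuous.
- by apply: add_continuous; [exact: cf|exact: cg].
- by apply: mul_continuous; [exact: cf|exact: cg].
Qed.

Lemma smooth_partial f i : smooth_rV f ->
  exists2 g, smooth_rV g & forall x, is_derive x (basis_vec i) f (g x).
Proof.
elim=> [c|m a b j|{}f g sf [f' sf' Df] sg [g' sg' Dg]|{}f g sf [f' sf' Df] sg [g' sg' Dg]].
- by exists (fun=> 0); [exact: smooth_cst|move=> x; exact: is_derive_const].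
- exists (fun x => (bump m.+2 (a * x 0 j + b) + - m%:R * bump m.+1 (a * x 0 j + b)) *
    (a * (basis_vec i : 'rV[R]_n) 0 j)).
    apply: smooth_mul; last exact: smooth_cst.
    apply: smooth_add; first exact: smooth_bump.
    by apply: smooth_mul; [exact: smooth_cst|exact: smooth_bump].
  move=> x; have D1 := is_derive_add (is_derive_mul (is_derive_const a x (basis_vec i))
    (is_derive_coord x (basis_vec i) j)) (is_derive_const b x (basis_vec i)).
  have D2 := is_derive_comp1 D1 (is_derive_bump m _).
  by apply: is_derive_eq D2 _; rewrite /=; ring.
- exists (fun x => f' x + g' x); first exact: smooth_add.
  by move=> x; exact: is_derive_add.
- exists (fun x => f' x * g x + f x * g' x).
    by apply: smooth_add; exact: smooth_mul.
  by move=> x; exact: is_derive_mul.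
Qed.

Lemma smooth_Ck f k : smooth_rV f -> Ck k setT f.
Proof.
elim: k f => [|k ih] f sf; first by move=> x _; exact: smooth_continuous.
split; first by move=> x _; exact: smooth_continuous.
move=> i; have [g sg Dg] := smooth_partial i sf; split.
  by move=> x _; have [] := Dg x.
rewrite (_ : 'D_(basis_vec i) f = g); first exact: ih.
by apply/funext => x; have /@derive_val := Dg x.
Qed.

Lemma smooth_prod (I : Type) (r : seq I) (F : I -> 'rV[R]_n -> R) :
  (forall i, smooth_rV (F i)) -> smooth_rV (fun x => \prod_(i <- r) F i x).
Proof.
move=> sF; elim: r => [|i r ih].
  rewrite (_ : (fun _ => _) = fun=> 1); first exact: smooth_cst.
  by apply/funext => x; rewrite big_nil.
rewrite (_ : (fun _ => _) = fun x => F i x * \prod_(i <- r) F i x).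
  exact: smooth_mul.
by apply/funext => x; rewrite big_cons.
Qed.

End smooth_functions.

(** * Spherical means *)

Section integral_transport.
Context d (T : measurableType d) (R : realType) (mu : {measure set T -> \bar R}).

Lemma integral_mscale_integrable (k : {nonneg R}) (D : set T) (f : T -> \bar R) :
  measurable D -> mu.-integrable D f ->
  (\int[mscale k mu]_(x in D) f x = k%:num%:E * \int[mu]_(x in D) f x)%E.
Proof.
move=> mD intf; have mf := measurable_int _ intf.
have E1 := integralE (mscale k mu) D f; have E2 := integralE mu D f.
rewrite E1 E2 muleBr//; last exact: integrable_add_def.
rewrite !ge0_integral_mscale//; first exact: measurable_funeneg.
exact: measurable_funepos.
Qed.

Lemma integral_mrestr_integrable (B D : set T) (mB : measurable B) (f : T -> \bar R) :
  measurable D -> (mrestr mu mB).-integrable D f ->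
  (\int[mrestr mu mB]_(x in D) f x = \int[mu]_(x in D `&` B) f x)%E.
Proof.
move=> mD intf.
rewrite (negligible_integral (measurableC mB) mD intf); last first.
  by rewrite /= /mrestr setICl measure0.
rewrite setDE setCK; apply: eq_measure_integral => A mA AB.
by rewrite /= /mrestr setIidl// => x /AB [].
Qed.

End integral_transport.

Section sphere.
Context {R : realType}.

Definition sphmean n (F : 'rV[R]_n -> R) : R :=
  \int[surface_measure n]_(z in esphere n) F z.

(** Since [direction 0 = 0] is off the sphere, this is exactly the part of the ball that [direction]
    sends to the sphere. *)
Definition punctured n : set 'rV[R]_n := eball n `\ 0.
Arguments punctured n : clear implicits.

Lemma enorm_direction n (x : 'rV[R]_n) : x != 0 -> enorm (direction x) = 1.
Proof.
move=> x0; have xp : 0 < enorm x by rewrite enorm_gt0.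
by rewrite enormZ gtr0_norm ?invr_gt0// mulVf// gt_eqF.
Qed.

Lemma direction0 n : direction (0 : 'rV[R]_n) = 0.
Proof. by rewrite /direction scaler0. Qed.

Lemma measurable_set10 n : measurable [set (0 : 'rV[R]_n)].
Proof. by apply: compact_measurable_rV; exact: compact_set1. Qed.

Lemma lebesgue_set10 n : (0 < n)%N -> lebesgue_rV n [set (0 : 'rV[R]_n)] = 0%E.
Proof.
case: n => // n _.
rewrite (_ : [set 0] = [set x : 'rV[R]_n.+1 | forall i, [set (0 : R)] (x 0 i)]).
  rewrite (@lebesgue_rV_boxS R n (fun=> [set 0])).
    by rewrite lebesgue_measure_set1 mul0e.
  by move=> i; exact: measurable_set1.
apply/seteqP; split => x /=; first by move=> -> i; rewrite mxE.
by move=> H; apply/rowP => i; rewrite mxE H.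
Qed.

Lemma direction_esphere n : @direction R n @^-1` esphere n `&` eball n = punctured n.
Proof.
apply/seteqP; split => x /=.
  move=> [x1 xB]; split => // x0; move: x1; rewrite x0 direction0.
  by rewrite /esphere/= enorm0 => /eqP; rewrite eq_sym oner_eq0.
by move=> [xB /eqP x0]; split => //; exact: enorm_direction.
Qed.

Definition ballvol n : R := fine (lebesgue_rV n (@eball R n)).

Lemma ballvolE n : lebesgue_rV n (@eball R n) = (ballvol n)%:E.
Proof. by rewrite fineK// ge0_fin_numE// lebesgue_eball_lty. Qed.

Lemma ballvol_gt0 n : 0 < ballvol n.
Proof. by rewrite -lte_fin -ballvolE lebesgue_eball_gt0. Qed.

Lemma measurable_punctured n : measurable (punctured n).
Proof. by apply: measurableD; [exact: measurable_eball|exact: measurable_set10]. Qed.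

Lemma lebesgue_punctured n : (0 < n)%N -> lebesgue_rV n (punctured n) = (ballvol n)%:E.
Proof.
move=> n0; rewrite measureD//=.
- by rewrite ballvolE (_ : _ `&` _ = [set 0]) ?lebesgue_set10 ?sube0//;
    apply/seteqP; split => [x []|x ->] //; split => //; exact: eball0.
- exact: measurable_eball.
- exact: measurable_set10.
- exact: lebesgue_eball_lty.
Qed.

Definition vinv n : {nonneg R} :=
  NngNum (ltW (eq_ind_r is_true (ballvol_gt0 n) (invr_gt0 (ballvol n)))).

Lemma vinvE n : (vinv n)%:num = (ballvol n)^-1.
Proof. by []. Qed.

Lemma surface_measureE n A : (0 < n)%N -> measurable A ->
  surface_measure n A = mscale (vinv n) (@cone_measure R n) A.
Proof.
move=> n0 mA.
have E : @cone_measure R n setT = (ballvol n)%:E.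
  by rewrite /cone_measure /pushforward preimage_setT /= /mrestr setTI ballvolE.
change (mnormalize (@cone_measure R n) (@dirac _ 'rV[R]_n 0 R) A =
  mscale (vinv n) (@cone_measure R n) A).
rewrite /mnormalize.
have -> : Measure.sort (@cone_measure R n) setT = (ballvol n)%:E by exact: E.
rewrite (gt_eqF (_ : 0 < (ballvol n)%:E)%E) ?lte_fin ?ballvol_gt0//=.
by rewrite /mscale/= muleC.
Qed.

Lemma cone_measure_lty n A : measurable A -> (@cone_measure R n A < +oo)%E.
Proof.
move=> mA; apply: le_lt_trans (lebesgue_eball_lty n).
rewrite /cone_measure /pushforward /= /mrestr; apply: le_measure; rewrite ?inE.
- apply: measurableI; last exact: measurable_eball.
  by rewrite -[X in measurable X]setTI; apply: measurable_direction.
- exact: measurable_eball.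
- by move=> x [].
Qed.

(** Undoing the definition of the surface measure: the normalization, the pushforward along
    [direction] and the restriction to the ball turn a spherical mean into the volume mean of the
    extension of [F] that is constant along rays. *)
Lemma sphere_direction_integral n (F : 'rV[R]_n -> R) (M : R) :
  (0 < n)%N -> measurable_fun (esphere n) F ->
  (forall z, esphere n z -> `|F z| <= M) ->
  [/\ (surface_measure n).-integrable (esphere n) (EFin \o F),
      (lebesgue_rV n).-integrable (punctured n) (EFin \o F \o @direction R n) &
      sphmean F = (ballvol n)^-1 * \int[lebesgue_rV n]_(x in punctured n) F (direction x)].
Proof.
move=> n0 mF FM; have mS := @measurable_esphere R n.
have bF : [bounded F x | x in esphere n].
  exists M; split; first exact: num_real.
  by move=> N MN x /FM h; exact: le_trans h (ltW MN).
(* The change of variables is applied to a function measurable on the whole space, so [F] is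
   extended by zero off the sphere. *)
pose G := F \_ (esphere n).
have mG : measurable_fun setT G by apply/(measurable_restrictT _ mS).
have GM x : `|G x| <= `|M|.
  rewrite /G patchE; case: ifPn => [/set_mem /FM h|_]; last by rewrite normr0.
  by apply: le_trans h _; exact: ler_norm.
have mGd : measurable_fun setT (G \o @direction R n).
  by apply: measurableT_comp => //; exact: measurable_direction.
have bd d (T : measurableType d) (g : T -> R) (D : set T) :
    (forall x, `|g x| <= `|M|) -> [bounded g x | x in D].
  move=> gM; exists `|M|; split; first exact: num_real.
  by move=> N MN x _; exact: le_trans (gM x) (ltW MN).
have mB := @measurable_eball R n.
have icone : (@cone_measure R n).-integrable (esphere n) (EFin \o G).
  apply: measurable_bounded_integrable => //; first exact: cone_measure_lty.
    exact: measurable_funTS.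
  exact: bd.
have mpre : measurable (@direction R n @^-1` esphere n).
  by rewrite -[X in measurable X]setTI; apply: measurable_direction.
have irestr : (mrestr (lebesgue_rV n) mB).-integrable
    (@direction R n @^-1` esphere n) (EFin \o (G \o @direction R n)).
  apply: measurable_bounded_integrable => //.
  - rewrite /= /mrestr; apply: le_lt_trans (lebesgue_eball_lty n).
    by apply: le_measure; rewrite ?inE//; exact: measurableI.
  - exact: measurable_funTS.
  - by apply: bd => x; exact: GM.
have E : (\int[surface_measure n]_(z in esphere n) (F z)%:E =
    ((ballvol n)^-1)%:E * \int[lebesgue_rV n]_(x in punctured n) (F (direction x))%:E)%E.
  transitivity (\int[mscale (vinv n) (@cone_measure R n)]_(z in esphere n) (G z)%:E)%E.
    rewrite (@eq_measure_integral _ _ _ _ (mscale (vinv n) (@cone_measure R n))).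
      by apply: eq_integral => x xS; rewrite /G patchE xS.
    by move=> A mA _; exact: surface_measureE.
  rewrite (@integral_mscale_integrable _ _ _ _ _ _ (EFin \o G))// vinvE; congr (_ * _)%E.
  rewrite (@integral_pushforward _ _ _ _ _ _ (@measurable_direction R n)
    (mrestr (lebesgue_rV n) mB) (esphere n) (EFin \o G))//; last exact/measurable_EFinP.
  rewrite integral_mrestr_integrable// direction_esphere.
  apply: eq_integral => x /set_mem [_ /eqP x0] /=; rewrite /G patchE mem_set//.
  exact: enorm_direction.
have ip : (lebesgue_rV n).-integrable (punctured n) (EFin \o F \o @direction R n).
  rewrite -direction_esphere.
  apply: (@eq_integrable _ _ _ _ _ _ (EFin \o (G \o @direction R n))).
  - exact: measurableI.
  - by move=> x /set_mem [x1 _] /=; rewrite /G patchE mem_set.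
  apply: measurable_bounded_integrable => //.
  - exact: measurableI.
  - apply: le_lt_trans (lebesgue_eball_lty n).
    by apply: le_measure; rewrite ?inE//; exact: measurableI.
  - exact: measurable_funTS.
  - by apply: bd => x; exact: GM.
split => //.
- apply: measurable_bounded_integrable => //.
  by apply: le_lt_trans (ltry 1); exact: probability_le1.
- by rewrite /sphmean /Rintegral E fineM//; exact: (integrable_fin_num (@measurable_punctured n) ip).
Qed.

End sphere.
Arguments punctured {R} n.

(** * Radial projection and radial cutoffs *)

Section rotation_fields.
Context {R : realType}.

Lemma continuous_rV (T : topologicalType) n (f : T -> 'rV[R]_n) (x : T) :
  (forall i, {for x, continuous (fun y => f y 0 i)}) -> {for x, continuous f}.
Proof.
move=> cf A /nbhs_ballP[e /= e0 eA].
have : \forall y \near x, forall i, `|f x 0 i - f y 0 i| < e.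
  apply: (@filter_forall _ _ _ (nbhs x)) => i.
  by have /cvgrPdist_lt := cf i; exact.
by apply: filterS => y H; apply: eA; apply/ball_rVP.
Qed.

Lemma inv_continuous_fun (T : topologicalType) (f : T -> R) (x : T) :
  f x != 0 -> {for x, continuous f} -> {for x, continuous (fun y => (f y)^-1)}.
Proof. by move=> fx cf; apply: cvgV. Qed.

Lemma is_derive_dotp n (x v : 'rV[R]_n) :
  is_derive x v (fun y : 'rV[R]_n => dotp y y) (2 * dotp x v).
Proof.
have H : is_derive x v (fun y : 'rV[R]_n => dotp y y)
    (\sum_i (v 0 i * x 0 i + x 0 i * v 0 i)).
  by apply: is_derive_big => i; apply: is_derive_mul; exact: is_derive_coord.
apply: is_derive_eq H _.
by rewrite big_split/= mulrDl !mul1r; congr (_ + _); apply: eq_bigr => i _; rewrite mulrC.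
Qed.

Lemma is_derive_enormV n (x v : 'rV[R]_n) : x != 0 ->
  is_derive x v (fun y => (enorm y)^-1) (- dotp x v * (enorm x)^-1 ^+ 3).
Proof.
move=> x0; have ex0 : 0 < enorm x by rewrite enorm_gt0.
have dx0 : 0 < dotp x x by rewrite -sqr_enorm exprn_gt0.
have := is_derive_comp1 (is_derive_comp1 (is_derive_dotp x v) (is_derive1_sqrt dx0))
  (is_derive_inv1 (lt0r_neq0 ex0)).
move=> H; apply: is_derive_eq H _; rewrite -/(enorm x) /=.
by field; rewrite gt_eqF.
Qed.

Lemma is_derive_direction n (x v : 'rV[R]_n) i : x != 0 ->
  is_derive x v (fun y => direction y 0 i)
    (((enorm x)^-1 *: v - (dotp x v * (enorm x)^-1 ^+ 3) *: x) 0 i).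
Proof.
move=> x0; have H := is_derive_mul (is_derive_enormV v x0) (is_derive_coord x v i).
rewrite (_ : (fun y => _) = fun y : 'rV[R]_n => (enorm y)^-1 * y 0 i); last first.
  by apply/funext => y; rewrite mxE.
by apply: is_derive_eq H _; rewrite !mxE; ring.
Qed.

Lemma enormV_continuous n (x : 'rV[R]_n) : x != 0 ->
  {for x, continuous (fun y : 'rV[R]_n => (enorm y)^-1)}.
Proof.
move=> x0; apply: inv_continuous_fun; first by rewrite enorm_eq0.
exact: enorm_continuous.
Qed.

Lemma direction_continuous n (x : 'rV[R]_n) : x != 0 ->
  {for x, continuous (@direction R n)}.
Proof.
move=> x0; apply: continuous_rV => i.
rewrite (_ : (fun y => _) = fun y : 'rV[R]_n => (enorm y)^-1 * y 0 i); last first.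
  by apply/funext => y; rewrite mxE.
by apply: mul_continuous; [exact: enormV_continuous|exact: coord_continuous_rV].
Qed.

(** Meant for [s = |x|^2]. For [k > 0] it vanishes when [s <= 1/k] or [s >= 1 - 1/k], so multiplying
    by it removes the singularity at the origin of functions constant along rays and gives them
    compact support in the ball. *)
Definition cutoff (k : nat) (s : R) : R :=
  bump 0 (k%:R * s - 1) * bump 0 (k%:R * (1 - s) - 1).

Definition dcutoff (k : nat) (s : R) : R :=
  k%:R * (bump 2 (k%:R * s - 1) * bump 0 (k%:R * (1 - s) - 1) -
    bump 0 (k%:R * s - 1) * bump 2 (k%:R * (1 - s) - 1)).

Lemma is_derive_cutoff k (s : R) : is_derive s 1 (cutoff k) (dcutoff k s).
Proof.
have D1 := is_derive_sub (is_derive_mul (is_derive_const (k%:R : R) s 1) (is_derive_id s 1))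
  (is_derive_const (1 : R) s 1).
have D2 := is_derive_sub (is_derive_mul (is_derive_const (k%:R : R) s 1)
    (is_derive_sub (is_derive_const (1 : R) s 1) (is_derive_id s 1)))
  (is_derive_const (1 : R) s 1).
have := is_derive_mul (is_derive_comp1 D1 (is_derive_bump 0 _))
  (is_derive_comp1 D2 (is_derive_bump 0 _)).
by move=> H; apply: is_derive_eq H _; rewrite /dcutoff /=; ring.
Qed.

Lemma affine_bump_continuous m (a b : R) : continuous (fun s => bump m (a * s + b)).
Proof.
move=> s; apply: (@continuous_comp _ _ _ (fun s => a * s + b) (bump m)).
  apply: add_continuous; last exact: cst_continuous.
  by apply: mul_continuous; [exact: cst_continuous|exact: cvg_id].
exact: bump_continuous.
Qed.

Lemma cutoff_bumpE m k s : bump m (k%:R * (1 - s) - 1) = bump m (- k%:R * s + (k%:R - 1) : R).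
Proof. by congr bump; ring. Qed.

Lemma cutoff_factor_continuous m k :
  continuous (fun s : R => bump m (k%:R * s - 1)) /\
  continuous (fun s : R => bump m (k%:R * (1 - s) - 1)).
Proof.
split; first exact: affine_bump_continuous.
rewrite (_ : (fun _ => _) = fun s => bump m (- k%:R * s + (k%:R - 1) : R)).
  exact: affine_bump_continuous.
by apply/funext => s; exact: cutoff_bumpE.
Qed.

Lemma cutoff_continuous k : continuous (cutoff k).
Proof.
have [c1 c2] := cutoff_factor_continuous 0 k.
by move=> s; exact: (mul_continuous (c1 s) (c2 s)).
Qed.

Lemma dcutoff_continuous k : continuous (dcutoff k).
Proof.
have [c1 c2] := cutoff_factor_continuous 0 k.
have [c3 c4] := cutoff_factor_continuous 2 k.
move=> s; apply: (mul_continuous (@cst_continuous _ _ (k%:R : R) s)).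
exact: (add_continuous (mul_continuous (c3 s) (c2 s))
  (opp_continuous_fun (mul_continuous (c1 s) (c4 s)))).
Qed.

Lemma cutoff_small k s : k%:R * s <= 1 -> cutoff k s = 0 /\ dcutoff k s = 0.
Proof.
by move=> ks; rewrite /cutoff /dcutoff ?(@bump_le0 _ _ (_ * s - 1)) ?subr_le0//
  !mul0r subr0 mulr0.
Qed.

Lemma cutoff_ge1 k s : 1 <= s -> cutoff k s = 0 /\ dcutoff k s = 0.
Proof.
move=> s1; have : k%:R * (1 - s) - 1 <= 0.
  rewrite subr_le0; apply: (@le_trans _ _ 0) => //.
  by rewrite mulr_ge0_le0// subr_le0.
by move=> H; rewrite /cutoff /dcutoff !(bump_le0 _ H) !mulr0 subr0 mulr0.
Qed.

Lemma cutoff_ge0 k s : 0 <= cutoff k s.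
Proof. by rewrite mulr_ge0// bump_ge0. Qed.

Lemma cutoff_le1 k s : cutoff k s <= 1.
Proof. by rewrite /cutoff mulr_ile1// ?bump_ge0// bump0_le1. Qed.

Lemma cutoff_cvg1 s : 0 < s < 1 -> cutoff k s @[k --> \oo] --> (1 : R).
Proof.
move=> /andP[s0 s1]; rewrite -[1]mulr1.
by apply: cvgM; apply: bump0_cvg1 => //; rewrite subr_gt0.
Qed.

End rotation_fields.

(** * Vanishing means of rotation fields *)

Section spherical_divergence.
Context {R : realType} (n : nat).
Hypothesis n0 : (0 < n)%N.
Variable G : 'rV[R]_n -> R.
Hypothesis dG : forall z, esphere n z -> differentiable G z.
Hypothesis cG : forall z i, esphere n z -> {for z, continuous ('D_(basis_vec i) G)}.

Let N := @direction R n.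

Let NS x : x != 0 -> esphere n (N x).
Proof. exact: enorm_direction. Qed.

Let rot (i j : 'I_n) (z : 'rV[R]_n) : R :=
  z 0 i * 'D_(basis_vec j) G z - z 0 j * 'D_(basis_vec i) G z.

(** The gradient of a function constant along rays: the tangential part of the gradient of [G] at
    the projected point, divided by [|x|]. *)
Let dGN (j : 'I_n) (x : 'rV[R]_n) : R :=
  (enorm x)^-1 * 'D_(basis_vec j) G (N x) -
  x 0 j * (enorm x)^-1 ^+ 3 * dotp x (grad G (N x)).

Let dotp_basis (x : 'rV[R]_n) j : dotp x (basis_vec j) = x 0 j.
Proof.
rewrite /dotp (bigD1 j)//= mxE !eqxx mulr1 big1 ?addr0// => i ij.
by rewrite mxE eqxx/= (negbTE ij) mulr0.
Qed.

Let is_derive_GN j x : x != 0 -> is_derive x (basis_vec j) (G \o N) (dGN j x).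
Proof.
move=> x0.
have H := is_derive_comp_rV (dG (NS x0))
  (fun i => is_derive_direction (basis_vec j) i x0).
apply: is_derive_eq H _.
rewrite dotpBl !dotpZl dotp_basis /dGN; congr (_ * _ - _ * _ * _).
by rewrite dotpC dotp_basis mxE.
Qed.

Let cut k (x : 'rV[R]_n) : R := cutoff k (dotp x x).

Let h k (x : 'rV[R]_n) : R := cut k x * G (N x).

Let dh k (j : 'I_n) (x : 'rV[R]_n) : R :=
  dcutoff k (dotp x x) * (2 * x 0 j) * G (N x) + cut k x * dGN j x.

Let near0 k : \forall x \near (0 : 'rV[R]_n), k%:R * dotp x x <= 1.
Proof.
have c : {for (0 : 'rV[R]_n), continuous (fun x : 'rV[R]_n => k%:R * dotp x x)}.
  by apply: mul_continuous; [exact: cst_continuous|exact: dotp_continuous].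
near=> x; apply: ltW; near: x; apply: (cvgr_lt (k%:R * dotp (0 : 'rV[R]_n) 0)) => //.
by rewrite dotp0 mulr0.
Unshelve. all: by end_near. Qed.

Let small k x : k%:R * dotp x x <= 1 -> h k x = 0 /\ forall j, dh k j x = 0.
Proof.
move=> /cutoff_small [c1 c2]; rewrite /h /dh /cut c1 c2; split => [|j].
  by rewrite mul0r.
by rewrite !mul0r addr0.
Qed.

Let large k x : 1 <= dotp x x -> h k x = 0 /\ forall j, dh k j x = 0.
Proof.
move=> /(cutoff_ge1 k) [c1 c2]; rewrite /h /dh /cut c1 c2; split => [|j].
  by rewrite mul0r.
by rewrite !mul0r addr0.
Qed.

Let is_derive_h k j x : is_derive x (basis_vec j) (h k) (dh k j x).
Proof.
(* Near the origin, where [direction] has no limit, the cutoff makes [h k] vanish identically. *)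
have [->|x0] := eqVneq x 0.
  have [h0 dh0] := small (nbhs_singleton (near0 k)).
  rewrite dh0; apply: (@near_eq_is_derive R 'rV[R]_n R (cst 0) (h k) 0 (basis_vec j) 0).
  by apply: filterS (near0 k) => y /small [].
have H := is_derive_mul (is_derive_comp1 (is_derive_dotp x (basis_vec j))
  (is_derive_cutoff k _)) (is_derive_GN j x0).
by apply: is_derive_eq H _; rewrite dotp_basis.
Qed.

Let cut_continuous k : continuous (cut k).
Proof.
move=> x; apply: (@continuous_comp _ _ _ (fun x : 'rV[R]_n => dotp x x) (cutoff k)).
  exact: dotp_continuous.
exact: cutoff_continuous.
Qed.

Let comp_direction_continuous (g : 'rV[R]_n -> R) x : x != 0 ->
  {for N x, continuous g} -> {for x, continuous (fun y => g (N y))}.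
Proof.
move=> x0 cg; apply: (@continuous_comp _ _ _ N g); last exact: cg.
exact: direction_continuous.
Qed.

Let dGN_continuous j x : x != 0 -> {for x, continuous (dGN j)}.
Proof.
move=> x0; have cV := enormV_continuous x0.
have cD i := comp_direction_continuous x0 (@cG _ i (NS x0)).
have cg : {for x, continuous (fun y => dotp y (grad G (N y)))}.
  rewrite (_ : (fun y => _) =
    fun y : 'rV[R]_n => \sum_i y 0 i * 'D_(basis_vec i) G (N y)); last first.
    by apply/funext => y; apply: eq_bigr => i _; rewrite mxE.
  apply: sum_continuous => i; apply: mul_continuous => //.
  exact: coord_continuous_rV.
have cV3 : {for x, continuous (fun y : 'rV[R]_n => (enorm y)^-1 ^+ 3)}.
  exact: (mul_continuous cV (mul_continuous cV cV)).
exact: (add_continuous (mul_continuous cV (cD j)) (opp_continuous_fun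
  (mul_continuous (mul_continuous (@coord_continuous_rV _ _ j x) cV3) cg))).
Qed.

Let dh_continuous k j : continuous (dh k j).
Proof.
move=> x; have [->|x0] := eqVneq x 0.
  have [_ dh0] := small (nbhs_singleton (near0 k)).
  apply: (@cvg_near_cst _ _ _ _ (nbhs (0 : 'rV[R]_n))); move: (near0 k); apply: filterS => y /small [_ dhy].
  by rewrite dhy dh0.
have cGN := comp_direction_continuous x0 (differentiable_continuous (dG (NS x0))).
have cd : {for x, continuous (fun y : 'rV[R]_n => dcutoff k (dotp y y))}.
  apply: (@continuous_comp _ _ _ (fun x : 'rV[R]_n => dotp x x) (dcutoff k)).
    exact: dotp_continuous.
  exact: dcutoff_continuous.
have c2 : {for x, continuous (fun y : 'rV[R]_n => 2 * y 0 j)}.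
  apply: mul_continuous; first exact: cst_continuous.
  exact: coord_continuous_rV.
have c3 := mul_continuous (mul_continuous cd c2) cGN.
have c4 := mul_continuous (@cut_continuous k x) (@dGN_continuous j _ x0).
have c5 := add_continuous c3 c4.
exact: c5.
Qed.

Let off_cube (x : 'rV[R]_n) : ~ cube n 1 x -> 1 <= dotp x x.
Proof.
move=> xc; rewrite leNgt; apply/negP => x1; apply: xc; apply: eball_cube.
by rewrite /eball/= -(@ltr_pXn2r _ 2)// ?nnegrE ?enorm_ge0// sqr_enorm expr1n.
Qed.

Let xdh k (i j : 'I_n) (x : 'rV[R]_n) : R := x 0 i * dh k j x.

(** As [i != j], the factor [x_i] is constant in direction [j], so [x_i d_j h] is the derivative
    [d_j (x_i h)] of a function supported in a cube. *)
Let partial_integral k i j : i != j ->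
  (lebesgue_rV n).-integrable setT (EFin \o xdh k i j) /\
  (\int[lebesgue_rV n]_x (xdh k i j x)%:E = 0)%E.
Proof.
move=> ij; rewrite /xdh.
have cF : continuous (fun x : 'rV[R]_n => x 0 i * dh k j x).
  by move=> x; apply: mul_continuous; [exact: coord_continuous_rV|exact: dh_continuous].
split.
  have [B B0 FB] := compact_bounded_fun (@compact_cube R n 1) (fun x _ => cF x).
  apply: (@bounded_support_integrable _ _ _ _ _ (cube n 1) B) => //.
  - exact: measurable_cube.
  - exact: lebesgue_cube.
  - exact: continuous_measurable_rV.
  - by move=> x /off_cube /(large k) [_ ->]; rewrite mulr0.
apply: (@integral_partial0 _ n j (fun x => x 0 i * h k x) _ 1) => //.
- move=> x; have H := is_derive_mul (is_derive_coord x (basis_vec j) i) (is_derive_h k j x).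
  by apply: is_derive_eq H _; rewrite mxE eqxx/= (negbTE ij) mul0r add0r.
- by move=> x /off_cube /(large k) [-> _]; rewrite mulr0.
Qed.

(** The derivative of the cutoff and the radial correction in [dGN] are both multiples of [x_j],
    hence cancel in the antisymmetric combination. *)
Let rot_cutoff k i j x : xdh k i j x - xdh k j i x = cut k x * rot i j (N x).
Proof.
have Nx l : N x 0 l = (enorm x)^-1 * x 0 l by rewrite mxE.
by rewrite /xdh /dh /rot /dGN !Nx; ring.
Qed.

Let rot_continuous z i j : esphere n z -> {for z, continuous (rot i j)}.
Proof.
move=> zS; exact: (add_continuous (mul_continuous (@coord_continuous_rV _ _ i z) (@cG _ j zS))
  (opp_continuous_fun (mul_continuous (@coord_continuous_rV _ _ j z) (@cG _ i zS)))).
Qed.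

(* The rotation fields have zero spherical mean: integrate by parts against radial
   cutoffs, which rotation fields annihilate, and let the cutoffs tend to 1. *)
Lemma sphmean_rotation i j :
  sphmean (fun z => z 0 i * 'D_(basis_vec j) G z - z 0 j * 'D_(basis_vec i) G z) = 0.
Proof.
have [->|ij] := eqVneq i j.
  rewrite /sphmean (_ : (fun z => _) = cst 0); last by apply/funext => z; rewrite subrr.
  by rewrite Rintegral_cst ?mul0r//; exact: measurable_esphere.
have mr : measurable_fun (esphere n) (rot i j).
  apply: continuous_at_measurable; first exact: measurable_esphere.
  by move=> z; exact: rot_continuous.
have [M M0 rM] := compact_bounded_fun (@compact_esphere R n)
  (fun z zS => @rot_continuous z i j zS).
have [_ ir ->] := sphere_direction_integral n0 mr rM.
rewrite /Rintegral.
have cut0 k x : ~ punctured n x -> cut k x = 0.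
  move=> xP; have [->|x0] := eqVneq x 0.
    by rewrite /cut dotp0; have [] := @cutoff_small R k 0 _; rewrite ?mulr0.
  have : 1 <= dotp x x.
    rewrite leNgt; apply/negP => x1; apply: xP; split; last exact/eqP.
    by rewrite /eball/= -(@ltr_pXn2r _ 2)// ?nnegrE ?enorm_ge0// sqr_enorm expr1n.
  by move/(cutoff_ge1 k) => [].
pose f k (x : 'rV[R]_n) := (cut k x * rot i j (N x))%:E.
have if0 k : (\int[lebesgue_rV n]_(x in punctured n) f k x = 0)%E.
  have [i1 e1] := @partial_integral k i j ij.
  have [i2 e2] : _ /\ _ := @partial_integral k j i ltac:(by rewrite eq_sym).
  have : (\int[lebesgue_rV n]_x f k x = 0)%E.
    under eq_integral do rewrite /f -rot_cutoff EFinB.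
    by rewrite integralB_EFin// e1 e2 sube0.
  move=> <-; rewrite integral_mkcond; apply: eq_integral => x _; rewrite patchE.
  by case: ifPn => // /negP; rewrite inE => /(cut0 k); rewrite /f => ->; rewrite mul0r.
have fcvg : (\int[lebesgue_rV n]_(x in punctured n) f k x)%E @[k --> \oo] -->
    (\int[lebesgue_rV n]_(x in punctured n) (rot i j (N x))%:E)%E.
  apply: (@dominated_cvg _ _ _ (lebesgue_rV n) (punctured n) _ f _ (cst M%:E)).
  - exact: measurable_punctured.
  - move=> k; apply/measurable_EFinP; apply: measurable_funM.
      by apply: measurable_funTS; apply: continuous_measurable_rV.
    by apply/measurable_EFinP; exact: measurable_int ir.
  - move=> x [xB /eqP x0]; apply: cvg_EFin; first exact: nearW.
    rewrite -[X in _ --> X]mul1r; apply: cvgMl; apply: cutoff_cvg1.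
    rewrite -sqr_enorm exprn_gt0 ?enorm_gt0//=.
    by rewrite expr_lt1// enorm_ge0.
  - by [].
  - apply: (@measurable_bounded_integrable _ _ _ (lebesgue_rV n) (cst M)) => //.
    + exact: measurable_punctured.
    + by apply: (@le_lt_trans _ _ (ballvol n)%:E); rewrite ?ltry// -lebesgue_punctured.
    + by exists `|M|; split; [exact: num_real|move=> N' /ltW MN x _].
  - move=> k x [_ /eqP x0]; rewrite lee_fin normrM.
    rewrite -[leRHS]mul1r ler_pM//; last exact/rM/NS.
    by rewrite ger0_norm ?cutoff_ge0// cutoff_le1.
have := cvg_lim (@ereal_hausdorff R) fcvg.
rewrite (_ : (fun k => _) = cst 0%E); last by apply/funext.
by rewrite lim_cst// => <-; rewrite mulr0.
Qed.

End spherical_divergence.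

(** * Linearity of spherical means and differentiation in the radius *)

Section spherical_mean_theory.
Context {R : realType} (n : nat).
Hypothesis n0 : (0 < n)%N.
Implicit Types F G : 'rV[R]_n -> R.

(** Continuity in the ambient space at the points of the sphere, which is stronger than continuity
    of the restriction to the sphere. *)
Definition sphcont F := forall z, esphere n z -> {for z, continuous F}.

Lemma sphcont_measurable F : sphcont F -> measurable_fun (esphere n) F.
Proof. by apply: continuous_at_measurable; exact: measurable_esphere. Qed.

Lemma sphcont_integrable F : sphcont F ->
  (surface_measure n).-integrable (esphere n) (EFin \o F).
Proof.
move=> cF; have [M M0 FM] := compact_bounded_fun (@compact_esphere R n) cF.
by have [] := sphere_direction_integral n0 (sphcont_measurable cF) FM.
Qed.

Lemma sphcontD F G : sphcont F -> sphcont G -> sphcont (fun z => F z + G z).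
Proof. by move=> cF cG z zS; apply: add_continuous; [exact: cF|exact: cG]. Qed.

Lemma sphcontM F G : sphcont F -> sphcont G -> sphcont (fun z => F z * G z).
Proof. by move=> cF cG z zS; apply: mul_continuous; [exact: cF|exact: cG]. Qed.

Lemma sphcont_cst (c : R) : sphcont (fun=> c).
Proof. by move=> z zS; exact: cst_continuous. Qed.

Lemma sphcont_coord i : sphcont (fun z => z 0 i).
Proof. by move=> z zS; exact: coord_continuous_rV. Qed.

Lemma sphcont_sum (I : finType) (F : I -> 'rV[R]_n -> R) :
  (forall i, sphcont (F i)) -> sphcont (fun z => \sum_i F i z).
Proof.
move=> cF; elim: (index_enum I) => [|i r ih].
  rewrite (_ : (fun _ => _) = fun=> 0); first exact: sphcont_cst.
  by apply/funext => z; rewrite big_nil.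
rewrite (_ : (fun _ => _) = fun z => F i z + \sum_(i <- r) F i z).
  exact: sphcontD.
by apply/funext => z; rewrite big_cons.
Qed.

Lemma sphcont_scale F r : `|r| < 1 -> (forall x, eball n x -> {for x, continuous F}) ->
  sphcont (fun z => F (r *: z)).
Proof.
move=> r1 cF z zS; apply: (@continuous_comp _ _ _ (fun z : 'rV[R]_n => r *: z) F).
  exact: scaler_continuous.
by apply: cF; rewrite /eball/= enormZ zS mulr1.
Qed.

Lemma sphmeanD F G : sphcont F -> sphcont G ->
  sphmean (fun z => F z + G z) = sphmean F + sphmean G.
Proof.
by move=> cF cG; apply: RintegralD; [exact: measurable_esphere|exact: sphcont_integrable..].
Qed.

Lemma sphmeanB F G : sphcont F -> sphcont G ->
  sphmean (fun z => F z - G z) = sphmean F - sphmean G.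
Proof.
by move=> cF cG; apply: RintegralB; [exact: measurable_esphere|exact: sphcont_integrable..].
Qed.

Lemma sphmeanZ (c : R) F : sphcont F -> sphmean (fun z => c * F z) = c * sphmean F.
Proof.
by move=> cF; apply: RintegralZl; [exact: measurable_esphere|exact: sphcont_integrable].
Qed.

Lemma eq_sphmean F G : (forall z, esphere n z -> F z = G z) -> sphmean F = sphmean G.
Proof. by move=> FG; apply: eq_Rintegral => z /set_mem; exact: FG. Qed.

Lemma sphmean0 : sphmean (fun _ : 'rV[R]_n => 0) = 0.
Proof. by rewrite /sphmean Rintegral_cst ?mul0r//; exact: measurable_esphere. Qed.

Lemma sphmean_sum (I : finType) (F : I -> 'rV[R]_n -> R) : (forall i, sphcont (F i)) ->
  sphmean (fun z => \sum_i F i z) = \sum_i sphmean (F i).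
Proof.
move=> cF; elim: (index_enum I) => [|i r ih].
  rewrite big_nil (_ : (fun _ => _) = fun=> 0) ?sphmean0//.
  by apply/funext => z; rewrite big_nil.
rewrite (_ : (fun _ => _) = fun z => F i z + \sum_(i <- r) F i z); last first.
  by apply/funext => z; rewrite big_cons.
rewrite big_cons sphmeanD ?ih//.
move=> z zS; elim: (r) => [|k s ih'].
  rewrite (_ : (fun _ => _) = fun=> 0); first exact: cst_continuous.
  by apply/funext => y; rewrite big_nil.
rewrite (_ : (fun _ => _) = fun z => F k z + \sum_(i <- s) F i z).
  by apply: add_continuous => //; exact: cF.
by apply/funext => y; rewrite big_cons.
Qed.

Lemma sphmean_ge0 F : (forall z, esphere n z -> 0 <= F z) -> 0 <= sphmean F.
Proof. exact: Rintegral_ge0. Qed.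

Lemma sphmean_le F G : sphcont F -> sphcont G ->
  (forall z, esphere n z -> F z <= G z) -> sphmean F <= sphmean G.
Proof.
by move=> cF cG; apply: le_Rintegral; [exact: measurable_esphere|exact: sphcont_integrable..].
Qed.

Lemma surface_esphere : surface_measure n (@esphere R n) = 1%E.
Proof.
rewrite surface_measureE//; last exact: measurable_esphere.
rewrite /mscale/= /cone_measure /pushforward/= /mrestr direction_esphere.
have -> : lebesgue_rV n (@punctured R n) = (ballvol n)%:E by exact: lebesgue_punctured.
by rewrite -EFinM mulVf// gt_eqF// ballvol_gt0.
Qed.

Lemma sphmean_cst (c : R) : sphmean (fun _ : 'rV[R]_n => c) = c.
Proof.
rewrite /sphmean Rintegral_cst; last exact: measurable_esphere.
by rewrite -[RHS]mulr1; congr (c * _); exact: (congr1 fine surface_esphere).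
Qed.

(** Differentiation under the integral for radii in []-rho, rho[] with [|a| < rho < 1]: the partial
    derivatives of [g] are bounded on the compact ball of radius [rho], which gives a constant
    dominating function. The weight [w] is [1] for the mean itself and a coordinate for its flux. *)
Lemma is_derive_sphmean (w g : 'rV[R]_n -> R) (a : R) :
  sphcont w ->
  (forall x, eball n x -> differentiable g x) ->
  (forall i x, eball n x -> {for x, continuous ('D_(basis_vec i) g)}) ->
  `|a| < 1 ->
  is_derive a 1 (fun r => sphmean (fun z => w z * g (r *: z)))
    (sphmean (fun z => w z * dotp z (grad g (a *: z)))).
Proof.
move=> cw dg cDg a1.
have [rho /andP[arho rho1]] : exists rho : R, `|a| < rho < 1.
  by exists ((`|a| + 1) / 2); rewrite midf_lt// ?midf_lt.
have cg x : eball n x -> {for x, continuous g}.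
  by move=> xB; exact: differentiable_continuous (dg x xB).
have [Mw Mw0 wM] := compact_bounded_fun (@compact_esphere R n) cw.
have /choice[M MP] : forall i : 'I_n, exists M, 0 <= M /\
    forall x, enorm x <= rho -> `|'D_(basis_vec i) g x| <= M.
  move=> i; have [M M0 HM] := compact_bounded_fun (@compact_enorm_le R n rho)
    (fun x (xr : enorm x <= rho) => cDg i x (le_lt_trans xr rho1)).
  by exists M.
pose f (r : R) (z : 'rV[R]_n) := w z * g (r *: z).
have Irho (r : R) : `]- rho, rho[%classic r -> `|r| < rho by rewrite /= in_itv/= ltr_norml.
have rz (r : R) (z : 'rV[R]_n) : `|r| < rho -> esphere n z -> enorm (r *: z) < rho.
  by move=> rr zS; rewrite enormZ zS mulr1.
have Df (r : R) z : `|r| < rho -> esphere n z ->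
    is_derive r 1 (f ^~ z) (w z * dotp z (grad g (r *: z))).
  move=> rr zS.
  have dgz : differentiable g (r *: z) by apply: dg; exact: lt_trans (rz _ _ rr zS) rho1.
  have Dz (i : 'I_n) : is_derive r 1 (fun s : R => (s *: z) 0 i) (z 0 i).
    have H := is_derive_mul (is_derive_id r 1) (is_derive_const (z 0 i) r 1).
    rewrite (_ : (fun _ => _) = fun s : R => s * z 0 i); last first.
      by apply/funext => s; rewrite mxE.
    by apply: is_derive_eq H _; rewrite mul1r mulr0 addr0.
  have H := is_derive_mul (is_derive_const (w z) r 1) (@is_derive_comp_rV _ _ _ g (fun s : R => s *: z) r 1 z dgz Dz).
  by apply: is_derive_eq H _; rewrite mul0r add0r.
have Ia : `]- rho, rho[%classic a by rewrite /= in_itv/= -ltr_norml.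
have intf (r : R) : `]- rho, rho[%classic r ->
    (surface_measure n).-integrable (esphere n) (EFin \o f r).
  move=> /Irho rr; apply: sphcont_integrable; apply: sphcontM => //.
  by apply: sphcont_scale => //; exact: lt_trans rr rho1.
have derf (r : R) z : `]- rho, rho[%classic r -> esphere n z -> derivable (f ^~ z) r 1.
  by move=> /Irho rr zS; have [] := Df r z rr zS.
pose B (_ : 'rV[R]_n) := Mw * \sum_i M i.
have B0 z : 0 <= B z by rewrite mulr_ge0// sumr_ge0// => i _; have [] := MP i.
have intB : (surface_measure n).-integrable (esphere n) (EFin \o B).
  by apply: sphcont_integrable; exact: sphcont_cst.
have derB (r : R) z : `]- rho, rho[%classic r -> esphere n z -> `|partial1of2 f r z| <= B z.
  move=> /Irho rr zS; rewrite partial1of2E.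
  have -> : 'D_1 (f ^~ z) r = w z * dotp z (grad g (r *: z)).
    by have /@derive_val := Df r z rr zS.
  rewrite normrM ler_pM//; first exact: wM.
  apply: le_trans (ler_norm_sum _ _ _) _; apply: ler_sum => i _.
  rewrite normrM -[leRHS]mul1r ler_pM//.
    by apply: le_trans (coord_le_enorm _ _) _; rewrite zS.
  by rewrite mxE; apply: (MP i).2; exact/ltW/rz.
have mS := @measurable_esphere R n.
split; first exact: (derivable_under_integral mS Ia intf derf B0 intB derB).
rewrite -derive1E.
rewrite (differentiation_under_integral mS Ia intf derf B0 intB derB).
apply: eq_sphmean => z zS; rewrite partial1of2E.
by have /@derive_val := Df a z arho zS.
Qed.

End spherical_mean_theory.

(** * The mean value inequality *)

Section invariant_subharmonic.
Context {R : realType}.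

Lemma near_continuous (T : topologicalType) (f g : T -> R) (x : T) :
  (\forall y \near x, g y = f y) -> {for x, continuous f} -> {for x, continuous g}.
Proof.
move=> gf cf; change (g @ x --> g x); rewrite (nbhs_singleton gf).
apply: cvg_trans cf; apply: near_eq_cvg.
by apply: filterS gf => y ->.
Qed.

Lemma Ck_differentiable n (Omega : set 'rV[R]_n) (u : 'rV[R]_n -> R) x :
  open Omega -> Ck 1 Omega u -> Omega x -> differentiable u x.
Proof.
move=> oO [_ Du] Ox; apply: C1_differentiable => [|i]; last by have [_] := Du i; exact.
apply: filterS (open_nbhs_nbhs (conj oO Ox)) => y Oy i.
by have [+ _] := Du i; exact.
Qed.

Lemma Ck_partial n k (Omega : set 'rV[R]_n) (u : 'rV[R]_n -> R) i :
  Ck k.+1 Omega u -> Ck k Omega ('D_(basis_vec i) u).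
Proof. by move=> [_ /(_ i) []]. Qed.

Lemma Ck_continuous n k (Omega : set 'rV[R]_n) (u : 'rV[R]_n -> R) x :
  Ck k Omega u -> Omega x -> {for x, continuous u}.
Proof. by case: k => [|k]; [exact|move=> [cu _]; exact: cu]. Qed.

Lemma Ck_le n k l (Omega : set 'rV[R]_n) (u : 'rV[R]_n -> R) :
  (l <= k)%N -> Ck k Omega u -> Ck l Omega u.
Proof.
elim: l k u => [|l ih] k u; first by move=> _ cu x Ox; exact: Ck_continuous cu Ox.
case: k => // k; rewrite ltnS => lk [cu Du]; split => // i.
by have [du cDu] := Du i; split => //; exact: ih cDu.
Qed.

Lemma Ck_is_derive n k (Omega : set 'rV[R]_n) (u : 'rV[R]_n -> R) i x :
  Ck k.+1 Omega u -> Omega x -> is_derive x (basis_vec i) u ('D_(basis_vec i) u x).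
Proof. by move=> [_ /(_ i) [du _]] Ox; split => //; exact: du. Qed.

(** The third term contributes [n] copies of [\sum_j z_j d_j] and the diagonal term gives one back,
    whence [n - 1]; the normalization of [z] collapses the second term to the trace of [dd]. *)
Lemma rotation_sum n (z d : 'I_n -> R) (dd : 'I_n -> 'I_n -> R) (r : R) :
  \sum_i z i ^+ 2 = 1 ->
  \sum_i \sum_j ((if i == j then z i * d j else 0) + z i ^+ 2 * r * dd j j -
     z j * d j - z j * z i * r * dd i j) =
  r * (\sum_j dd j j) - (n%:R - 1) * (\sum_j z j * d j) -
  r * \sum_j z j * (\sum_i z i * dd i j).
Proof.
move=> z1.
have E1 : \sum_i \sum_j (if i == j then z i * d j else 0) = \sum_j z j * d j.
  by apply: eq_bigr => i _; rewrite -big_mkcond/= (big_pred1 i)// => j; rewrite eq_sym.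
have E2 : \sum_i \sum_j z i ^+ 2 * r * dd j j = r * \sum_j dd j j.
  rewrite exchange_big/= mulr_sumr; apply: eq_bigr => j _.
  by rewrite -!mulr_suml z1 mul1r.
have E3 : \sum_i \sum_j z j * z i * r * dd i j = r * \sum_j z j * \sum_i z i * dd i j.
  rewrite exchange_big/= mulr_sumr; apply: eq_bigr => j _.
  by rewrite !mulr_sumr; apply: eq_bigr => i _; ring.
under eq_bigr do rewrite !sumrB big_split/=.
rewrite !sumrB big_split/= E1 E2 E3 sumr_const card_ord -mulr_natl.
ring.
Qed.

Section mean_value.
Variables (n : nat) (u : 'rV[R]_n -> R).
Hypothesis n0 : (0 < n)%N.
Hypothesis C2u : Ck 2 (eball n) u.

Let D j := 'D_(basis_vec j) u.
Let DD i j := 'D_(basis_vec i) (D j).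

Let C1D j : Ck 1 (eball n) (D j).
Proof. exact: Ck_partial C2u. Qed.

Let D_differentiable j x : eball n x -> differentiable (D j) x.
Proof. by apply: Ck_differentiable => //; exact: open_eball. Qed.

Let DD_continuous i j x : eball n x -> {for x, continuous (DD i j)}.
Proof. by apply: (@Ck_continuous n 0); exact: Ck_partial (C1D j). Qed.

Let D_continuous j x : eball n x -> {for x, continuous (D j)}.
Proof. exact: Ck_continuous (C1D j). Qed.

Definition mflux (r : R) := sphmean (fun z : 'rV[R]_n => dotp z (grad u (r *: z))).

Let scB (r : R) z : `|r| < 1 -> esphere n z -> eball n (r *: z).
Proof. by move=> r1 zS; rewrite /eball/= enormZ zS mulr1. Qed.

Lemma is_derive_mean (r : R) : `|r| < 1 ->
  is_derive r 1 (fun r => sphmean (fun z : 'rV[R]_n => u (r *: z))) (mflux r).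
Proof.
move=> r1; have H := @is_derive_sphmean R n n0 (fun=> 1) u r.
have -> : (fun r => sphmean (fun z : 'rV[R]_n => u (r *: z))) =
    fun r => sphmean (fun z : 'rV[R]_n => 1 * u (r *: z)).
  by apply/funext => s; apply: eq_sphmean => z _; rewrite mul1r.
have -> : mflux r = sphmean (fun z : 'rV[R]_n => 1 * dotp z (grad u (r *: z))).
  by apply: eq_sphmean => z _; rewrite mul1r.
apply: H => //.
- exact: sphcont_cst.
- move=> x; apply: Ck_differentiable; first exact: open_eball.
  exact: Ck_le C2u.
Qed.

Let dotpE (r : R) z : dotp z (grad u (r *: z)) = \sum_j z 0 j * D j (r *: z).
Proof. by apply: eq_bigr => j _; rewrite mxE. Qed.

Let cD (r : R) j : `|r| < 1 -> sphcont (fun z : 'rV[R]_n => D j (r *: z)).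
Proof. by move=> r1; apply: sphcont_scale => // x; exact: D_continuous. Qed.

Let cDD (r : R) i j : `|r| < 1 -> sphcont (fun z : 'rV[R]_n => DD i j (r *: z)).
Proof. by move=> r1; apply: sphcont_scale => // x; exact: DD_continuous. Qed.

Let czD (r : R) j : `|r| < 1 -> sphcont (fun z : 'rV[R]_n => z 0 j * D j (r *: z)).
Proof. by move=> r1; apply: sphcontM; [exact: sphcont_coord|exact: cD]. Qed.

Let czDD (r : R) j : `|r| < 1 ->
  sphcont (fun z : 'rV[R]_n => z 0 j * dotp z (grad (D j) (r *: z))).
Proof.
move=> r1; apply: sphcontM; first exact: sphcont_coord.
rewrite (_ : (fun z : 'rV[R]_n => _) = fun z : 'rV[R]_n => \sum_i z 0 i * DD i j (r *: z)).
  by apply: sphcont_sum => i; apply: sphcontM; [exact: sphcont_coord|exact: cDD].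
by apply/funext => z; apply: eq_bigr => i _; rewrite mxE.
Qed.

Lemma mfluxE (r : R) : `|r| < 1 ->
  mflux r = \sum_j sphmean (fun z : 'rV[R]_n => z 0 j * D j (r *: z)).
Proof.
move=> r1; rewrite -(sphmean_sum n0 (fun j => @czD r j r1)).
by apply: eq_sphmean => z _; exact: dotpE.
Qed.

(** The mean of the second radial derivative [<Hess u(r z) z, z>]. *)
Definition hessmean (r : R) :=
  sphmean (fun z : 'rV[R]_n => \sum_j z 0 j * dotp z (grad (D j) (r *: z))).

Lemma is_derive_mflux (r : R) : `|r| < 1 -> is_derive r 1 mflux (hessmean r).
Proof.
move=> r1; rewrite /hessmean (sphmean_sum n0 (fun j => @czDD r j r1)).
apply: (@near_eq_is_derive R R R
  (fun s => \sum_j sphmean (fun z : 'rV[R]_n => z 0 j * D j (s *: z)))).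
  have : \forall s \near r, `|s| < 1 by exact: (cvgr_lt _ (@norm_continuous _ _ r)).
  by apply: filterS => s s1; rewrite mfluxE.
apply: is_derive_big => j; apply: is_derive_sphmean => //.
- exact: sphcont_coord.
- by move=> x; exact: D_differentiable.
- by move=> i x; exact: DD_continuous.
Qed.

Definition lapmean (r : R) := sphmean (fun z : 'rV[R]_n => laplacian u (r *: z)).

Let clap (r : R) : `|r| < 1 -> sphcont (fun z : 'rV[R]_n => laplacian u (r *: z)).
Proof. by move=> r1; apply: sphcont_sum => i; exact: cDD. Qed.

(* The rotation z_i d_j - z_j d_i applied to z_i D_j u(r z).  Its spherical mean
   vanishes; summed over i and j this is the divergence theorem for grad u. *)
Let rotfield (r : R) (i j : 'I_n) (z : 'rV[R]_n) : R :=
  (if i == j then z 0 i * D j (r *: z) else 0) +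
  z 0 i ^+ 2 * r * DD j j (r *: z) - z 0 j * D j (r *: z) -
  z 0 j * z 0 i * r * DD i j (r *: z).

Let rotfield_sum (r : R) z : esphere n z ->
  \sum_i \sum_j rotfield r i j z =
  r * laplacian u (r *: z) - (n%:R - 1) * dotp z (grad u (r *: z)) -
  r * \sum_j z 0 j * dotp z (grad (D j) (r *: z)).
Proof.
move=> zS; have z1 : \sum_i z 0 i ^+ 2 = 1.
  by rewrite -[RHS](expr1n _ 2) -[in RHS]zS sqr_enorm; apply: eq_bigr.
rewrite dotpE /rotfield (rotation_sum (D^~ (r *: z)) (fun i j => DD i j (r *: z)) r z1).
congr (_ - _ - _ * _); apply: eq_bigr => j _; congr (_ * _).
by apply: eq_bigr => i _; rewrite mxE.
Qed.

Let rotfield_mean (r : R) i j : `|r| < 1 -> sphmean (rotfield r i j) = 0.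
Proof.
move=> r1.
pose G (y : 'rV[R]_n) := y 0 i * D j (r *: y).
have DG y (l : 'I_n) : eball n (r *: y) -> is_derive y (basis_vec l) G
    ((basis_vec l : 'rV[R]_n) 0 i * D j (r *: y) + y 0 i * (r * DD l j (r *: y))).
  move=> yB; apply: is_derive_mul; first exact: is_derive_coord.
  have Dl k : is_derive y (basis_vec l) (fun y : 'rV[R]_n => (r *: y) 0 k)
     ((r *: basis_vec l : 'rV[R]_n) 0 k).
    have H := is_derive_mul (is_derive_const r y (basis_vec l))
      (is_derive_coord y (basis_vec l) k).
    rewrite (_ : (fun y => _) = fun y : 'rV[R]_n => r * y 0 k); last first.
      by apply/funext => x; rewrite mxE.
    by apply: is_derive_eq H _; rewrite mul0r add0r [RHS]mxE.
  have H := @is_derive_comp_rV _ _ _ (D j) (fun y : 'rV[R]_n => r *: y) y _ _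
    (D_differentiable j yB) Dl.
  apply: is_derive_eq H _; rewrite dotpZl; congr (_ * _).
  rewrite /dotp (bigD1 l)//= !mxE !eqxx mul1r big1 ?addr0// => k kl.
  by rewrite !mxE (negbTE kl) andbF mul0r.
have nearB z : esphere n z -> \forall y \near z, eball n (r *: y).
  move=> zS; have : {for z, continuous (fun y : 'rV[R]_n => r *: y)}.
    exact: scaler_continuous.
  by apply; apply: open_nbhs_nbhs; split; [exact: open_eball|exact: scB].
have DGE l y : eball n (r *: y) -> 'D_(basis_vec l) G y =
    (basis_vec l : 'rV[R]_n) 0 i * D j (r *: y) + y 0 i * (r * DD l j (r *: y)).
  by move=> yB; have /@derive_val := DG y l yB.
have cG z l : esphere n z -> {for z, continuous ('D_(basis_vec l) G)}.
  move=> zS; have c : {for z, continuous (fun y : 'rV[R]_n =>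
      (basis_vec l : 'rV[R]_n) 0 i * D j (r *: y) + y 0 i * (r * DD l j (r *: y)))}.
    have c1 : {for z, continuous (fun y => D j (r *: y))} by exact: cD.
    have c2 : {for z, continuous (fun y => DD l j (r *: y))} by exact: cDD.
    exact: (add_continuous (mul_continuous (@cst_continuous _ _ _ z) c1)
      (mul_continuous (@coord_continuous_rV _ _ i z)
        (mul_continuous (@cst_continuous _ _ r z) c2))).
  apply: near_continuous c; have := nearB z zS.
  by apply: (@filterS _ (nbhs z)) => y; exact: DGE.
have dG z : esphere n z -> differentiable G z.
  move=> zS; apply: C1_differentiable => [|l]; last exact: cG.
  by move: (nearB z zS); apply: (@filterS _ (nbhs z)) => y yB l; have [] := DG y l yB.
rewrite -[RHS](sphmean_rotation n0 dG cG i j); apply: eq_sphmean => z zS.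
rewrite (DGE j z (scB r1 zS)) (DGE i z (scB r1 zS)).
rewrite /rotfield !mxE !eqxx/=; case: (eqVneq i j) => [->|ij].
  by rewrite ?eqxx/=; ring.
by move: (D j (r *: z)) (DD i j (r *: z)) (DD j j (r *: z)) => a b c /=; ring.
Qed.

(** The mean of the polar decomposition of [Delta u] into [u_rr + (n-1)/r u_r] and a tangential
    part, the latter having mean zero as a sum of rotation fields. The factor [r] avoids a division
    at the centre. *)
Lemma flux_identity (r : R) : `|r| < 1 ->
  r * hessmean r = r * lapmean r - (n%:R - 1) * mflux r.
Proof.
move=> r1.
have crot i j : sphcont (rotfield r i j).
  have cif : sphcont (fun z : 'rV[R]_n => if i == j then z 0 i * D j (r *: z) else 0).
    case: eqP => _; last exact: sphcont_cst.
    by apply: sphcontM; [exact: sphcont_coord|exact: cD].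
  have cz2 : sphcont (fun z : 'rV[R]_n => z 0 i ^+ 2 * r).
    by apply: sphcontM; [apply: sphcontM; exact: sphcont_coord|exact: sphcont_cst].
  have czz : sphcont (fun z : 'rV[R]_n => - (z 0 j * z 0 i * r)).
    move=> z zS; apply: opp_continuous_fun; move: z zS.
    by apply: sphcontM; [apply: sphcontM; exact: sphcont_coord|exact: sphcont_cst].
  have cN : sphcont (fun z : 'rV[R]_n => - (z 0 j * D j (r *: z))).
    by move=> z zS; apply: opp_continuous_fun; exact: czD.
  have := sphcontD (sphcontD (sphcontD cif (sphcontM cz2 (@cDD r j j r1))) cN)
    (sphcontM czz (@cDD r i j r1)).
  rewrite /rotfield => H z zS; have := H z zS.
  by under [X in {for z, continuous X} -> _]eq_fun do rewrite mulNr.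
have : sphmean (fun z : 'rV[R]_n => \sum_i \sum_j rotfield r i j z) = 0.
  rewrite (sphmean_sum n0); last by move=> i; apply: sphcont_sum => j; exact: crot.
  rewrite big1// => i _; rewrite (sphmean_sum n0); last by move=> j; exact: crot.
  by rewrite big1// => j _; exact: rotfield_mean.
rewrite (eq_sphmean (@rotfield_sum r)).
have cl : sphcont (fun z : 'rV[R]_n => r * laplacian u (r *: z)).
  by apply: sphcontM; [exact: sphcont_cst|exact: clap].
have cg0 : sphcont (fun z : 'rV[R]_n => dotp z (grad u (r *: z))).
  rewrite (_ : (fun z : 'rV[R]_n => _) = fun z : 'rV[R]_n => \sum_j z 0 j * D j (r *: z)).
    by apply: sphcont_sum => j; exact: czD.
  by apply/funext => z; exact: dotpE.
have cg : sphcont (fun z : 'rV[R]_n => (n%:R - 1) * dotp z (grad u (r *: z))).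
  by apply: sphcontM; [exact: sphcont_cst|].
have ch0 : sphcont (fun z : 'rV[R]_n => \sum_j z 0 j * dotp z (grad (D j) (r *: z))).
  by apply: sphcont_sum => j; exact: czDD.
have ch : sphcont (fun z : 'rV[R]_n => r * \sum_j z 0 j * dotp z (grad (D j) (r *: z))).
  by apply: sphcontM; [exact: sphcont_cst|].
have clg : sphcont (fun z : 'rV[R]_n => r * laplacian u (r *: z) -
    (n%:R - 1) * dotp z (grad u (r *: z))).
  by move=> z zS; apply: add_continuous; [exact: cl|apply: opp_continuous_fun; exact: cg].
rewrite (sphmeanB n0 clg ch) (sphmeanB n0 cl cg) !(sphmeanZ n0)//.
  by rewrite -/(lapmean r) -/(mflux r) -/(hessmean r); lra.
exact: clap.
Qed.

Hypothesis n2 : (2 <= n)%N.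
Hypothesis Lu : forall x, eball n x -> 0 <= inv_laplacian u x.

(** On the sphere of radius [r] the coefficients of the invariant Laplacian are constants, so its
    mean only involves [lapmean] and [mflux]; the positive common factor [1 - r^2] is divided
    out. *)
Let mean_inv_laplacian (r : R) : 0 <= r < 1 ->
  0 <= (1 - r ^+ 2) * lapmean r + 2 * (n%:R - 2) * r * mflux r.
Proof.
move=> /andP[r0 r1]; have nr1 : `|r| < 1 by rewrite ger0_norm.
have cl : sphcont (fun z : 'rV[R]_n => (1 - r ^+ 2) * laplacian u (r *: z)).
  by apply: sphcontM; [exact: sphcont_cst|exact: clap].
have cg0 : sphcont (fun z : 'rV[R]_n => dotp z (grad u (r *: z))).
  rewrite (_ : (fun z => _) = fun z : 'rV[R]_n => \sum_j z 0 j * D j (r *: z)).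
    by apply: sphcont_sum => j; exact: czD.
  by apply/funext => z; exact: dotpE.
have cg : sphcont (fun z : 'rV[R]_n => 2 * (n%:R - 2) * r * dotp z (grad u (r *: z))).
  by apply: sphcontM; [exact: sphcont_cst|].
rewrite -(sphmeanZ n0 _ (@clap r nr1)) -(sphmeanZ n0 _ cg0) -(sphmeanD n0 cl cg).
apply: sphmean_ge0 => z zS.
have q0 : 0 < 1 - r ^+ 2 by rewrite subr_gt0 expr_lt1.
have := Lu (scB nr1 zS).
rewrite /inv_laplacian enormZ zS mulr1 ger0_norm// dotpC dotpZl.
rewrite (_ : _ + _ = (1 - r ^+ 2) * ((1 - r ^+ 2) * laplacian u (r *: z) +
  2 * (n%:R - 2) * r * dotp z (grad u (r *: z)))); last by ring.
by rewrite pmulr_rge0.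
Qed.

Let wflux (r : R) := r ^+ n.-1 * ((1 - r ^+ 2)^-1) ^+ n.-2 * mflux r.

Let dwflux (r : R) := r ^+ n.-1 * ((1 - r ^+ 2)^-1) ^+ n.-2 *
  (lapmean r + 2 * (n%:R - 2) * r * (1 - r ^+ 2)^-1 * mflux r).

(* [wflux] is the flux of the field (1-|x|^2)^(2-n) grad u, whose divergence is
   inv_laplacian u up to a positive factor. *)
Let is_derive_wflux (r : R) : `|r| < 1 -> is_derive r 1 wflux (dwflux r).
Proof.
move=> r1; have q0 : 1 - r ^+ 2 != 0.
  by rewrite gt_eqF// subr_gt0 -real_normK ?num_real// expr_lt1.
have Dq := is_derive_comp1 (is_derive_sub (is_derive_const (1 : R) r 1) (is_derive_expn r 2))
  (is_derive_inv1 q0).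
have H := is_derive_mul (is_derive_mul (is_derive_expn r n.-1)
  (is_derive_comp1 Dq (is_derive_expn _ n.-2))) (is_derive_mflux r1).
apply: is_derive_eq H _; rewrite /dwflux.
have := flux_identity r1.
case: (n) n2 => [|[|k]]//= _.
rewrite (_ : k.+2%:R = k%:R + 2 :> R); last by rewrite -natrD addn2.
set h := hessmean r; set l := lapmean r; set w := mflux r; set q := (1 - r ^+ 2)^-1.
rewrite (_ : (1 - r ^+ 2) ^- 2 = q ^+ 2); last by rewrite exprVn.
rewrite (_ : k.+1%:R = k%:R + 1 :> R); last by rewrite -natr1.
move=> E; rewrite !exprS expr0 mulr1.
rewrite (_ : r * r ^+ k * q ^+ k * h = r ^+ k * q ^+ k * (r * h)); last by ring.
(* The derivative of [q ^+ k] carries the exponent [k.-1]; setting [k = 0] apart, that is [n = 2],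
   removes the truncated predecessor. *)
rewrite E; case: k {E} => [|k] /=; first by ring.
by rewrite !exprS; ring.
Qed.

Let dwflux_ge0 (r : R) : 0 <= r < 1 -> 0 <= dwflux r.
Proof.
move=> r01; have := mean_inv_laplacian r01; move: r01 => /andP[r0 r1].
have q0 : 0 < 1 - r ^+ 2 by rewrite subr_gt0 expr_lt1.
move=> H; rewrite /dwflux mulr_ge0//.
  by rewrite mulr_ge0// exprn_ge0// invr_ge0 ltW.
rewrite -(pmulr_rge0 _ q0); apply: le_trans H _.
rewrite le_eqVlt; apply/orP; left; apply/eqP; field.
by rewrite gt_eqF.
Qed.

(** [wflux] starts from zero, because [n.-1] is a positive exponent, and its derivative is
    nonnegative; its weight in front of [mflux] is positive for [0 < r < 1]. *)
Let mflux_ge0 (r : R) : 0 <= r < 1 -> 0 <= r * mflux r.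
Proof.
move=> /andP[r0 r1].
have w0 : wflux 0 = 0 by rewrite /wflux; case: (n) n2 => [|[|k]]//= _; rewrite exprS !mul0r.
have [||c cr E] := @MVT_segment R wflux dwflux 0 r r0.
- move=> t; rewrite in_itv/= => /andP[t0 tr]; apply: is_derive_wflux.
  by rewrite ger0_norm ?(ltW t0)//; exact: lt_trans tr r1.
- apply: derivable_within_continuous => t; rewrite in_itv/= => /andP[t0 tr].
  have [] // := @is_derive_wflux t _.
  by rewrite ger0_norm//; exact: le_lt_trans tr r1.
have wr : 0 <= wflux r.
  move: E; rewrite w0 !subr0 => ->; rewrite mulr_ge0// dwflux_ge0//.
  by move: cr; rewrite in_itv/= => /andP[-> cr]; exact: le_lt_trans cr r1.
move: r0; rewrite le_eqVlt => /orP[/eqP <-|r0]; first by rewrite mul0r.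
have q0 : 0 < 1 - r ^+ 2 by rewrite subr_gt0 expr_lt1// ltW.
rewrite mulr_ge0 ?(ltW r0)//.
by move: wr; rewrite /wflux pmulr_rge0// mulr_gt0// exprn_gt0// invr_gt0.
Qed.

Lemma sphmean_ge_center (r : R) : 0 <= r < 1 -> u 0 <= sphmean (fun z => u (r *: z)).
Proof.
move=> /andP[r0 r1].
pose m (s : R) := sphmean (fun z => u (s *: z)).
have m0 : m 0 = u 0.
  rewrite /m -[RHS](sphmean_cst n0 (u 0)); apply: eq_sphmean => z _.
  by rewrite scale0r.
move: r0; rewrite le_eqVlt => /orP[/eqP <-|r0]; first by rewrite -/(m 0) m0.
(* The interior form of the mean value theorem: [0 < c] is needed to cancel [c] in
   [0 <= c * mflux c]. *)
have [||c cr E] := @MVT R m mflux 0 r r0.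
- move=> t; rewrite in_itv/= => /andP[t0 tr]; apply: is_derive_mean.
  by rewrite ger0_norm ?(ltW t0)//; exact: lt_trans tr r1.
- apply: derivable_within_continuous => t; rewrite in_itv/= => /andP[t0 tr].
  have [] // := @is_derive_mean t _.
  by rewrite ger0_norm//; exact: le_lt_trans tr r1.
rewrite -m0 -subr_ge0 -/(m r) E subr0.
move: cr; rewrite in_itv/= => /andP[c0 cr].
rewrite mulr_ge0 ?(ltW r0)//.
have := @mflux_ge0 c; rewrite (ltW c0) (lt_trans cr r1) => /(_ isT).
by rewrite pmulr_rge0.
Qed.

End mean_value.
End invariant_subharmonic.

(** * Weak derivatives *)

Section integration_by_parts.
Context {R : realType} (n : nat).
Implicit Types u phi w : 'rV[R]_n -> R.

Let supp phi := closure [set x | phi x != 0].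

Lemma supp_zero phi x : ~ supp phi x -> phi x = 0.
Proof.
by move=> xs; apply/eqP; apply: contrapT => /negP px; apply: xs; exact: subset_closure.
Qed.

Lemma near_supp_zero phi x : ~ supp phi x -> \forall y \near x, ~ supp phi y.
Proof.
move=> xs; apply: open_nbhs_nbhs; split => //; apply: closed_openC.
exact: closed_closure.
Qed.

Lemma Ck1_is_derive phi i x : Ck 1 setT phi ->
  is_derive x (basis_vec i) phi ('D_(basis_vec i) phi x).
Proof. by move=> cphi; exact: Ck_is_derive cphi _. Qed.

Lemma supp_partial_zero phi i x : Ck 1 setT phi -> ~ supp phi x ->
  'D_(basis_vec i) phi x = 0.
Proof.
move=> cphi xs; have : is_derive x (basis_vec i) phi 0.
  apply: (@near_eq_is_derive R 'rV[R]_n R (cst 0) phi x (basis_vec i) 0).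
  have := near_supp_zero xs.
  by apply: (@filterS _ (nbhs x)) => y /supp_zero.
by move=> H; exact: derive_val.
Qed.

Section product.
Variables (K : set 'rV[R]_n) (w psi : 'rV[R]_n -> R).
Hypothesis cK : compact K.
Hypothesis KB : K `<=` eball n.
Hypothesis cpsi : continuous psi.
Hypothesis psi0 : forall x, ~ K x -> psi x = 0.

Lemma integrable_mul_test :
  (forall x, eball n x -> {for x, continuous w}) ->
  (lebesgue_rV n).-integrable (eball n) (fun x => (w x * psi x)%:E).
Proof.
move=> cw; apply/(integrable_mkcond _ (@measurable_eball R n)).
rewrite (_ : _ \_ _ = EFin \o ((fun x => w x * psi x) \_ (eball n))); last first.
  by rewrite -restrict_EFin.
have mwp : measurable_fun (eball n) (fun x => w x * psi x).
  apply: measurable_funM.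
    by apply: continuous_at_measurable => //; exact: measurable_eball.
  by apply: measurable_funTS; exact: continuous_measurable_rV.
have [M M0 HM] := compact_bounded_fun cK (fun x Kx => mul_continuous (cw x (KB Kx)) (@cpsi x)).
apply: (@bounded_support_integrable _ _ _ _ _ K M).
- exact: compact_measurable_rV.
- apply: le_lt_trans (lebesgue_eball_lty n); apply: le_measure; rewrite ?inE.
  + exact: compact_measurable_rV.
  + exact: measurable_eball.
  + exact: KB.
- by apply/(measurable_restrictT _ (@measurable_eball R n)).
- by move=> x Kx; rewrite patchE mem_set ?HM//; exact: KB.
- by move=> x Kx; rewrite patchE; case: ifPn => // _; rewrite psi0// mulr0.
Qed.

End product.

(** Extended by zero, [u phi] has a continuous [i]-th partial derivative on the whole space and is
    supported inside the ball, so that derivative has integral zero; the product rule splits it into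
    the two sides. *)
Lemma C1_weak_partial u i : Ck 1 (eball n) u ->
  weak_partial (eball n) i u ('D_(basis_vec i) u).
Proof.
move=> cu phi [sphi cK KB]; have cphi := sphi 1%N.
have cp : continuous phi by move=> x; exact: Ck_continuous cphi _.
have cdp : continuous ('D_(basis_vec i) phi).
  by move=> x; apply: (@Ck_continuous _ _ 0 setT) => //; exact: Ck_partial cphi.
have cuB x : eball n x -> {for x, continuous u} by exact: Ck_continuous cu.
have cduB x : eball n x -> {for x, continuous ('D_(basis_vec i) u)}.
  by apply: (@Ck_continuous _ _ 0); exact: Ck_partial cu.
pose G0 (x : 'rV[R]_n) := 'D_(basis_vec i) u x * phi x + u x * 'D_(basis_vec i) phi x.
pose F := (fun x => u x * phi x) \_ (eball n).
pose G := G0 \_ (eball n).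
have nearB (x : 'rV[R]_n) : eball n x -> \forall y \near x, eball n y.
  by move=> xB; apply: open_nbhs_nbhs; split => //; exact: open_eball.
have offF x : ~ supp phi x -> F x = 0.
  by move=> xs; rewrite /F patchE; case: ifP => // _; rewrite (supp_zero xs) mulr0.
have offG x : ~ supp phi x -> G x = 0.
  move=> xs; rewrite /G patchE; case: ifP => // _.
  by rewrite /G0 (supp_zero xs) (supp_partial_zero i cphi xs) !mulr0 addr0.
have cG : continuous G.
  move=> x; have [xB|xB] := pselect (eball n x).
    have c : {for x, continuous G0}.
      exact: (add_continuous (mul_continuous (cduB x xB) (cp x))
        (mul_continuous (cuB x xB) (cdp x))).
    apply: near_continuous c; have := nearB x xB.
    by apply: (@filterS _ (nbhs x)) => y yB; rewrite /G patchE mem_set.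
  have xs : ~ supp phi x by move=> /KB.
  apply: (@near_continuous _ _ (fun=> 0)); last exact: cst_continuous.
  have := near_supp_zero xs.
  by apply: (@filterS _ (nbhs x)) => y /offG.
have DF x : is_derive x (basis_vec i) F (G x).
  have [xB|xB] := pselect (eball n x).
    rewrite /G patchE mem_set//.
    apply: (@near_eq_is_derive R 'rV[R]_n R (fun x => u x * phi x) F x (basis_vec i)).
      have := nearB x xB.
      by apply: (@filterS _ (nbhs x)) => y yB; rewrite /F patchE mem_set.
    apply: is_derive_mul; last exact: Ck1_is_derive.
    exact: Ck_is_derive cu xB.
  have xs : ~ supp phi x by move=> /KB.
  rewrite offG//.
  apply: (@near_eq_is_derive R 'rV[R]_n R (cst 0) F x (basis_vec i) 0).
  have := near_supp_zero xs.
  by apply: (@filterS _ (nbhs x)) => y /offF.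
have F0 x : ~ cube n 1 x -> F x = 0.
  by move=> xc; apply: offF => /KB /eball_cube.
have := integral_partial0 cG DF F0.
have i1 : (lebesgue_rV n).-integrable (eball n) (fun x => ('D_(basis_vec i) u x * phi x)%:E).
  by apply: (@integrable_mul_test (supp phi)) => // x /supp_zero.
have i2 : (lebesgue_rV n).-integrable (eball n) (fun x => (u x * 'D_(basis_vec i) phi x)%:E).
  by apply: (@integrable_mul_test (supp phi)) => // x; exact: supp_partial_zero.
rewrite (_ : (fun x => (G x)%:E) = (EFin \o G0) \_ (eball n)); last first.
  by rewrite restrict_EFin.
rewrite -integral_mkcond => H.
have : \int[lebesgue_rV n]_(x in eball n) G0 x = 0 by rewrite /Rintegral H.
rewrite RintegralD//; last exact: measurable_eball.
by move/eqP; rewrite addr_eq0 => /eqP ->; rewrite opprK.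
Qed.

End integration_by_parts.

(** * Boxes and their test functions *)

Section boxes.
Context {R : realType} (n : nat).
Implicit Types a b x : 'rV[R]_n.

Definition obox a b : set 'rV[R]_n := [set x | forall i, a 0 i < x 0 i < b 0 i].
Definition cbox a b : set 'rV[R]_n := [set x | forall i, a 0 i <= x 0 i <= b 0 i].

Lemma obox_cbox a b : obox a b `<=` cbox a b.
Proof. by move=> x H i; have /andP[/ltW -> /ltW ->] := H i. Qed.

Lemma compact_cbox a b : compact (cbox a b).
Proof.
rewrite (_ : cbox a b = [set x | forall i, (x 0 i) \in `[a 0 i, b 0 i]]).
  by apply: (@rV_compact _ _ (fun i => [set` `[a 0 i, b 0 i]])) => i; exact: segment_compact.
by apply/seteqP; split => x /= H i; have := H i; rewrite in_itv.
Qed.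

Lemma nbhs_obox a b x : obox a b x -> nbhs x (obox a b).
Proof.
move=> xab; apply: (@filter_forall _ _ _ (nbhs x)) => i; have /andP[ax xb] := xab i.
have c := @coord_continuous_rV R n i x.
have H1 : \forall y \near x, a 0 i < (y : 'rV[R]_n) 0 i by exact: (cvgr_gt _ c).
have H2 : \forall y \near x, (y : 'rV[R]_n) 0 i < b 0 i by exact: (cvgr_lt _ c).
by apply: (@filterS _ (nbhs x) _ _ _ _ (filterI H1 H2)) => y [? ?]; apply/andP.
Qed.

Lemma open_obox a b : open (obox a b).
Proof. by rewrite openE => x; exact: nbhs_obox. Qed.

Lemma measurable_obox a b : measurable (obox a b).
Proof. by apply: open_measurable_rV; exact: open_obox. Qed.

Lemma oboxI a b a' b' :
  obox a b `&` obox a' b' =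
  obox (\row_i Num.max (a 0 i) (a' 0 i)) (\row_i Num.min (b 0 i) (b' 0 i)).
Proof.
apply/seteqP; split => x /=.
  move=> [H H'] i; rewrite !mxE gt_max lt_min.
  by have /andP[-> ->] := H i; have /andP[-> ->] := H' i.
by move=> H; split => i; have := H i; rewrite !mxE gt_max lt_min =>
  /andP[/andP[? ?] /andP[? ?]]; apply/andP.
Qed.

Definition oboxes : set (set 'rV[R]_n) := [set A | exists a b, A = obox a b].

Lemma oboxes_setI : setI_closed oboxes.
Proof. by move=> _ _ [a [b ->]] [a' [b' ->]]; rewrite oboxI; do 2 eexists. Qed.

(** Only slabs in one coordinate have to be recovered, and a slab is the countable union of the
    boxes whose other sides are []-k, k[]. *)
Lemma measurable_oboxes : (measurable : set (set 'rV[R]_n)) = <<s oboxes >>.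
Proof.
apply/seteqP; split; last first.
  apply: smallest_sub; first exact: sigma_algebra_measurable.
  by move=> _ [a [b ->]]; exact: measurable_obox.
have mc (i : 'I_n) : measurable_fun setT
    ((fun x : 'rV[R]_n => x 0 i) : g_sigma_algebraType oboxes -> R).
  apply: (measurability _ (RGenOpens.measurableE R)).
  move=> _ [_ [c [d ->]] <-]; rewrite setTI.
  rewrite (_ : _ @^-1` _ = \bigcup_k
      obox (\row_j (if j == i then c else - k%:R)) (\row_j (if j == i then d else k%:R))).
    by apply: bigcup_measurable => k _; apply: sub_sigma_algebra; do 2 eexists.
  apply/seteqP; split => x /=; last first.
    by move=> [k _ /(_ i)]; rewrite !mxE eqxx in_itv.
  rewrite in_itv/= => xcd.
  (* This integer exceeds the absolute value of every coordinate of [x]. *)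
  exists (Num.truncn `|x|).+1 => // j; rewrite !mxE; case: eqP => [->//|_].
  rewrite -ltr_norml; apply: le_lt_trans (coord_le_norm _ _) _.
  exact: truncnS_gt.
apply: smallest_sub; first exact: (@sigma_algebra_measurable _ (g_sigma_algebraType oboxes)).
move=> A; rewrite -bigcup_seq/= => -[i _ [C mC <-]].
exact: (mc i measurableT _ mC).
Qed.

(** A smooth approximation of the indicator of the open box as [k] grows. The arguments have the
    shape [a * x_i + b] required by the constructor [smooth_bump]. *)
Definition boxbump (k : nat) a b x : R :=
  \prod_i (bump 0 (k%:R * x 0 i + - (k%:R * a 0 i)) *
           bump 0 (- k%:R * x 0 i + k%:R * b 0 i)).

Lemma boxbump_smooth k a b : smooth_rV (boxbump k a b).
Proof. by apply: smooth_prod => i; apply: smooth_mul; exact: smooth_bump. Qed.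

Lemma boxbump_ge0 k a b x : 0 <= boxbump k a b x.
Proof. by apply: prodr_ge0 => i _; rewrite mulr_ge0// bump_ge0. Qed.

Lemma boxbump_le1 k a b x : boxbump k a b x <= 1.
Proof.
rewrite [leRHS](_ : 1 = \prod_(i < n) 1); last by rewrite big1.
apply: ler_prod => i _.
by rewrite mulr_ge0 ?bump_ge0//= mulr_ile1// ?bump_ge0// bump0_le1.
Qed.

Lemma boxbump_out k a b x : ~ obox a b x -> boxbump k a b x = 0.
Proof.
move=> xab; have [i Hi] : exists i, ~~ (a 0 i < x 0 i < b 0 i).
  apply: contrapT => H; apply: xab => i; apply: contrapT => /negP Hi.
  by apply: H; exists i.
rewrite /boxbump (bigD1 i)//=; apply/eqP; rewrite mulf_eq0; apply/orP; left.
have k0 : (0 : R) <= k%:R by [].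
move: Hi; rewrite negb_and -!leNgt => /orP[H|H].
  by rewrite bump_le0 ?mul0r//; nra.
by rewrite [X in _ * X]bump_le0 ?mulr0//; nra.
Qed.

Lemma boxbump_cvg a b x : obox a b x -> boxbump k a b x @[k --> \oo] --> (1 : R).
Proof.
move=> xab; rewrite /boxbump.
elim: (index_enum _) => [|i r ih].
  rewrite (_ : (fun _ => _) = fun=> 1); first exact: cvg_cst.
  by apply/funext => k; rewrite big_nil.
rewrite (_ : (fun k : nat => _) = fun k : nat =>
    bump 0 (k%:R * (x 0 i - a 0 i) - 0) * bump 0 (k%:R * (b 0 i - x 0 i) - 0) *
    \prod_(i <- r) (bump 0 (k%:R * x 0 i + - (k%:R * a 0 i)) *
           bump 0 (- k%:R * x 0 i + k%:R * b 0 i))); last first.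
  apply/funext => k; rewrite big_cons; congr (_ * _).
  by congr (bump _ _ * bump _ _); ring.
have /andP[ax xb] := xab i.
have c1 : bump 0 (k%:R * (x 0 i - a 0 i) - 0) @[k --> \oo] --> (1 : R).
  by apply: bump0_cvg1; rewrite subr_gt0.
have c2 : bump 0 (k%:R * (b 0 i - x 0 i) - 0) @[k --> \oo] --> (1 : R).
  by apply: bump0_cvg1; rewrite subr_gt0.
by have := cvgM (cvgM c1 c2) ih; rewrite !mulr1; exact.
Qed.

Lemma boxbump_supp k a b : closure [set x | boxbump k a b x != 0] `<=` cbox a b.
Proof.
have cc : closed (cbox a b).
  by apply: compact_closed; [exact: norm_hausdorff|exact: compact_cbox].
rewrite [X in _ `<=` X](closure_id _).1//; apply: closure_subset => x /= /eqP x0.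
by apply: obox_cbox; apply: contrapT => /(boxbump_out k).
Qed.

Lemma boxbump_test k a b (Omega : set 'rV[R]_n) : cbox a b `<=` Omega ->
  test_fun Omega (boxbump k a b).
Proof.
move=> abO; split.
- by move=> l; apply: smooth_Ck; exact: boxbump_smooth.
- apply: subclosed_compact (@compact_cbox a b) (@boxbump_supp k a b).
  exact: closed_closure.
- exact: subset_trans (@boxbump_supp k a b) abO.
Qed.

End boxes.

(** * The fundamental lemma of the calculus of variations *)

Section fundamental_lemma.
Context {R : realType} (n : nat) (h : 'rV[R]_n -> R).
Let B := @eball R n.
Hypothesis mh : measurable_fun B h.
Hypothesis ih : forall C, compact C -> C `<=` B ->
  (lebesgue_rV n).-integrable C (EFin \o h).
Hypothesis h0 : forall phi, test_fun B phi ->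
  \int[lebesgue_rV n]_(x in B) (h x * phi x) = 0.

(** The functions [boxbump k] are test functions with values in [[0, 1]] that tend to the indicator
    of the box; dominated convergence applies with the bound [|h|]. *)
Lemma integral_obox0 a b : cbox a b `<=` B ->
  (\int[lebesgue_rV n]_(x in obox a b) (h x)%:E = 0)%E.
Proof.
move=> abB; have mo := @measurable_obox R n a b.
have oB : obox a b `<=` B by apply: subset_trans abB; exact: obox_cbox.
have io : (lebesgue_rV n).-integrable (obox a b) (EFin \o h).
  apply: (@integrableS _ _ _ _ (cbox a b)) => //.
  - by apply: compact_measurable_rV; exact: compact_cbox.
  - exact: obox_cbox.
  - by apply: ih => //; exact: compact_cbox.
pose f k (x : 'rV[R]_n) := (h x * boxbump k a b x)%:E.
have mho : measurable_fun (obox a b) h by apply: measurable_funS oB mh; exact: measurable_eball.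
have mb k : measurable_fun (obox a b) (boxbump k a b).
  apply: measurable_funTS; apply: continuous_measurable_rV.
  by apply: smooth_continuous; exact: boxbump_smooth.
have fle k x : (`|f k x| <= `|(h x)%:E|)%E.
  rewrite lee_fin normrM -[leRHS]mulr1 ler_wpM2l//.
  by rewrite ger0_norm ?boxbump_ge0// boxbump_le1.
have if0 k : (\int[lebesgue_rV n]_(x in obox a b) f k x = 0)%E.
  have := h0 (boxbump_test k abB); rewrite /Rintegral.
  have -> : (\int[lebesgue_rV n]_(x in B) (h x * boxbump k a b x)%:E =
      \int[lebesgue_rV n]_(x in obox a b) f k x)%E.
    rewrite integral_mkcond [RHS]integral_mkcond; apply: eq_integral => x _.
    rewrite !patchE; case: ifPn => [xB|xB]; case: ifPn => //.
      by move=> /negP; rewrite inE => xo; rewrite boxbump_out// mulr0.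
    by rewrite inE => /oB; move/negP: xB; rewrite inE.
  have ifk : (lebesgue_rV n).-integrable (obox a b) (f k).
    apply: le_integrable io => //.
    by apply/measurable_EFinP; exact: measurable_funM.
  by move=> H; rewrite -(fineK (integrable_fin_num mo ifk)) H.
have fcvg : (\int[lebesgue_rV n]_(x in obox a b) f k x)%E @[k --> \oo] -->
    (\int[lebesgue_rV n]_(x in obox a b) (h x)%:E)%E.
  apply: (@dominated_cvg _ _ _ (lebesgue_rV n) _ mo f _ (abse \o (EFin \o h))).
  - by move=> k; apply/measurable_EFinP; exact: measurable_funM.
  - move=> x xo; apply: cvg_EFin; first exact: nearW.
    by rewrite -[X in _ --> X]mulr1; apply: cvgMr; exact: boxbump_cvg.
  - by [].
  - exact: integrable_abse.
  - by move=> k x _; exact: fle.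
have := cvg_lim (@ereal_hausdorff R) fcvg.
rewrite (_ : (fun k => _) = cst 0%E); last by apply/funext.
by rewrite lim_cst// => <-.
Qed.

(** The sets [A] for which [h] has zero integral over the part of the box in [A] form a Dynkin class
    containing the open boxes, a generating family stable under intersection. Hence [h] has zero
    integral on every measurable subset of the box. *)
Lemma ae_obox0 a b : cbox a b `<=` B ->
  {ae lebesgue_rV n, forall x, obox a b x -> h x = 0}.
Proof.
move=> abB; have mo := @measurable_obox R n a b.
have io : (lebesgue_rV n).-integrable (obox a b) (EFin \o h).
  apply: (@integrableS _ _ _ _ (cbox a b)) => //.
  - by apply: compact_measurable_rV; exact: compact_cbox.
  - exact: obox_cbox.
  - by apply: ih => //; exact: compact_cbox.
have iA A : measurable A -> (lebesgue_rV n).-integrable (obox a b `&` A) (EFin \o h).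
  by move=> mA; apply: integrableS io => //; exact: measurableI.
have zero A : measurable A -> (\int[lebesgue_rV n]_(x in obox a b `&` A) (h x)%:E = 0)%E.
  rewrite measurable_oboxes => sA.
  apply: (@dynkin_induction _ 'rV[R]_n (@oboxes R n)
    (fun A => (\int[lebesgue_rV n]_(x in obox a b `&` A) (h x)%:E = 0)%E)) sA => //.
  - exact: measurable_oboxes.
  - exact: oboxes_setI.
  - by rewrite setIT; exact: integral_obox0.
  - move=> _ [a' [b' ->]]; rewrite oboxI; apply: integral_obox0.
    apply: subset_trans abB => x /= H i; have := H i; rewrite !mxE.
    by rewrite ge_max le_min => /andP[/andP[-> _] /andP[-> _]].
  - move=> S mS S0.
    have : (\int[lebesgue_rV n]_(x in (obox a b `&` S) `|` (obox a b `&` ~` S)) (h x)%:E = 0)%E.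
      by rewrite -setIUr setUv setIT; exact: integral_obox0.
    rewrite integral_setU//.
    + by rewrite S0 add0e.
    + exact: measurableI.
    + by apply: measurableI => //; exact: measurableC.
    + by rewrite -setIUr setUv setIT; exact: measurable_int io.
    + by rewrite disj_set2E setIACA setICr setI0.
  - move=> F mF tF F0; rewrite setI_bigcupr integral_bigcup//.
    + by rewrite eseries0.
    + exact: trivIset_setIl.
    + by move=> k; exact: measurableI.
    + by rewrite -setI_bigcupr; apply: iA; exact: bigcup_measurable.
have := @integral_ae_eq _ _ _ (lebesgue_rV n) (obox a b) mo (cst 0%E) (EFin \o h) io.
move=> H; have : ae_eq (lebesgue_rV n) (obox a b) (EFin \o h) (cst 0%E).
  apply: H => // E Eo mE; rewrite integral0.
  by have := zero E mE; rewrite setIidr.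
by apply: filterS => x H1 xo; have := H1 xo => -[].
Qed.

End fundamental_lemma.

(** * Hadamard's inequality and quasiregular gradients *)

Section hadamard.
Context {R : realType} (n : nat).
Implicit Types A B : 'M[R]_n.

Lemma dotp_sumr m (I : finType) (P : pred I) (x : 'rV[R]_m) (F : I -> 'rV[R]_m) :
  dotp x (\sum_(i | P i) F i) = \sum_(i | P i) dotp x (F i).
Proof.
rewrite /dotp exchange_big/=; apply: eq_bigr => k _.
by rewrite summxE mulr_sumr.
Qed.

(** From row [k] its projections on the earlier rows are subtracted. The matrix [L] doing this is
    triangular with unit diagonal, so the determinant is kept, and by Pythagoras the row does not
    get longer. *)
Lemma gram_schmidt_step A (k : 'I_n) :
  (forall i j : 'I_n, (i < k)%N -> (j < k)%N -> i != j -> dotp (row i A) (row j A) = 0) ->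
  exists B, [/\ \det B = \det A,
    forall i, enorm (row i B) <= enorm (row i A) &
    forall i j : 'I_n, (i <= k)%N -> (j <= k)%N -> i != j ->
      dotp (row i B) (row j B) = 0].
Proof.
move=> oA.
pose c (j : 'I_n) := if (j < k)%N then dotp (row k A) (row j A) / dotp (row j A) (row j A) else 0.
pose L : 'M[R]_n := \matrix_(i, j) ((i == j)%:R - (if i == k then c j else 0)).
pose s := \sum_j c j *: row j A.
have rowLk : row k (L *m A) = row k A - s.
  rewrite row_mul; apply/rowP => l; rewrite !mxE summxE -[A k l]mul1r.
  under eq_bigr do rewrite !mxE eqxx mulrBl.
  rewrite sumrB; congr (_ - _); last by apply: eq_bigr => j _; rewrite !mxE.
  rewrite (bigD1 k)//= eqxx big1 ?addr0// => j jk.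
  by rewrite eq_sym (negbTE jk) mul0r.
have rowL i : i != k -> row i (L *m A) = row i A.
  move=> ik; rewrite row_mul; apply/rowP => l; rewrite !mxE.
  under eq_bigr do rewrite !mxE (negbTE ik) subr0.
  rewrite (bigD1 i)//= eqxx mul1r big1 ?addr0// => j ji.
  by rewrite eq_sym (negbTE ji) mul0r.
have ck (j : 'I_n) : ~~ (j < k)%N -> c j = 0 by rewrite /c => /negbTE ->.
have ortho (j : 'I_n) : (j < k)%N -> dotp (row k A - s) (row j A) = 0.
  move=> jk; rewrite dotpBl [X in _ - X]dotpC /s dotp_sumr.
  rewrite (bigD1 j)//= big1 ?addr0; last first.
    move=> i ij; rewrite dotpZr; have [ik|ik] := boolP (i < k)%N; last by rewrite ck// mul0r.
    by rewrite (oA j i)// ?mulr0// eq_sym.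
  (* A zero row has coefficient zero, as division by zero gives zero, and is orthogonal to
     everything; otherwise the coefficient removes exactly the inner product. *)
  rewrite dotpZr /c jk; have [z|nz] := eqVneq (dotp (row j A) (row j A)) 0.
    have : row j A == 0 by rewrite -enorm_eq0 /enorm z sqrtr0.
    by move=> /eqP ->; rewrite dotpC !dotp0 mulr0 subr0.
  by rewrite divfK// subrr.
exists (L *m A); split.
- rewrite det_mulmx det_trig.
    rewrite big1 ?mul1r// => i _; rewrite !mxE eqxx; case: eqP => [->|_]; last by rewrite subr0.
    by rewrite ck ?subr0// ltnn.
  apply/is_trig_mxP => i j ij; rewrite !mxE.
  rewrite (_ : (i == j) = false); last by apply/negbTE; rewrite neq_ltn ij.
  case: eqP => [ik|_]; last by rewrite subr0.
  by rewrite ck ?subr0// -leqNgt -ik ltnW.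
- move=> i; have [->|ik] := eqVneq i k; last by rewrite rowL.
  rewrite rowLk -ler_sqr ?nnegrE ?enorm_ge0// !sqr_enorm.
  set r := row k A - s.
  have -> : row k A = r + s by rewrite /r subrK.
  have rs : dotp r s = 0.
    rewrite /s dotp_sumr big1// => j _; rewrite dotpZr.
    have [jk|jk] := boolP (j < k)%N; first by rewrite ortho// mulr0.
    by rewrite ck// mul0r.
  have gen (x y : 'rV[R]_n) : dotp x y = 0 -> dotp x x <= dotp (x + y) (x + y).
    move=> xy; rewrite !(dotpDl, dotpDr) (dotpC y x) xy addr0 add0r.
    by rewrite lerDl dotp_ge0.
  exact: gen.
- move=> i j ik jk ij.
  have lt (l : 'I_n) : (l <= k)%N -> l != k -> (l < k)%N.
    by move=> lk nlk; rewrite ltn_neqAle lk andbT.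
  have [ei|nik] := eqVneq i k; have [ej|njk] := eqVneq j k.
  + by move: ij; rewrite ei ej eqxx.
  + by rewrite ei rowLk rowL// ortho// lt.
  + by rewrite dotpC ej rowLk rowL// ortho// lt.
  + by rewrite !rowL// oA// lt.
Qed.

Lemma orthogonalize A : exists B, [/\ \det B = \det A,
    forall i, enorm (row i B) <= enorm (row i A) &
    forall i j : 'I_n, i != j -> dotp (row i B) (row j B) = 0].
Proof.
suff H k : (k <= n)%N -> exists B, [/\ \det B = \det A,
    forall i, enorm (row i B) <= enorm (row i A) &
    forall i j : 'I_n, (i < k)%N -> (j < k)%N -> i != j -> dotp (row i B) (row j B) = 0].
  by have [B [dB nB oB]] := H n (leqnn n); exists B; split => // i j ij; exact: oB.
elim: k => [_|k ih kn]; first by exists A; split.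
have [B [dB nB oB]] := ih (ltnW kn).
have [C [dC nC oC]] := @gram_schmidt_step B (Ordinal kn) oB.
exists C; split.
- by rewrite dC.
- by move=> i; exact: le_trans (nC i) (nB i).
- exact: oC.
Qed.

(** For the orthogonalized [B] the matrix [B *m B^T] is diagonal, so the squared determinant is the
    product of the squared row norms, and no row of [B] is longer than that of [A]. *)
Lemma hadamard_rows A : `|\det A| <= \prod_i enorm (row i A).
Proof.
have [B [<- nB oB]] := orthogonalize A.
apply: (@le_trans _ _ (\prod_i enorm (row i B))); last first.
  by apply: ler_prod => i _; rewrite enorm_ge0 nB.
have E : B *m B^T = diag_mx (\row_i dotp (row i B) (row i B)).
  apply/matrixP => i j; rewrite !mxE.
  have -> : \sum_k B i k * B^T k j = dotp (row i B) (row j B).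
    by apply: eq_bigr => k _; rewrite !mxE.
  by have [->|ij] := eqVneq i j; rewrite ?mulr1n// mulr0n oB.
have : (\det B) ^+ 2 = (\prod_i enorm (row i B)) ^+ 2.
  rewrite expr2 -{2}det_tr -det_mulmx E det_diag -prodrXl.
  by apply: eq_bigr => i _; rewrite mxE sqr_enorm.
move=> H; rewrite -ler_sqr ?nnegrE ?prodr_ge0//.
  by rewrite -normrX H ger0_norm// sqr_ge0.
by move=> i _; exact: enorm_ge0.
Qed.

Lemma coord_mulmx (v : 'rV[R]_n) A j : (v *m A) 0 j = dotp v (row j A^T).
Proof. by rewrite mxE; apply: eq_bigr => k _; rewrite !mxE. Qed.

Lemma enorm_mulmx (v : 'rV[R]_n) A :
  enorm (v *m A) <= enorm v * Num.sqrt (\sum_j enorm (row j A^T) ^+ 2).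
Proof.
have s0 : 0 <= \sum_j enorm (row j A^T) ^+ 2 by apply: sumr_ge0 => j _; exact: sqr_ge0.
rewrite -ler_sqr ?nnegrE ?mulr_ge0 ?enorm_ge0 ?sqrtr_ge0//.
rewrite sqr_enorm exprMn (sqr_sqrtr s0) mulr_sumr; apply: ler_sum => j _.
rewrite coord_mulmx -expr2 -exprMn -real_normK ?num_real//.
by rewrite lerXn2r ?nnegrE ?mulr_ge0 ?enorm_ge0// cauchy_schwarz.
Qed.

Lemma enorm_mulmx_le_opnorm (v : 'rV[R]_n) A : enorm v <= 1 -> enorm (v *m A) <= opnorm A.
Proof.
move=> v1; apply: sup_upper_bound; last by exists v.
split; first by exists (enorm (0 *m A)); exists 0 => //=; rewrite enorm0.
exists (Num.sqrt (\sum_j enorm (row j A^T) ^+ 2)) => _ [w /= w1 <-].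
by apply: le_trans (enorm_mulmx _ _) _; rewrite ler_piMl// sqrtr_ge0.
Qed.

(** The unit vector along the column [c] is sent to a vector whose [j]-th coordinate is [|c|]. In
    the convention [v *m A] the columns are the gradients of the components. *)
Lemma enorm_col_le_opnorm A j : enorm (row j A^T) <= opnorm A.
Proof.
set c := row j A^T.
have [->|c0] := eqVneq c 0.
  rewrite enorm0; apply: le_trans (@enorm_mulmx_le_opnorm 0 A _); first exact: enorm_ge0.
  by rewrite enorm0.
have cp : 0 < enorm c by rewrite enorm_gt0.
have d1 : enorm (direction c) = 1 by exact: enorm_direction.
apply: le_trans (@enorm_mulmx_le_opnorm (direction c) A _); last by rewrite d1.
apply: le_trans (coord_le_enorm _ j); rewrite coord_mulmx -/c dotpZl -sqr_enorm.
by rewrite expr2 mulKf ?gt_eqF// ler_norm.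
Qed.

(** Hadamard for [A^T], with every column but [c_j] bounded by the operator norm, gives
    [\det A <= |c_j| |A|^(n-1)]. Then the distortion inequality yields [|c_i| <= |A| <= K |c_j|]
    after cancelling [|A|^(n-1)]. *)
Lemma quasiregular_matrix A (K : R) i j : 0 <= K -> opnorm A ^+ n <= K * \det A ->
  enorm (row i A^T) <= K * enorm (row j A^T).
Proof.
move=> K0 HA; have n0 : (0 < n)%N by case: (n) i => [[]|].
have op0 : 0 <= opnorm A by apply: le_trans (enorm_col_le_opnorm A i); exact: enorm_ge0.
have detA : \det A <= enorm (row j A^T) * opnorm A ^+ n.-1.
  apply: le_trans (ler_norm _) _; rewrite -det_tr; apply: le_trans (hadamard_rows _) _.
  rewrite (bigD1 j)//= ler_wpM2l ?enorm_ge0//.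
  apply: (@le_trans _ _ (\prod_(k < n | k != j) opnorm A)).
    by apply: ler_prod => k _; rewrite enorm_ge0 enorm_col_le_opnorm.
  by rewrite prodr_const cardC1 card_ord.
have [op|op] := eqVneq (opnorm A) 0.
  apply: (@le_trans _ _ 0); first by rewrite -op enorm_col_le_opnorm.
  by rewrite mulr_ge0// enorm_ge0.
have opp : 0 < opnorm A by rewrite lt_neqAle eq_sym op.
apply: le_trans (enorm_col_le_opnorm A i) _.
rewrite -(ler_pM2r (exprn_gt0 n.-1 opp)) -exprS prednK//.
by apply: le_trans HA _; rewrite -mulrA ler_wpM2l.
Qed.

End hadamard.

(** * From distortion almost everywhere to gradients at every point *)

Section gradient_comparison.
Context {R : realType}.

(** [C] has finite measure and [|g| <= 1 + |g|^n]. *)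
Lemma Lp_loc_integrable n (g : 'rV[R]_n -> R) (C : set 'rV[R]_n) : (0 < n)%N ->
  Lp_loc n%:R (eball n) g -> compact C -> C `<=` eball n ->
  (lebesgue_rV n).-integrable C (EFin \o g).
Proof.
move=> n0 [mg ig] cC CB; have mC := compact_measurable_rV cC.
have Coo : (lebesgue_rV n C < +oo)%E.
  apply: le_lt_trans (lebesgue_eball_lty n); apply: le_measure; rewrite ?inE//.
  exact: measurable_eball.
have i1 : (lebesgue_rV n).-integrable C (EFin \o cst (1 : R)).
  apply: measurable_bounded_integrable => //.
  by exists 1; split; [exact: num_real|move=> N N1 x _; rewrite /cst normr1; exact: ltW].
apply: (le_integrable _ _ _ (integrableD mC i1 (ig C cC CB))) => //.
  by apply/measurable_EFinP; apply: measurable_funS CB mg; exact: measurable_eball.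
move=> x Cx; rewrite /= lee_fin [leRHS]ger0_norm ?addr_ge0 ?powR_ge0//.
have [g1|g1] := leP `|g x| 1; first by rewrite ler_wpDr ?powR_ge0.
rewrite ler_wpDl// -[leLHS]powRr1// ler_powR ?(ltW g1)//.
by rewrite ler1n.
Qed.

(** The classical partial derivative obeys the same integration by parts as [g], so their difference
    is orthogonal to all test functions and the fundamental lemma applies on the box. *)
Lemma weak_partial_unique n (i : 'I_n) (u g : 'rV[R]_n -> R) a b :
  Ck 1 (eball n) u -> weak_partial (eball n) i u g -> Lp_loc n%:R (eball n) g ->
  cbox a b `<=` eball n ->
  {ae lebesgue_rV n, forall x, obox a b x -> g x = 'D_(basis_vec i) u x}.
Proof.
move=> cu wg lg abB; have n0 : (0 < n)%N by exact: leq_ltn_trans (leq0n i) (ltn_ord i).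
have cdu x : eball n x -> {for x, continuous ('D_(basis_vec i) u)}.
  by apply: (@Ck_continuous _ _ 0); exact: Ck_partial cu.
have mdu : measurable_fun (eball n) ('D_(basis_vec i) u).
  by apply: continuous_at_measurable => //; exact: measurable_eball.
have [mg _] := lg.
have mB := @measurable_eball R n.
pose h x := g x - 'D_(basis_vec i) u x.
have mh : measurable_fun (eball n) h by exact: measurable_funB.
have ih C : compact C -> C `<=` eball n -> (lebesgue_rV n).-integrable C (EFin \o h).
  move=> cC CB; have mC := compact_measurable_rV cC.
  have [M M0 HM] := compact_bounded_fun cC (fun x Cx => cdu x (CB x Cx)).
  have iD : (lebesgue_rV n).-integrable C (EFin \o 'D_(basis_vec i) u).
    apply: measurable_bounded_integrable => //.
    - by apply: le_lt_trans (lebesgue_eball_lty n); apply: le_measure; rewrite ?inE.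
    - exact: measurable_funS CB mdu.
    - exists M; split; first exact: num_real.
      by move=> N MN x /HM H; exact: le_trans H (ltW MN).
  exact: (integrableB mC (Lp_loc_integrable n0 lg cC CB) iD).
have h0 phi : test_fun (eball n) phi -> \int[lebesgue_rV n]_(x in eball n) (h x * phi x) = 0.
  move=> tphi; have := wg _ tphi; rewrite (C1_weak_partial i cu tphi) => /oppr_inj.
  move=> E; have [sphi cK KB] := tphi.
  have cphi : continuous phi by move=> x; exact: Ck_continuous (sphi 0%N) _.
  have mK := compact_measurable_rV cK.
  have i2 : (lebesgue_rV n).-integrable (eball n) (fun x => ('D_(basis_vec i) u x * phi x)%:E).
    by apply: (@integrable_mul_test _ _ _ _ _ cK KB cphi _ cdu) => x /supp_zero.
  have i1 : (lebesgue_rV n).-integrable (eball n) (fun x => (g x * phi x)%:E).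
    have [M M0 HM] := compact_bounded_fun cK (fun x _ => cphi x).
    have ik : (lebesgue_rV n).-integrable (closure [set x | phi x != 0])
        (fun x => (g x * phi x)%:E).
      apply: (@integrableMl _ _ _ _ _ mK (EFin \o g) phi).
      - exact: Lp_loc_integrable.
      - exact: measurable_funTS (continuous_measurable_rV cphi).
      - exists M; split; first exact: num_real.
        by move=> N MN x /HM H; exact: le_trans H (ltW MN).
    rewrite (integrable_mkcond _ mB) (_ : _ \_ _ =
        (fun x => (g x * phi x)%:E) \_ (closure [set x | phi x != 0])).
      by apply/(integrable_mkcond _ mK).
    apply/funext => x; rewrite !patchE; case: ifPn => [xB|xB]; case: ifPn => //.
      by move=> /negP; rewrite inE => /supp_zero ->; rewrite mulr0.
    by rewrite inE => /KB; move/negP: xB; rewrite inE.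
  have : \int[lebesgue_rV n]_(x in eball n) (g x * phi x) -
    \int[lebesgue_rV n]_(x in eball n) ('D_(basis_vec i) u x * phi x) = 0.
    by rewrite E subrr.
  rewrite -RintegralB// => <-; apply: eq_Rintegral => x _.
  by rewrite /h mulrBl.
have := ae_obox0 mh ih h0 abB.
by apply: filterS => x H xo; apply/eqP; rewrite -subr_eq0; apply/eqP; exact: H.
Qed.

Lemma ae_exists n (A : set 'rV[R]_n) (P : 'rV[R]_n -> Prop) x :
  open A -> A x -> {ae lebesgue_rV n, forall y, P y} -> exists2 y, A y & P y.
Proof.
move=> oA Ax [N [mN N0 PN]]; apply: contrapT => H.
have AN : A `<=` N.
  by move=> y Ay; apply: PN => Py; apply: H; exists y.
have := lebesgue_open_gt0 oA Ax.
have : (lebesgue_rV n A <= lebesgue_rV n N)%E.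
  by apply: le_measure; rewrite ?inE//; exact: open_measurable_rV.
by rewrite N0 leNgt => /negP.
Qed.

Lemma grad_continuous n (u : 'rV[R]_n -> R) x : Ck 1 (eball n) u -> eball n x ->
  {for x, continuous (fun y => enorm (grad u y))}.
Proof.
move=> cu xB; apply: (@continuous_comp _ _ _ (grad u) (@enorm R n)); last exact: enorm_continuous.
apply: continuous_rV => i; rewrite (_ : (fun y => _) = 'D_(basis_vec i) u).
  by apply: (@Ck_continuous _ _ 0) xB; exact: Ck_partial cu.
by apply/funext => y; rewrite mxE.
Qed.

Lemma nbhs_cbox n (x : 'rV[R]_n) (A : set 'rV[R]_n) : nbhs x A ->
  exists a b, obox a b x /\ cbox a b `<=` A.
Proof.
move=> /nbhs_ballP[e /= e0 eA].
exists (x - const_mx (e / 2)), (x + const_mx (e / 2)); split.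
  by move=> i; rewrite !mxE; lra.
move=> y xy; apply: eA; apply/ball_rVP => // i; have := xy i; rewrite !mxE.
by rewrite ltr_norml; lra.
Qed.

(** If the inequality failed at [x], it would fail on a box around [x] by continuity. The box has
    positive measure, so it contains a point where [A] is the classical derivative and the
    distortion inequality holds, against the matrix estimate. *)
Lemma quasiregular_grad_le n (K : R) (f : 'rV[R]_n -> 'rV[R]_n) i j x : 0 <= K ->
  quasiregular K (eball n) f -> (forall k, Ck 1 (eball n) (component f k)) ->
  eball n x -> enorm (grad (component f i) x) <= K * enorm (grad (component f j) x).
Proof.
move=> K0 [_ [A [[_ sA] qA]]] cf xB; rewrite leNgt; apply/negP => H.
pose g y := enorm (grad (component f i) y) - K * enorm (grad (component f j) y).
have cg : {for x, continuous g}.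
  apply: add_continuous; first exact: grad_continuous.
  apply: opp_continuous_fun; apply: mul_continuous; first exact: cst_continuous.
  exact: grad_continuous.
have gx : 0 < g x by rewrite subr_gt0.
have n1 : \forall y \near x, 0 < g y by exact: (cvgr_gt _ cg).
have n2 : \forall y \near x, eball n y.
  by apply: open_nbhs_nbhs; split => //; exact: open_eball.
have [a [b [abx abH]]] := nbhs_cbox (filterI n1 n2).
have abB : cbox a b `<=` eball n by move=> y /abH [].
have aeA : {ae lebesgue_rV n, forall y, obox a b y ->
    forall k l, A y k l = 'D_(basis_vec k) (component f l) y}.
  (* There are finitely many index pairs, so one null set serves them all. *)
  have : {ae lebesgue_rV n, forall y, forall kl : 'I_n * 'I_n, obox a b y ->
      A y kl.1 kl.2 = 'D_(basis_vec kl.1) (component f kl.2) y}.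
    apply: filter_forall => -[k l] /=; have [wk lk] := sA k l.
    exact: weak_partial_unique (cf l) wk lk abB.
  by apply: filterS => y Hy yab k l; exact: (Hy (k, l)).
have [y yab [Hy qy]] := ae_exists (@open_obox R n a b) abx (filterI aeA qA).
have [gy yB] := abH _ (obox_cbox yab).
have := quasiregular_matrix i j K0 (qy yB).
have rowE l : row l (A y)^T = grad (component f l) y.
  by apply/rowP => k; rewrite !mxE (Hy yab).
by rewrite !rowE leNgt -subr_gt0 => /negP.
Qed.

End gradient_comparison.

(** * Calculus of the invariant Laplacian *)

Section Ck_calculus.
Context {R : realType} (n : nat) (Omega : set 'rV[R]_n).
Hypothesis oO : open Omega.
Implicit Types f g : 'rV[R]_n -> R.

Lemma near_open (x : 'rV[R]_n) : Omega x -> \forall y \near x, Omega y.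
Proof. by move=> xO; exact: open_nbhs_nbhs. Qed.

Lemma near_eq_on f g x : (forall y, Omega y -> f y = g y) -> Omega x ->
  \forall y \near x, f y = g y.
Proof.
by move=> fg /near_open; apply: (@filterS _ (nbhs x)) => y; exact: fg.
Qed.

Lemma derive_on f g x v : (forall y, Omega y -> f y = g y) -> Omega x ->
  'D_v f x = 'D_v g x.
Proof. by move=> fg xO; apply: near_eq_derive; exact: near_eq_on fg xO. Qed.

(** Partial derivatives on the open set [Omega] are local, so the values outside it do not
    matter. *)
Lemma Ck_ext k f g : (forall y, Omega y -> f y = g y) -> Ck k Omega f -> Ck k Omega g.
Proof.
have cfg (h1 h2 : 'rV[R]_n -> R) : (forall y, Omega y -> h1 y = h2 y) ->
    (forall x, Omega x -> {for x, continuous h1}) ->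
    forall x, Omega x -> {for x, continuous h2}.
  move=> h12 c1 x xO; apply: (@near_continuous R _ h1 h2 x _ (c1 x xO)).
  exact: (near_eq_on (fun y yO => esym (h12 y yO)) xO).
elim: k f g => [|k ih] f g fg; first exact: cfg fg.
move=> [cf df]; split; first exact: cfg fg cf.
move=> i; have [dfi cdfi] := df i; split.
  by move=> x xO; apply: near_eq_derivable (dfi x xO); exact: near_eq_on fg xO.
by apply: ih cdfi => y yO; exact: derive_on fg yO.
Qed.

Lemma CkS_intro k f (f' : 'I_n -> 'rV[R]_n -> R) :
  (forall x, Omega x -> {for x, continuous f}) ->
  (forall i x, Omega x -> is_derive x (basis_vec i) f (f' i x)) ->
  (forall i, Ck k Omega (f' i)) -> Ck k.+1 Omega f.
Proof.
move=> cf df cf'; split => // i; split; first by move=> x xO; have [] := df i x xO.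
apply: Ck_ext (cf' i) => x xO.
by have /@derive_val := df i x xO.
Qed.

Lemma Ck_cst k (c : R) : Ck k Omega (fun=> c).
Proof.
elim: k c => [|k ih] c; first by move=> x _; exact: cst_continuous.
apply: (@CkS_intro k _ (fun _ _ => 0)).
- by move=> x _; exact: cst_continuous.
- by move=> i; exact: ih.
Qed.

Lemma Ck_add k f g : Ck k Omega f -> Ck k Omega g -> Ck k Omega (fun x => f x + g x).
Proof.
elim: k f g => [|k ih] f g cf cg.
  by move=> x xO; apply: add_continuous; [exact: cf|exact: cg].
apply: (@CkS_intro k _ (fun i x => 'D_(basis_vec i) f x + 'D_(basis_vec i) g x)).
- by move=> x xO; apply: add_continuous; [exact: Ck_continuous cf xO|exact: Ck_continuous cg xO].
- by move=> i x xO; exact: is_derive_add (Ck_is_derive i cf xO) (Ck_is_derive i cg xO).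
- by move=> i; apply: ih; exact: Ck_partial.
Qed.

Lemma Ck_mul k f g : Ck k Omega f -> Ck k Omega g -> Ck k Omega (fun x => f x * g x).
Proof.
elim: k f g => [|k ih] f g cf cg.
  by move=> x xO; apply: mul_continuous; [exact: cf|exact: cg].
apply: (@CkS_intro k _ (fun i x => 'D_(basis_vec i) f x * g x + f x * 'D_(basis_vec i) g x)).
- by move=> x xO; apply: mul_continuous; [exact: Ck_continuous cf xO|exact: Ck_continuous cg xO].
- by move=> i x xO; exact: is_derive_mul (Ck_is_derive i cf xO) (Ck_is_derive i cg xO).
- move=> i; apply: Ck_add; apply: ih; try exact: Ck_partial.
    exact: Ck_le cg.
  exact: Ck_le cf.
Qed.

Lemma Ck_opp k f : Ck k Omega f -> Ck k Omega (fun x => - f x).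
Proof.
move=> cf; apply: Ck_ext (Ck_mul (Ck_cst k (-1)) cf) => x _.
by rewrite mulN1r.
Qed.

Lemma Ck_sum k (I : Type) (r : seq I) (F : I -> 'rV[R]_n -> R) :
  (forall i, Ck k Omega (F i)) -> Ck k Omega (fun x => \sum_(i <- r) F i x).
Proof.
move=> cF; elim: r => [|i r ih].
  by apply: Ck_ext (Ck_cst k 0) => x _; rewrite big_nil.
by apply: Ck_ext (Ck_add (cF i) ih) => x _; rewrite big_cons.
Qed.

Lemma is_derive_powR f x v d (s : R) : 0 < f x -> is_derive x v f d ->
  is_derive x v (fun y => f y `^ s) (s * f x `^ (s - 1) * d).
Proof. by move=> fx df; have := is_derive_comp1 df (is_derive1_powR s fx). Qed.

Lemma powR_continuous_at (t s : R) : 0 < t -> {for t, continuous (fun y : R => y `^ s)}.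
Proof.
move=> t0; apply: differentiable_continuous; apply/derivable1_diffP.
by have [] := is_derive1_powR s t0.
Qed.

(** The induction on [k] lets [s] vary, since each derivative lowers the exponent by one. *)
Lemma Ck_powR k f (s : R) : (forall x, Omega x -> 0 < f x) -> Ck k Omega f ->
  Ck k Omega (fun x => f x `^ s).
Proof.
move=> f0; have cp (t : R) x : Omega x -> {for x, continuous f} ->
    {for x, continuous (fun x => f x `^ t)}.
  move=> xO cf; apply: (@continuous_comp _ _ _ f (fun y : R => y `^ t)) => //.
  by apply: powR_continuous_at; exact: f0.
elim: k f s f0 cp => [|k ih] f s f0 cp cf; first by move=> x xO; apply: cp => //; exact: cf.
apply: (@CkS_intro k _ (fun i x => s * f x `^ (s - 1) * 'D_(basis_vec i) f x)).
- by move=> x xO; apply: cp => //; exact: Ck_continuous cf xO.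
- by move=> i x xO; exact: is_derive_powR (f0 x xO) (Ck_is_derive i cf xO).
- move=> i; apply: Ck_mul; last exact: Ck_partial.
  apply: Ck_mul; first exact: Ck_cst.
  by apply: ih => //; exact: Ck_le cf.
Qed.

End Ck_calculus.

Section inv_laplacian_calculus.
Context {R : realType} (n : nat).
Implicit Types f g : 'rV[R]_n -> R.
Let B := @eball R n.
Let oB : open B := @open_eball R n.

Lemma partialD f g i x : Ck 1 B f -> Ck 1 B g -> B x ->
  'D_(basis_vec i) (fun y => f y + g y) x = 'D_(basis_vec i) f x + 'D_(basis_vec i) g x.
Proof.
move=> cf cg xB.
by have /@derive_val := is_derive_add (Ck_is_derive i cf xB) (Ck_is_derive i cg xB).
Qed.

Lemma partialM f g i x : Ck 1 B f -> Ck 1 B g -> B x ->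
  'D_(basis_vec i) (fun y => f y * g y) x =
  'D_(basis_vec i) f x * g x + f x * 'D_(basis_vec i) g x.
Proof.
move=> cf cg xB.
by have /@derive_val := is_derive_mul (Ck_is_derive i cf xB) (Ck_is_derive i cg xB).
Qed.

Lemma partial_powR f i x (s : R) : (forall y, B y -> 0 < f y) -> Ck 1 B f -> B x ->
  'D_(basis_vec i) (fun y => f y `^ s) x = s * f x `^ (s - 1) * 'D_(basis_vec i) f x.
Proof.
move=> f0 cf xB.
by have /@derive_val := is_derive_powR s (f0 x xB) (Ck_is_derive i cf xB).
Qed.

Lemma gradD f g x : Ck 1 B f -> Ck 1 B g -> B x ->
  grad (fun y => f y + g y) x = grad f x + grad g x.
Proof. by move=> cf cg xB; apply/rowP => i; rewrite !mxE partialD. Qed.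

Lemma gradM f g x : Ck 1 B f -> Ck 1 B g -> B x ->
  grad (fun y => f y * g y) x = g x *: grad f x + f x *: grad g x.
Proof.
by move=> cf cg xB; apply/rowP => i; rewrite !mxE partialM// [_ * g x]mulrC.
Qed.

Lemma grad_powR f x (s : R) : (forall y, B y -> 0 < f y) -> Ck 1 B f -> B x ->
  grad (fun y => f y `^ s) x = (s * f x `^ (s - 1)) *: grad f x.
Proof. by move=> f0 cf xB; apply/rowP => i; rewrite !mxE partial_powR. Qed.

Lemma grad_cst (c : R) (x : 'rV[R]_n) : grad (fun=> c) x = 0.
Proof. by apply/rowP => i; rewrite !mxE derive_cst. Qed.

Lemma laplacianD f g x : Ck 2 B f -> Ck 2 B g -> B x ->
  laplacian (fun y => f y + g y) x = laplacian f x + laplacian g x.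
Proof.
move=> cf cg xB; rewrite /laplacian -big_split/=; apply: eq_bigr => i _.
have cf1 := Ck_le (isT : (1 <= 2)%N) cf; have cg1 := Ck_le (isT : (1 <= 2)%N) cg.
rewrite (derive_on oB _ (fun y yB => partialD i cf1 cg1 yB) xB).
by rewrite partialD//; exact: Ck_partial.
Qed.

Lemma laplacianM f g x : Ck 2 B f -> Ck 2 B g -> B x ->
  laplacian (fun y => f y * g y) x =
  g x * laplacian f x + f x * laplacian g x + 2 * dotp (grad f x) (grad g x).
Proof.
move=> cf cg xB; rewrite /laplacian /dotp !mulr_sumr -!big_split/=; apply: eq_bigr => i _.
have cf1 := Ck_le (isT : (1 <= 2)%N) cf; have cg1 := Ck_le (isT : (1 <= 2)%N) cg.
rewrite (derive_on oB _ (fun y yB => partialM i cf1 cg1 yB) xB).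
have cfi := Ck_partial i cf; have cgi := Ck_partial i cg.
rewrite (partialD i (Ck_mul oB cfi cg1) (Ck_mul oB cf1 cgi) xB).
rewrite (partialM i cfi cg1 xB) (partialM i cf1 cgi xB) !mxE.
move: ('D_(basis_vec i) f x) ('D_(basis_vec i) g x) => a b.
by move: ('D_(basis_vec i) _ x) ('D_(basis_vec i) _ x) => c d; ring.
Qed.

Lemma laplacian_cst (c : R) (x : 'rV[R]_n) : laplacian (fun=> c) x = 0.
Proof.
rewrite /laplacian big1// => i _.
rewrite (_ : 'D_(basis_vec i) (fun=> c) = fun=> 0); first exact: derive_cst.
by apply/funext => y; exact: derive_cst.
Qed.

Lemma laplacian_powR f x (s : R) : (forall y, B y -> 0 < f y) -> Ck 2 B f -> B x ->
  laplacian (fun y => f y `^ s) x =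
  s * f x `^ (s - 1) * laplacian f x +
  s * (s - 1) * f x `^ (s - 2) * dotp (grad f x) (grad f x).
Proof.
move=> f0 cf xB; rewrite /laplacian /dotp !mulr_sumr -!big_split/=; apply: eq_bigr => i _.
have cf1 := Ck_le (isT : (1 <= 2)%N) cf; have cfi := Ck_partial i cf.
rewrite (derive_on oB _ (fun y yB => partial_powR i s f0 cf1 yB) xB).
have cp := Ck_powR oB (s - 1) f0 cf1.
rewrite (partialM i (Ck_mul oB (Ck_cst oB 1 s) cp) cfi xB).
rewrite (partialM i (Ck_cst oB 1 s) cp xB) (partial_powR i (s - 1) f0 cf1 xB) !mxE.
rewrite derive_cst (_ : s - 1 - 1 = s - 2); last by ring.
move: ('D_(basis_vec i) f x) => a.
by move: ('D_(basis_vec i) _ x) => c; ring.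
Qed.

Lemma inv_laplacianD f g x : Ck 2 B f -> Ck 2 B g -> B x ->
  inv_laplacian (fun y => f y + g y) x = inv_laplacian f x + inv_laplacian g x.
Proof.
move=> cf cg xB; rewrite /inv_laplacian laplacianD// gradD ?dotpDl//; last 2 first.
- exact: Ck_le cf.
- exact: Ck_le cg.
by ring.
Qed.

(** The first-order part of the operator is a derivation, so the gradient product comes from the
    leading part [(1 - |x|^2)^2 Delta] alone. *)
Lemma inv_laplacianM f g x : Ck 2 B f -> Ck 2 B g -> B x ->
  inv_laplacian (fun y => f y * g y) x =
  g x * inv_laplacian f x + f x * inv_laplacian g x +
  2 * (1 - enorm x ^+ 2) ^+ 2 * dotp (grad f x) (grad g x).
Proof.
move=> cf cg xB; rewrite /inv_laplacian laplacianM// gradM ?dotpDl ?dotpZl//; last 2 first.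
- exact: Ck_le cf.
- exact: Ck_le cg.
by ring.
Qed.

Lemma inv_laplacian_cst (c : R) (x : 'rV[R]_n) : inv_laplacian (fun=> c) x = 0.
Proof. by rewrite /inv_laplacian laplacian_cst grad_cst dotp0 !mulr0 addr0. Qed.

Lemma inv_laplacian_powR f x (s : R) : (forall y, B y -> 0 < f y) -> Ck 2 B f -> B x ->
  inv_laplacian (fun y => f y `^ s) x =
  s * f x `^ (s - 1) * inv_laplacian f x +
  s * (s - 1) * f x `^ (s - 2) *
    ((1 - enorm x ^+ 2) ^+ 2 * dotp (grad f x) (grad f x)).
Proof.
move=> f0 cf xB; rewrite /inv_laplacian laplacian_powR// grad_powR ?dotpZl//; last first.
  exact: Ck_le cf.
by ring.
Qed.

Lemma inv_laplacianZ (c : R) f x : Ck 2 B f -> B x ->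
  inv_laplacian (fun y => c * f y) x = c * inv_laplacian f x.
Proof.
move=> cf xB; rewrite (inv_laplacianM (Ck_cst oB 2 c) cf xB).
by rewrite inv_laplacian_cst grad_cst dotp0 !mulr0 addr0 add0r.
Qed.

Lemma inv_laplacian_sum (I : Type) (r : seq I) (F : I -> 'rV[R]_n -> R) x :
  (forall i, Ck 2 B (F i)) -> B x ->
  inv_laplacian (fun y => \sum_(i <- r) F i y) x = \sum_(i <- r) inv_laplacian (F i) x.
Proof.
move=> cF xB; elim: r => [|i r ih].
  rewrite big_nil (_ : (fun y => _) = fun=> 0) ?inv_laplacian_cst//.
  by apply/funext => y; rewrite big_nil.
rewrite big_cons -ih -(inv_laplacianD (cF i) (Ck_sum oB r cF) xB).
by congr (inv_laplacian _ x); apply/funext => y; rewrite big_cons.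
Qed.

End inv_laplacian_calculus.

Lemma powR_succ (R : realType) (t s : R) : 0 < t -> t `^ (s + 1) = t `^ s * t.
Proof.
move=> t0; rewrite powRD ?powRr1 ?ltW//.
by rewrite (gt_eqF t0) implybT.
Qed.

(** * Subharmonic combinations of powers *)

Section subharmonic_powers.
Context {R : realType} (n : nat).
Let B := @eball R n.
Let oB : open B := @open_eball R n.
Let a (x : 'rV[R]_n) : R := (1 - enorm x ^+ 2) ^+ 2.

Let a_ge0 x : 0 <= a x.
Proof. exact: sqr_ge0. Qed.

Section one_function.
Variables (u : 'rV[R]_n -> R) (e : R).
Hypothesis hu : invariant_harmonic u.
Hypothesis e0 : 0 < e.

Let cu : Ck 2 B u. Proof. by have [] := hu. Qed.
Let cu1 : Ck 1 B u. Proof. exact: Ck_le cu. Qed.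
Let cuu : Ck 2 B (fun y => u y * u y). Proof. exact: (Ck_mul oB cu cu). Qed.

Lemma Ck_sqr_eps : Ck 2 B (fun y => u y * u y + e).
Proof. exact: (Ck_add oB cuu (Ck_cst oB 2 e)). Qed.

Lemma sqr_eps_gt0 (y : 'rV[R]_n) : 0 < u y * u y + e.
Proof. by rewrite ltr_wpDl// -expr2 sqr_ge0. Qed.

Lemma grad_sqr_eps x : B x -> grad (fun y => u y * u y + e) x = (2 * u x) *: grad u x.
Proof.
move=> xB; rewrite (gradD (Ck_le (isT : (1 <= 2)%N) cuu) (Ck_cst oB 1 e) xB).
by rewrite grad_cst addr0 (gradM cu1 cu1 xB) -scalerDl; congr (_ *: _); ring.
Qed.

Lemma inv_laplacian_sqr_eps x : B x ->
  inv_laplacian (fun y => u y * u y + e) x = 2 * a x * dotp (grad u x) (grad u x).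
Proof.
move=> xB; have hx : inv_laplacian u x = 0 by have [_] := hu; exact.
rewrite (inv_laplacianD cuu (Ck_cst oB 2 e) xB) inv_laplacian_cst addr0.
by rewrite (inv_laplacianM cu cu xB) hx !mulr0 !add0r.
Qed.

(** For [z = u^2 + e], factoring out [z^(s-2)] leaves [z + 2(s-1) u^2 = (2s-1) u^2 + e]. This is the
    origin of [p - 1] when [s = p/2], while [s = 1/2] leaves only [e]. *)
Lemma inv_laplacian_sqr_eps_powR x (s : R) : B x ->
  inv_laplacian (fun y => (u y * u y + e) `^ s) x =
  2 * s * a x * dotp (grad u x) (grad u x) * (u x * u x + e) `^ (s - 2) *
    (u x * u x + e + 2 * (s - 1) * (u x * u x)).
Proof.
move=> xB; rewrite (inv_laplacian_powR s (fun y _ => sqr_eps_gt0 y) Ck_sqr_eps xB).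
rewrite inv_laplacian_sqr_eps// grad_sqr_eps// dotpZl dotpZr.
set z := u x * u x + e; have z0 : 0 < z by exact: sqr_eps_gt0.
have -> : z `^ (s - 1) = z `^ (s - 2) * z.
  by rewrite -powR_succ//; congr (_ `^ _); ring.
rewrite -/(a x); move: (dotp _ _) (z `^ _) => d w; rewrite /z; ring.
Qed.

End one_function.

Section low_exponent.
Variables (m : nat) (f : 'I_m -> 'rV[R]_n -> R) (j : 'I_m) (K p e : R).
Hypothesis hf : forall i, invariant_harmonic (f i).
Hypothesis p12 : 1 < p <= 2.
Hypothesis e0 : 0 < e.
Hypothesis fK : forall i x, B x -> enorm (grad (f i) x) <= K * enorm (grad (f j) x).

(** The numerator compares [\sum_i |grad f_i|^2] with [|grad f_j|^2]; the denominator is the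
    convexity left in [(f_j^2 + e)^(p/2)]. *)
Let C := (1 + (m%:R - 1) * K ^+ 2) / (p - 1).
Let w (y : 'rV[R]_n) := \sum_i f i y * f i y + e.

Let cf i : Ck 2 B (f i). Proof. by have [] := hf i. Qed.

Let w_gt0 y : 0 < w y.
Proof. by rewrite ltr_wpDl// sumr_ge0// => i _; rewrite -expr2 sqr_ge0. Qed.

Let cff : Ck 2 B (fun y => \sum_i f i y * f i y).
Proof. exact: (Ck_sum oB _ (fun i => Ck_mul oB (cf i) (cf i))). Qed.

Let cw : Ck 2 B w.
Proof. exact: (Ck_add oB cff (Ck_cst oB 2 e)). Qed.

Let ILw x : B x -> inv_laplacian w x = 2 * a x * \sum_i dotp (grad (f i) x) (grad (f i) x).
Proof.
move=> xB; rewrite /w (inv_laplacianD cff (Ck_cst oB 2 e) xB) inv_laplacian_cst addr0.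
rewrite (inv_laplacian_sum _ (fun i => Ck_mul oB (cf i) (cf i)) xB) mulr_sumr.
apply: eq_bigr => i _; have hx : inv_laplacian (f i) x = 0 by have [_] := hf i; exact.
by rewrite (inv_laplacianM (cf i) (cf i) xB) hx !mulr0 !add0r.
Qed.

Let sum_grad x : B x -> \sum_i dotp (grad (f i) x) (grad (f i) x) <=
  (1 + (m%:R - 1) * K ^+ 2) * dotp (grad (f j) x) (grad (f j) x).
Proof.
move=> xB; rewrite (bigD1 j)//= mulrDl mul1r lerD2l.
apply: (@le_trans _ _ (\sum_(i < m | i != j) K ^+ 2 * dotp (grad (f j) x) (grad (f j) x))).
  apply: ler_sum => i _; rewrite -!sqr_enorm -exprMn lerXn2r ?nnegrE ?enorm_ge0//.
    by apply: le_trans (fK i xB); exact: enorm_ge0.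
  exact: fK.
rewrite sumr_const cardC1 card_ord -[leLHS]mulr_natl mulrA.
suff -> : m.-1%:R = m%:R - 1 :> R by [].
by rewrite -[in RHS](prednK (leq_ltn_trans (leq0n j) (ltn_ord j))) -natr1 addrK.
Qed.

(** As [s = p/2 <= 1], the squared gradient of [w] enters the Laplacian of [w^s] with a nonpositive
    coefficient and is dropped, and [z <= w] gives [w^(s-1) <= z^(s-1)]. The rest is compared with
    [f_j] by [sum_grad], and [key] supplies the factor [p - 1]. *)
Lemma low_exponent_subharmonic x : B x ->
  0 <= inv_laplacian (fun y => C * (f j y * f j y + e) `^ (p / 2) + - (w y `^ (p / 2))) x.
Proof.
move=> xB; have /andP[p1 p2] := p12.
have cz := Ck_powR oB (p / 2) (fun y _ => sqr_eps_gt0 (f j) e0 y) (Ck_sqr_eps e (hf j)).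
have cz' := Ck_mul oB (Ck_cst oB 2 C) cz.
have cwp := Ck_powR oB (p / 2) (fun y _ => w_gt0 y) cw.
rewrite (inv_laplacianD cz' (Ck_opp oB cwp) xB).
rewrite (inv_laplacianZ C cz xB).
rewrite (_ : (fun y => - (w y `^ (p / 2))) = fun y => -1 * w y `^ (p / 2)); last first.
  by apply/funext => y; rewrite mulN1r.
rewrite (inv_laplacianZ (-1) cwp xB) mulN1r subr_ge0.
rewrite (inv_laplacian_powR (p / 2) (fun y _ => w_gt0 y) cw xB) ILw//.
rewrite (inv_laplacian_sqr_eps_powR (hf j) e0 _ xB).
set z := f j x * f j x + e; set s := p / 2.
have z0 : 0 < z := sqr_eps_gt0 (f j) e0 x.
have wx0 := w_gt0 x.
have sg := sum_grad xB.
set d := dotp (grad (f j) x) (grad (f j) x) in sg *.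
have d0 : 0 <= d by exact: dotp_ge0.
set S := \sum_i _ in sg *.
have S0 : 0 <= S by apply: sumr_ge0 => i _; exact: dotp_ge0.
have zw : z <= w x.
  rewrite /z /w lerD2r (bigD1 j)//= lerDl sumr_ge0// => i _.
  by rewrite -expr2 sqr_ge0.
have ps : p = 2 * s by rewrite /s; lra.
have s1 : s <= 1 by rewrite /s; lra.
have s12 : 1 / 2 < s by rewrite /s; lra.
have powle : w x `^ (s - 1) <= z `^ (s - 1).
  have -> : s - 1 = - (1 - s) by ring.
  rewrite !powRN lef_pV2 ?posrE ?powR_gt0//.
  have s10 : 0 <= 1 - s by lra.
  by apply: ge0_ler_powR => //; rewrite nnegrE ltW.
have zs : z `^ (s - 1) = z `^ (s - 2) * z.
  by rewrite -powR_succ//; congr (_ `^ _); ring.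
have ax := a_ge0 x.
apply: (@le_trans _ _ (2 * s * (z `^ (s - 1) * (a x * ((1 + (m%:R - 1) * K ^+ 2) * d))))).
  apply: (@le_trans _ _ (s * w x `^ (s - 1) * (2 * a x * S))).
    rewrite gerDl -/(a x); apply: mulr_le0_ge0; last exact: mulr_ge0 ax (dotp_ge0 _).
    by apply: mulr_le0_ge0; [nra|exact: powR_ge0].
  have -> : s * w x `^ (s - 1) * (2 * a x * S) = 2 * s * (w x `^ (s - 1) * (a x * S)) by ring.
  rewrite ler_wpM2l//; first by lra.
  apply: ler_pM; [exact: powR_ge0|exact: mulr_ge0|by []|].
  exact: ler_wpM2l.
set M := 1 + (m%:R - 1) * K ^+ 2.
have M0 : 0 <= M.
  have mj : 1 <= m%:R :> R by rewrite ler1n (leq_ltn_trans (leq0n j)).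
  by rewrite /M addr_ge0// mulr_ge0 ?sqr_ge0// subr_ge0.
have p10 : 0 < p - 1 by lra.
(* The right side minus the left is [2 (1 - s) (z - f_j^2)], with [z - f_j^2 = e]. *)
have key : (p - 1) * z <= z + 2 * (s - 1) * (f j x * f j x).
  have : 0 <= (1 - s) * (z - f j x * f j x).
    by rewrite mulr_ge0 ?subr_ge0// /z lerDl ltW.
  rewrite ps; nra.
rewrite zs /C -/M -/(a x).
have -> : 2 * s * (z `^ (s - 2) * z * (a x * (M * d))) =
   M / (p - 1) * (2 * s * a x * d * z `^ (s - 2) * ((p - 1) * z)).
  by field; rewrite gt_eqF.
apply: ler_wpM2l; first by rewrite divr_ge0// ltW.
apply: ler_wpM2l => //; apply: mulr_ge0; last exact: powR_ge0.
by do 2 (apply: mulr_ge0 => //); lra.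
Qed.

End low_exponent.
End subharmonic_powers.

(** * Burkholder's function *)

Section burkholder.
Context {R : realType}.

(* Read al = |grad v|^2, be = |grad u|^2, A = |grad X|^2, B = |grad Y|^2,
   C = <grad X, grad Y>, P = (X + Y)^(p-3), a = (1 - |x|^2)^2, a lx = Delta_h X and
   a ly = Delta_h Y. *)
Lemma burkholder_algebra (p a P X Y al be A B C lx ly : R) :
  2 < p -> 0 <= a -> 0 <= P -> 0 < X -> 0 < Y -> 0 <= ly ->
  X * lx = al - A -> Y * ly = be - B -> be <= al -> 0 <= A + 2 * C + B ->
  0 <= p * (P * (X + Y) ^+ 2 * (a * lx) +
      X * ((p - 1) * (P * (X + Y)) * (a * lx + a * ly) +
           (p - 1) * (p - 2) * P * (a * (A + 2 * C + B))) +
      2 * a * ((p - 1) * (P * (X + Y)) * (A + C))) -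
    (p * (P * (X + Y) ^+ 2) * (a * lx + a * ly) +
     p * (p - 1) * (P * (X + Y)) * (a * (A + 2 * C + B))).
Proof.
move=> p2 a0 P0 X0 Y0 ly0 Elx Ely ba Q0.
(* The factor of [X + Y] becomes [(p - 2) (al - B) + (al - be)], and [al - B >= be - B = Y ly >= 0];
   the other two summands are visibly nonnegative. *)
rewrite (_ : _ - _ = a * (p * (P * (
   (X + Y) * ((p - 2) * (X * lx + A - B) + (X * lx + A - (Y * ly + B))) +
   (p - 2) * ((X + Y) * (X * ly)) + (p - 1) * ((p - 2) * (X * (A + 2 * C + B))))))); last by ring.
have p0 : 0 <= p by lra.
have S0 : 0 <= X + Y by lra.
have YL : 0 <= Y * ly by exact: mulr_ge0 (ltW Y0) ly0.
apply: mulr_ge0 => //; apply: mulr_ge0 => //; apply: mulr_ge0 => //.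
rewrite Elx Ely !subrK; apply: addr_ge0; first apply: addr_ge0.
- apply: mulr_ge0 => //; apply: addr_ge0; last by rewrite subr_ge0.
  by apply: mulr_ge0; lra.
- apply: mulr_ge0; first by lra.
  by apply: mulr_ge0 => //; apply: mulr_ge0 => //; exact: ltW.
- apply: mulr_ge0; first by lra.
  apply: mulr_ge0; first by lra.
  by apply: mulr_ge0 => //; exact: ltW.
Qed.

(** All powers of [X + Y] are written over [(X + Y)^(p-3)] to match [burkholder_algebra], with
    [lx = |gv|^2 e / X^3] and [ly = |gu|^2 e / Y^3]. *)
Lemma burkholder_vector (p a X Y e : R) n (gu gv gX gY : 'rV[R]_n) :
  2 < p -> 0 <= a -> 0 < X -> 0 < Y -> 0 < e ->
  X * (dotp gv gv * e / X ^+ 3) = dotp gv gv - dotp gX gX ->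
  Y * (dotp gu gu * e / Y ^+ 3) = dotp gu gu - dotp gY gY ->
  enorm gu <= enorm gv ->
  0 <= p * ((X + Y) `^ (p - 1) * (a * (dotp gv gv * e / X ^+ 3)) +
      X * ((p - 1) * (X + Y) `^ (p - 1 - 1) *
          (a * (dotp gv gv * e / X ^+ 3) + a * (dotp gu gu * e / Y ^+ 3)) +
        (p - 1) * (p - 1 - 1) * (X + Y) `^ (p - 1 - 2) *
          (a * dotp (gX + gY) (gX + gY))) +
      2 * a * dotp gX (((p - 1) * (X + Y) `^ (p - 1 - 1)) *: (gX + gY))) -
    (p * (X + Y) `^ (p - 1) *
        (a * (dotp gv gv * e / X ^+ 3) + a * (dotp gu gu * e / Y ^+ 3)) +
      p * (p - 1) * (X + Y) `^ (p - 2) * (a * dotp (gX + gY) (gX + gY))).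
Proof.
move=> p2 a0 X0 Y0 e0 idX idY uv.
have dQ := dotp_ge0 (gX + gY).
rewrite dotpZr !(dotpDl, dotpDr) (dotpC gY gX) in dQ *.
have ba : dotp gu gu <= dotp gv gv.
  by rewrite -!sqr_enorm lerXn2r ?nnegrE ?enorm_ge0.
have ly0 : 0 <= dotp gu gu * e / Y ^+ 3.
  by rewrite divr_ge0 ?mulr_ge0 ?exprn_ge0 ?dotp_ge0// ltW.
have Sx : 0 < X + Y by exact: addr_gt0.
have E3 : p - 1 - 2 = p - 3 by lra.
have E2 : (X + Y) `^ (p - 1 - 1) = (X + Y) `^ (p - 3) * (X + Y).
  by rewrite -powR_succ//; congr (_ `^ _); lra.
have E2' : (X + Y) `^ (p - 2) = (X + Y) `^ (p - 3) * (X + Y).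
  by rewrite -powR_succ//; congr (_ `^ _); lra.
have E1 : (X + Y) `^ (p - 1) = (X + Y) `^ (p - 3) * (X + Y) ^+ 2.
  by rewrite expr2 mulrA -E2' -powR_succ//; congr (_ `^ _); lra.
rewrite E3 E2 E2' E1.
have P0 : 0 <= (X + Y) `^ (p - 3) by exact: powR_ge0.
have Q0 : 0 <= dotp gX gX + 2 * dotp gX gY + dotp gY gY by move: dQ; lra.
have := burkholder_algebra p2 a0 P0 X0 Y0 ly0 idX idY ba Q0.
move=> H; apply: le_trans H _; rewrite le_eqVlt; apply/orP; left; apply/eqP.
by ring.
Qed.

Variable n : nat.
Let B := @eball R n.
Let oB : open B := @open_eball R n.
Variables (u v : 'rV[R]_n -> R) (p e : R).
Hypothesis hu : invariant_harmonic u.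
Hypothesis hv : invariant_harmonic v.
Hypothesis e0 : 0 < e.
Hypothesis p2 : 2 < p.
Hypothesis uv : forall x, B x -> enorm (grad u x) <= enorm (grad v x).

(** A smooth positive substitute for [|f|], written as a real power so that the calculus of [powR]
    applies. *)
Definition regabs (f : 'rV[R]_n -> R) (y : 'rV[R]_n) : R := (f y * f y + e) `^ (2^-1).

Lemma regabs_gt0 f y : 0 < regabs f y.
Proof. by rewrite powR_gt0// sqr_eps_gt0. Qed.

Lemma sqr_regabs f y : regabs f y ^+ 2 = f y * f y + e.
Proof.
have z0 := sqr_eps_gt0 f e0 y.
rewrite -powR_mulrn ?ltW ?regabs_gt0// /regabs -powRrM mulVf ?pnatr_eq0// powRr1//.
exact: ltW.
Qed.

Lemma Ck_regabs f : invariant_harmonic f -> Ck 2 B (regabs f).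
Proof. by move=> hf; exact: (Ck_powR oB _ (fun y _ => sqr_eps_gt0 f e0 y) (Ck_sqr_eps e hf)). Qed.

Lemma grad_regabs f x : invariant_harmonic f -> B x ->
  grad (regabs f) x = (f x / regabs f x) *: grad f x.
Proof.
move=> hf xB; have z0 := sqr_eps_gt0 f e0 x.
rewrite (grad_powR _ (fun y _ => sqr_eps_gt0 f e0 y)
  (Ck_le (isT : (1 <= 2)%N) (Ck_sqr_eps e hf)) xB).
rewrite (grad_sqr_eps e hf xB) scalerA; congr (_ *: _).
have -> : (f x * f x + e) `^ (2^-1 - 1) = (regabs f x)^-1.
  by rewrite /regabs -powRN; congr (_ `^ _); lra.
by field; rewrite gt_eqF// regabs_gt0.
Qed.

(** The exponent [1/2] is the case where the last factor of [inv_laplacian_sqr_eps_powR] reduces to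
    [e]. *)
Lemma inv_laplacian_regabs f x : invariant_harmonic f -> B x ->
  inv_laplacian (regabs f) x = (1 - enorm x ^+ 2) ^+ 2 *
    (dotp (grad f x) (grad f x) * e / regabs f x ^+ 3).
Proof.
move=> hf xB; have z0 := sqr_eps_gt0 f e0 x.
rewrite (inv_laplacian_sqr_eps_powR hf e0 _ xB).
have -> : (f x * f x + e) `^ (2^-1 - 2) = (regabs f x ^+ 3)^-1.
  rewrite -powR_mulrn ?ltW ?regabs_gt0// /regabs -powRrM -powRN; congr (_ `^ _); lra.
have r0 : regabs f x != 0 by rewrite gt_eqF// regabs_gt0.
move: (dotp _ _) => d; have -> : f x * f x + e + 2 * (2^-1 - 1) * (f x * f x) = e by lra.
by field.
Qed.

(** For [X = regabs f], from [|grad X|^2 = (f^2 / X^2) |grad f|^2] and [X^2 - f^2 = e]. These are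
    the hypotheses on [X lx] and [Y ly] in the Burkholder inequality. *)
Lemma regabs_identity f x : invariant_harmonic f -> B x ->
  regabs f x * (dotp (grad f x) (grad f x) * e / regabs f x ^+ 3) =
  dotp (grad f x) (grad f x) - dotp (grad (regabs f) x) (grad (regabs f) x).
Proof.
move=> hf xB; rewrite (grad_regabs hf xB) dotpZl dotpZr.
have r0 : regabs f x != 0 by rewrite gt_eqF// regabs_gt0.
have E := sqr_regabs f x.
move: (dotp _ _) => d.
have -> : e = regabs f x ^+ 2 - f x * f x by rewrite E; ring.
by field.
Qed.

Let X := regabs v.
Let Y := regabs u.
Let S (y : 'rV[R]_n) := X y + Y y.

Let cX : Ck 2 B X. Proof. exact: Ck_regabs. Qed.
Let cY : Ck 2 B Y. Proof. exact: Ck_regabs. Qed.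
Let cS : Ck 2 B S. Proof. exact: (Ck_add oB cX cY). Qed.
Let S0 y : 0 < S y. Proof. by rewrite addr_gt0// regabs_gt0. Qed.
Let cSp q : Ck 2 B (fun y => S y `^ q).
Proof. exact: (Ck_powR oB q (fun y _ => S0 y) cS). Qed.

(** Equal to [((p-1) X - Y) (X + Y)^(p-1)], the usual form of Burkholder's function. *)
Definition burkholder_fun (y : 'rV[R]_n) : R :=
  p * (X y * S y `^ (p - 1)) + - (S y `^ p).

Let cXS : Ck 2 B (fun y => X y * S y `^ (p - 1)).
Proof. exact: (Ck_mul oB cX (cSp (p - 1))). Qed.

Lemma Ck_burkholder_fun : Ck 2 B burkholder_fun.
Proof. exact: (Ck_add oB (Ck_mul oB (Ck_cst oB 2 p) cXS) (Ck_opp oB (cSp p))). Qed.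

Lemma burkholder_subharmonic x : B x -> 0 <= inv_laplacian burkholder_fun x.
Proof.
move=> xB.
have EN : (fun y => - (S y `^ p)) = fun y => -1 * S y `^ p.
  by apply/funext => y; rewrite mulN1r.
rewrite /burkholder_fun (inv_laplacianD (Ck_mul oB (Ck_cst oB 2 p) cXS) (Ck_opp oB (cSp p)) xB).
rewrite (inv_laplacianZ p cXS xB) EN (inv_laplacianZ (-1) (cSp p) xB) mulN1r.
rewrite (inv_laplacianM cX (cSp (p - 1)) xB).
rewrite !(inv_laplacian_powR _ (fun y _ => S0 y) cS xB).
rewrite (grad_powR (p - 1) (fun y _ => S0 y) (Ck_le (isT : (1 <= 2)%N) cS) xB).
rewrite (inv_laplacianD cX cY xB).
rewrite (gradD (Ck_le (isT : (1 <= 2)%N) cX) (Ck_le (isT : (1 <= 2)%N) cY) xB).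
rewrite (inv_laplacian_regabs hv xB) (inv_laplacian_regabs hu xB).
exact: (@burkholder_vector p ((1 - enorm x ^+ 2) ^+ 2) (X x) (Y x) e _ _ _ _ _
  p2 (sqr_ge0 _) (regabs_gt0 v x) (regabs_gt0 u x) e0
  (regabs_identity hv xB) (regabs_identity hu xB) (uv xB)).
Qed.

End burkholder.

(** * Spherical means of powers *)

Section power_inequalities.
Context {R : realType}.

Lemma powR_mono (s x y : R) : 0 <= s -> 0 <= x -> x <= y -> x `^ s <= y `^ s.
Proof.
move=> s0 x0 xy; apply: ge0_ler_powR => //; rewrite nnegrE//.
exact: le_trans xy.
Qed.

Lemma sqr_powR_half (x p : R) : 0 <= x -> (x ^+ 2) `^ (p / 2) = x `^ p.
Proof.
by move=> x0; rewrite -powR_mulrn// -powRrM mulrC divfK// pnatr_eq0.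
Qed.

(** Split [(x + y)^s = (x + y)^(s-1) (x + y)]; as [s - 1 <= 0], replacing the base of the first
    factor by the smaller [x] or [y] can only increase each part. *)
Lemma powR_subadd (x y s : R) : 0 <= x -> 0 <= y -> 0 < s <= 1 ->
  (x + y) `^ s <= x `^ s + y `^ s.
Proof.
move=> x0 y0 /andP[s0 s1].
have H (t z : R) : 0 <= t -> t <= z -> t * z `^ (s - 1) <= t `^ s.
  rewrite le_eqVlt => /orP[/eqP <- _|t0 tz]; first by rewrite mul0r powR_ge0.
  have -> : t `^ s = t `^ (s - 1) * t by rewrite -powR_succ//; congr (_ `^ _); lra.
  rewrite mulrC ler_pM2r// (_ : s - 1 = - (1 - s)); last by lra.
  rewrite !powRN lef_pV2 ?posrE ?powR_gt0//; last exact: lt_le_trans tz.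
  by apply: powR_mono => //; lra.
have [xy|xy] := leP (x + y) 0.
  have -> : x = 0 by lra.
  have -> : y = 0 by lra.
  by rewrite addr0 powR0 ?addr0// gt_eqF.
have -> : (x + y) `^ s = (x + y) `^ (s - 1) * (x + y).
  by rewrite -powR_succ//; congr (_ `^ _); lra.
rewrite mulrDr ![_ `^ _ * _]mulrC lerD//; apply: H => //; lra.
Qed.

Lemma powR_sum2 (x y p : R) : 0 <= x -> 0 <= y -> 0 <= p ->
  (x + y) `^ p <= 2 `^ p * (x `^ p + y `^ p).
Proof.
move=> x0 y0 p0.
wlog xy : x y x0 y0 / x <= y.
  move=> H; have [xy|/ltW yx] := leP x y; first exact: H.
  by rewrite addrC [X in _ * X]addrC; exact: H.
apply: (@le_trans _ _ ((2 * y) `^ p)).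
  by apply: powR_mono => //; lra.
by rewrite powRM// ler_wpM2l ?powR_ge0// lerDr powR_ge0.
Qed.

(** Either [2 p X <= S], and [p X] is absorbed by [S / 2], or [S < 2 p X], and the power of [S] is
    replaced by one of [X]. *)
Lemma burkholder_majorant (p X S : R) : 1 < p -> 0 <= X -> 0 < S ->
  p * (X * S `^ (p - 1)) <= S `^ p / 2 + p * (2 * p) `^ (p - 1) * X `^ p.
Proof.
move=> p1 X0 S0.
have E : S `^ p = S `^ (p - 1) * S by rewrite -powR_succ//; congr (_ `^ _); lra.
have Sp0 : 0 <= S `^ (p - 1) by exact: powR_ge0.
have [H|H] := leP (2 * p * X) S.
  rewrite ler_wpDr//; first by rewrite !mulr_ge0 ?powR_ge0//; lra.
  rewrite E; have -> : p * (X * S `^ (p - 1)) = S `^ (p - 1) * (p * X) by ring.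
  by rewrite -mulrA ler_wpM2l//; lra.
rewrite ler_wpDl ?divr_ge0 ?powR_ge0//.
have X1 : 0 < X by nra.
have -> : X `^ p = X `^ (p - 1) * X by rewrite -powR_succ//; congr (_ `^ _); lra.
have : S `^ (p - 1) <= (2 * p * X) `^ (p - 1) by apply: powR_mono; lra.
rewrite powRM ?(ltW X1)//; last by lra.
move=> Hp; rewrite [leRHS](_ : _ = p * (X * ((2 * p) `^ (p - 1) * X `^ (p - 1)))); last by ring.
by rewrite ler_wpM2l ?ler_wpM2l//; lra.
Qed.

Lemma powR_norm_continuous (p : R) : 1 <= p -> continuous (fun t : R => `|t| `^ p).
Proof.
move=> p1 t; have [->|t0] := eqVneq t 0.
  rewrite /continuous_at normr0 powR0; last by lra.
  apply/cvgrPdist_le => /= e e0; near=> s; rewrite sub0r normrN ger0_norm ?powR_ge0//.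
  have s1 : `|s| <= Num.min 1 e.
    by rewrite -[s]subr0 distrC; near: s; apply: cvgr_dist_le; rewrite // lt_min ltr01.
  move: s1; rewrite le_min => /andP[s1 se].
  apply: le_trans se; have [->|s0] := eqVneq s 0; first by rewrite normr0 powR0//; lra.
  have sp : 0 < `|s| by rewrite normr_gt0.
  rewrite (_ : p = 1 + (p - 1)); last by lra.
  rewrite powRD; last by rewrite normr_eq0 s0 implybT.
  have : `|s| `^ (p - 1) <= 1 `^ (p - 1) by apply: powR_mono => //; lra.
  by rewrite powR1 powRr1// => ?; rewrite ler_piMr.
apply: (@continuous_comp _ _ _ (fun t : R => `|t|) (fun y : R => y `^ p)).
  exact: norm_continuous.
by apply: powR_continuous_at; rewrite normr_gt0.
Unshelve. all: by end_near. Qed.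

(** The middle factor is the constant of [burkholder_majorant], the last that of [powR_sum2], and
    the leading [2] undoes the half in front of [S^p]. *)
Definition high_cst (p : R) : R := 2 * (p * (2 * p) `^ (p - 1)) * 2 `^ p.

Lemma high_cst_gt0 (p : R) : 0 < p -> 0 < high_cst p.
Proof. by move=> p0; rewrite !mulr_gt0 ?powR_gt0// mulr_gt0. Qed.

End power_inequalities.

Section spherical_power_means.
Context {R : realType} (n : nat).
Let B := @eball R n.
Let oB : open B := @open_eball R n.

Lemma sphcont_powR_norm (g : 'rV[R]_n -> R) (p : R) : 1 <= p ->
  sphcont g -> sphcont (fun z => `|g z| `^ p).
Proof.
move=> p1 cg z zS.
apply: (@continuous_comp _ _ _ g (fun t : R => `|t| `^ p)); first exact: cg.
exact: powR_norm_continuous.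
Qed.

Lemma Ck_sphcont k (g : 'rV[R]_n -> R) (r : R) : 0 <= r < 1 -> Ck k B g ->
  sphcont (fun z => g (r *: z)).
Proof.
move=> /andP[r0 r1] cg; apply: sphcont_scale; first by rewrite ger0_norm.
by move=> x; exact: Ck_continuous cg.
Qed.

Hypothesis n2 : (2 <= n)%N.
Let n0 : (0 < n)%N := ltnW n2.

Section high.
Variables (u v : 'rV[R]_n -> R) (p : R).
Hypothesis hu : invariant_harmonic u.
Hypothesis hv : invariant_harmonic v.
Hypothesis p2 : 2 < p.
Hypothesis uv : forall x, B x -> enorm (grad u x) <= enorm (grad v x).
Hypothesis u0 : u 0 = 0.

Let regabs_le (f : 'rV[R]_n -> R) (e : R) y : 0 < e ->
  regabs (e ^+ 2) f y <= `|f y| + e.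
Proof.
move=> e0; have e20 : 0 < e ^+ 2 by rewrite exprn_gt0.
have X0 := regabs_gt0 e20 f y; have Y0 := normr_ge0 (f y).
rewrite -ler_sqr ?nnegrE ?addr_ge0 ?(ltW X0) ?(ltW e0)//.
rewrite (sqr_regabs e20) sqrrD (real_normK (num_real _)) -expr2.
have := mulr_ge0 Y0 (ltW e0); move: (_ * e) (f y ^+ 2) (e ^+ 2) => a b c; lra.
Qed.

Let abs_le_regabs (f : 'rV[R]_n -> R) (e : R) y : 0 < e ->
  `|f y| <= regabs (e ^+ 2) f y.
Proof.
move=> e0; have e20 : 0 < e ^+ 2 by rewrite exprn_gt0.
have X0 := regabs_gt0 e20 f y.
rewrite -ler_sqr ?nnegrE ?(ltW X0)// (sqr_regabs e20) (real_normK (num_real _)).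
by rewrite -expr2 lerDl (ltW e20).
Qed.

(** The mean value inequality for Burkholder's function, followed by its pointwise majorant.
    Regularizing with [e ^+ 2] makes the error a multiple of [e^p]. *)
Lemma high_exponent_mean_eps (r e : R) : 0 <= r < 1 -> 0 < e ->
  sphmean (fun z => `|u (r *: z)| `^ p) <=
  high_cst p * (sphmean (fun z => `|v (r *: z)| `^ p) + e `^ p).
Proof.
move=> r01 e0; have e20 : 0 < e ^+ 2 by rewrite exprn_gt0.
have p0 : 0 < p := lt_trans (ltr0n _ 2) p2.
have p1 : 1 <= p by apply: ltW; apply: lt_trans p2; rewrite ltr1n.
pose X := regabs (e ^+ 2) v; pose Y := regabs (e ^+ 2) u.
pose G := burkholder_fun u v p (e ^+ 2).
have cG : Ck 2 B G by exact: Ck_burkholder_fun.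
have GE y : G y = p * (X y * (X y + Y y) `^ (p - 1)) - (X y + Y y) `^ p by [].
have X0 y : 0 < X y by exact: regabs_gt0.
have Y0 y : 0 < Y y by exact: regabs_gt0.
(* At the centre [Y = e <= X] because [u 0 = 0], so [p X - (X + Y) >= (p - 2) X >= 0]. *)
have G0 : 0 <= G 0.
  have Y0e : Y 0 = e.
    apply/eqP; rewrite -(eqrXn2 (_ : (0 < 2)%N) (ltW (Y0 0)) (ltW e0))//.
    by rewrite (sqr_regabs e20) u0 mulr0 add0r.
  have X0e : e <= X 0.
    rewrite -ler_sqr ?nnegrE ?(ltW e0) ?(ltW (X0 _))// (sqr_regabs e20) lerDr -expr2.
    exact: sqr_ge0.
  rewrite GE Y0e; have S0 : 0 < X 0 + e by exact: addr_gt0.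
  have -> : (X 0 + e) `^ p = (X 0 + e) `^ (p - 1) * (X 0 + e).
    by rewrite -powR_succ//; congr (_ `^ _); lra.
  have := powR_ge0 (X 0 + e) (p - 1); move: (_ `^ _) => P P0.
  rewrite (_ : _ - _ = P * (p * X 0 - (X 0 + e))); last by ring.
  apply: mulr_ge0 => //.
  have : 2 * X 0 <= p * X 0 by rewrite ler_wpM2r ?ltW.
  lra.
have mG := sphmean_ge_center n0 cG n2 (burkholder_subharmonic hu hv e20 p2 uv) r01.
have cX : sphcont (fun z => X (r *: z)) by exact: Ck_sphcont r01 (Ck_regabs e20 hv).
have cY : sphcont (fun z => Y (r *: z)) by exact: Ck_sphcont r01 (Ck_regabs e20 hu).
have cu : sphcont (fun z => u (r *: z)) by have [c _] := hu; exact: Ck_sphcont r01 c.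
have cv : sphcont (fun z => v (r *: z)) by have [c _] := hv; exact: Ck_sphcont r01 c.
pose c := p * (2 * p) `^ (p - 1).
have c0 : 0 <= c by rewrite /c mulr_ge0 ?powR_ge0// ltW.
have cup := sphcont_powR_norm p1 cu; have cvp := sphcont_powR_norm p1 cv.
have cW := sphcontD cvp (@sphcont_cst R n (e `^ p)).
have cM1 := sphcontM (@sphcont_cst R n (c * 2 `^ p)) cW.
have cM2 := sphcontM (@sphcont_cst R n (- 2^-1)) cup.
(* The negative half of [S^p] is kept and dominates [|u|^p / 2], since [|u| <= Y <= S]. *)
have : sphmean (fun z => G (r *: z)) <=
   sphmean (fun z => c * 2 `^ p * (`|v (r *: z)| `^ p + e `^ p) +
     - 2^-1 * `|u (r *: z)| `^ p).
  apply: (sphmean_le n0 (Ck_sphcont r01 cG) (sphcontD cM1 cM2)) => z _.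
  set y := r *: z; rewrite GE.
  have S0 : 0 < X y + Y y by exact: addr_gt0.
  have p11 : 1 < p by apply: lt_trans p2; rewrite ltr1n.
  have H1 := burkholder_majorant p11 (ltW (X0 y)) S0.
  have H2 : `|u y| `^ p <= (X y + Y y) `^ p.
    apply: powR_mono => //; first exact: ltW.
    by apply: le_trans (abs_le_regabs u y e0) _; rewrite lerDr ltW.
  have H3 : X y `^ p <= 2 `^ p * (`|v y| `^ p + e `^ p).
    apply: le_trans (powR_sum2 (normr_ge0 (v y)) (ltW e0) (ltW p0)).
    by apply: powR_mono; [exact: ltW|exact: ltW|exact: regabs_le].
  have H4 := ler_wpM2l c0 H3.
  rewrite -/c in H1; rewrite mulrA in H4.
  move: H1 H2 H4; set x1 := (X in X <= _ / 2 + _); set x2 := (X y + Y y) `^ p.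
  move: (c * X y `^ p) (_ * (_ + _)) (`|u y| `^ p) => x3 x4 x5 h1 h2 h3.
  by rewrite -/x1; clearbody x1 x2; lra.
rewrite (sphmeanD n0 cM1 cM2) (sphmeanZ n0 _ cW) (sphmeanZ n0 _ cup).
rewrite (sphmeanD n0 cvp (@sphcont_cst R n (e `^ p))) (sphmean_cst n0).
move=> H; have := le_trans (le_trans G0 mG) H.
rewrite /high_cst -/c; set x1 := sphmean _; set x2 := _ + e `^ p => h.
have : 2 * c * 2 `^ p * x2 = 2 * (c * 2 `^ p * x2) by rewrite !mulrA.
move: h; move: (c * _ * x2) (sphmean (fun z => `|u (r *: z)| `^ p)) (2 * c * _ * _).
by move=> a b d h ->; clearbody X Y G c; lra.
Qed.

Lemma high_exponent_mean (r : R) : 0 <= r < 1 ->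
  sphmean (fun z => `|u (r *: z)| `^ p) <=
  high_cst p * sphmean (fun z => `|v (r *: z)| `^ p).
Proof.
move=> r01; apply/ler_addgt0Pr => d d0.
have p0 : 0 < p := lt_trans (ltr0n _ 2) p2; have c0 := high_cst_gt0 p0.
(* Chosen so that the error [high_cst p * e^p] equals [d]. *)
pose e := (d / high_cst p) `^ p^-1.
have e0 : 0 < e by rewrite powR_gt0// divr_gt0.
have ep : e `^ p = d / high_cst p.
  by rewrite /e -powRrM mulVf ?gt_eqF// powRr1// ltW// divr_gt0.
have := high_exponent_mean_eps r01 e0; rewrite ep mulrDr.
by rewrite [_ * (d / _)]mulrC divfK ?gt_eqF.
Qed.

End high.

Section low.
Variables (m : nat) (f : 'I_m -> 'rV[R]_n -> R) (j : 'I_m) (K p : R).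
Hypothesis hf : forall i, invariant_harmonic (f i).
Hypothesis p12 : 1 < p <= 2.
Hypothesis fK : forall i x, B x -> enorm (grad (f i) x) <= K * enorm (grad (f j) x).

Let C := (1 + (m%:R - 1) * K ^+ 2) / (p - 1).
Let nf (y : 'rV[R]_n) : R := Num.sqrt (\sum_i f i y * f i y).

Let C0 : 0 <= C.
Proof.
have mj : 1 <= m%:R :> R by rewrite ler1n (leq_ltn_trans (leq0n j)).
have /andP[p1 _] := p12.
rewrite /C; apply: divr_ge0; last by rewrite subr_ge0 ltW.
by apply: addr_ge0 => //; apply: mulr_ge0; rewrite ?sqr_ge0// subr_ge0.
Qed.

(** Since [p/2 <= 1], subadditivity of the power traps each regularized power between the true one
    and the true one plus [e^(p/2)]; the mean value inequality is then read with these bounds on the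
    sphere and at the centre. *)
Lemma low_exponent_mean_eps (r e : R) : 0 <= r < 1 -> 0 < e ->
  sphmean (fun z => nf (r *: z) `^ p) <=
  nf 0 `^ p + e `^ (p / 2) +
    C * (sphmean (fun z => `|f j (r *: z)| `^ p) + e `^ (p / 2) - `|f j 0| `^ p).
Proof.
move=> r01 e0; have /andP[p1 p2] := p12.
have s0 : 0 < p / 2 by lra.
have s01 : 0 < p / 2 <= 1 by lra.
have p0 : 0 < p by lra.
pose w y := \sum_i f i y * f i y + e.
pose z y := f j y * f j y + e.
have sq0 y : 0 <= \sum_i f i y * f i y.
  by apply: sumr_ge0 => i _; rewrite -expr2 sqr_ge0.
have cfj : Ck 2 B (f j) by have [] := hf j.
have cff : Ck 2 B (fun y => \sum_i f i y * f i y).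
  apply: (Ck_sum oB _ (fun i => _)) => i; have [ci _] := hf i; exact: (Ck_mul oB ci ci).
have cw : Ck 2 B w by exact: (Ck_add oB cff (Ck_cst oB 2 e)).
have w0 y : 0 < w y by rewrite ltr_wpDl.
have cwp : Ck 2 B (fun y => w y `^ (p / 2)) by exact: (Ck_powR oB _ (fun y _ => w0 y) cw).
have z0 y : 0 < z y by exact: sqr_eps_gt0.
have czp : Ck 2 B (fun y => z y `^ (p / 2)).
  exact: (Ck_powR oB _ (fun y _ => z0 y) (Ck_sqr_eps e (hf j))).
have cCz := Ck_mul oB (Ck_cst oB 2 C) czp.
have cG := Ck_add oB cCz (Ck_opp oB cwp).
have mG := sphmean_ge_center n0 cG n2 (low_exponent_subharmonic hf p12 e0 fK) r01.
have scz := Ck_sphcont r01 czp; have scw := Ck_sphcont r01 cwp.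
have scCz := sphcontM (@sphcont_cst R n C) scz.
have scNw := sphcontM (@sphcont_cst R n (-1)) scw.
move: mG; rewrite -/C.
rewrite (_ : sphmean _ = C * sphmean (fun y => z (r *: y) `^ (p / 2)) -
    sphmean (fun y => w (r *: y) `^ (p / 2))); last first.
  rewrite -(sphmeanZ n0 _ scz) -(sphmeanB n0 scCz scw).
  exact: eq_sphmean.
have nf_w y : nf y `^ p <= w y `^ (p / 2).
  rewrite -(sqr_powR_half p (sqrtr_ge0 _)) sqr_sqrtr//.
  by apply: powR_mono; rewrite ?(ltW s0)// lerDl ltW.
have w_nf y : w y `^ (p / 2) <= nf y `^ p + e `^ (p / 2).
  rewrite -(sqr_powR_half p (sqrtr_ge0 _)) sqr_sqrtr//.
  by apply: powR_subadd => //; exact: ltW.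
have fz y : `|f j y| `^ p <= z y `^ (p / 2).
  rewrite -(sqr_powR_half p (normr_ge0 _)) real_normK ?num_real//.
  by rewrite /z -expr2; apply: powR_mono; rewrite ?(ltW s0) ?sqr_ge0// lerDl ltW.
have zf y : z y `^ (p / 2) <= `|f j y| `^ p + e `^ (p / 2).
  rewrite -(sqr_powR_half p (normr_ge0 _)) real_normK ?num_real//.
  by rewrite /z -expr2; apply: powR_subadd => //; [exact: sqr_ge0|exact: ltW].
have cfp := sphcont_powR_norm (ltW p1) (Ck_sphcont r01 cfj).
have cnf : sphcont (fun y => nf (r *: y) `^ p).
  have H : sphcont (fun y => `|nf (r *: y)| `^ p).
    apply: sphcont_powR_norm; first exact: ltW.
    rewrite /nf => y yS.
    apply: (@continuous_comp _ _ _
      (fun y : 'rV[R]_n => \sum_i f i (r *: y) * f i (r *: y)) (@Num.sqrt R)).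
      exact: (Ck_sphcont r01 cff).
    exact: sqrt_continuous.
  rewrite (_ : (fun y => _) = fun y => `|nf (r *: y)| `^ p)//.
  by apply/funext => y; rewrite ger0_norm// sqrtr_ge0.
have M1 : sphmean (fun y => nf (r *: y) `^ p) <= sphmean (fun y => w (r *: y) `^ (p / 2)).
  by apply: (sphmean_le n0) => // y _; exact: nf_w.
have M2 : sphmean (fun y => z (r *: y) `^ (p / 2)) <=
    sphmean (fun y => `|f j (r *: y)| `^ p) + e `^ (p / 2).
  rewrite -[X in _ + X](sphmean_cst n0) -(sphmeanD n0 cfp (@sphcont_cst R n _)).
  apply: (sphmean_le n0 scz (sphcontD cfp (@sphcont_cst R n _))) => y _.
  exact: zf.
have H1 := w_nf 0; have H2 := fz 0.
have H3 := ler_wpM2l C0 M2; have H4 := ler_wpM2l C0 H2.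
rewrite -/(z 0) -/(w 0); move: M1 H1 H3 H4.
rewrite mulrBr; rewrite !mulrDr.
move: (sphmean _) (sphmean _) => x1 x2.
by move: (C * sphmean _) (C * sphmean _) (C * (_ `^ _)) (C * (_ `^ _)) (C * (_ `^ _)) => *; lra.
Qed.

Lemma low_exponent_mean (r : R) : 0 <= r < 1 ->
  sphmean (fun z => nf (r *: z) `^ p) <=
  nf 0 `^ p + C * (sphmean (fun z => `|f j (r *: z)| `^ p) - `|f j 0| `^ p).
Proof.
move=> r01; apply/ler_addgt0Pr => d d0; have /andP[p1 p2] := p12.
have C1 : 0 < 1 + C by rewrite ltr_wpDr.
(* The errors at the centre and on the sphere add up to [(1 + C) e^(p/2)], which is [d] for this
   choice. *)
pose e := (d / (1 + C)) `^ (2 / p).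
have dC : 0 < d / (1 + C) by exact: divr_gt0.
have e0 : 0 < e by rewrite powR_gt0.
have ep : e `^ (p / 2) = d / (1 + C).
  rewrite /e -powRrM (_ : 2 / p * (p / 2) = 1) ?powRr1 ?ltW//.
  by field; lra.
have := low_exponent_mean_eps r01 e0; rewrite ep.
have E : d = d / (1 + C) + C * (d / (1 + C)) by field; rewrite gt_eqF.
move=> H; apply: le_trans H _; rewrite [X in _ <= _ + X]E.
rewrite !mulrBr mulrDr; move: (C * sphmean _) (C * (_ `^ _)) (d / _) (C * (d / _)) => *; lra.
Qed.

End low.
End spherical_power_means.

(** * Hardy norms *)

Section spherical_norm.
Context {R : realType} (n : nat).
Hypothesis n0 : (0 < n)%N.

(** [(s + t) / (a + b)] is the convex combination of [s / a] and [t / b] with weights [a / (a + b)]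
    and [b / (a + b)], and [t^p] is convex. *)
Lemma powR_convex_comb (p a b s t : R) : 1 <= p -> 0 < a -> 0 < b -> 0 <= s -> 0 <= t ->
  (s + t) `^ p <= (a + b) `^ p * (a / (a + b) * (s / a) `^ p + b / (a + b) * (t / b) `^ p).
Proof.
move=> p1 a0 b0 s0 t0; have ab0 : 0 < a + b by exact: addr_gt0.
have E : s + t = (a + b) * (a / (a + b) * (s / a) + b / (a + b) * (t / b)).
  by field; rewrite !gt_eqF.
have i0 : 0 <= a / (a + b) <= 1.
  by rewrite divr_ge0 ?(ltW a0) ?(ltW ab0)//= ler_pdivrMr// mul1r lerDl ltW.
have /andP[i1 i2] := i0.
have sa : 0 <= s / a by rewrite divr_ge0 ?(ltW a0).
have tb : 0 <= t / b by rewrite divr_ge0 ?(ltW b0).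
have bE : b / (a + b) = 1 - a / (a + b) by field; rewrite gt_eqF.
rewrite E bE powRM ?(ltW ab0)//; last first.
  by apply: addr_ge0; apply: mulr_ge0; rewrite // subr_ge0.
rewrite ler_wpM2l ?powR_ge0//.
by apply: (convex_powR p1 (Itv01 i1 i2)); rewrite inE/= in_itv/= andbT.
Qed.

Definition sphnorm (p : R) (g : 'rV[R]_n -> R) : R :=
  sphmean (fun z => `|g z| `^ p) `^ p^-1.

Lemma sphnorm_ge0 p g : 0 <= sphnorm p g. Proof. exact: powR_ge0. Qed.

Section fixed_exponent.
Variable p : R.
Hypothesis p1 : 1 <= p.
Implicit Types f g : 'rV[R]_n -> R.
Let p0 : 0 < p := lt_le_trans ltr01 p1.

Lemma sphmean_powR_ge0 (g : 'rV[R]_n -> R) : 0 <= sphmean (fun z : 'rV[R]_n => `|g z| `^ p).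
Proof. by apply: sphmean_ge0 => z _; exact: powR_ge0. Qed.

Lemma sphnorm_powR g : sphnorm p g `^ p = sphmean (fun z : 'rV[R]_n => `|g z| `^ p).
Proof. by rewrite /sphnorm -powRrM mulVf ?gt_eqF// powRr1// sphmean_powR_ge0. Qed.

Lemma sphnorm_leP g (N : R) : 0 <= N ->
  (sphnorm p g <= N) = (sphmean (fun z : 'rV[R]_n => `|g z| `^ p) <= N `^ p).
Proof.
move=> N0; rewrite -sphnorm_powR; apply/idP/idP => [H|H].
  by apply: powR_mono => //; [exact: ltW|exact: sphnorm_ge0].
rewrite leNgt; apply/negP => H1; move: H; rewrite leNgt => /negP; apply.
by apply: gt0_ltr_powR; rewrite ?nnegrE// sphnorm_ge0.
Qed.

Lemma sphnorm_le f g : sphcont f -> sphcont g ->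
  (forall z, esphere n z -> `|f z| <= `|g z|) -> sphnorm p f <= sphnorm p g.
Proof.
move=> cf cg fg; rewrite sphnorm_leP ?sphnorm_ge0// sphnorm_powR.
apply: (sphmean_le n0); [exact: sphcont_powR_norm..|move=> z zS].
by apply: powR_mono => //; [exact: ltW|exact: fg].
Qed.

Lemma sphnorm_cst c : sphnorm p (fun=> c) = `|c|.
Proof. by rewrite /sphnorm (sphmean_cst n0) -powRrM mulfV ?gt_eqF// powRr1. Qed.

Lemma sphnormZ c g : sphcont g -> sphnorm p (fun z => c * g z) = `|c| * sphnorm p g.
Proof.
move=> cg; rewrite /sphnorm -[X in X * _](sphnorm_cst c) /sphnorm (sphmean_cst n0).
rewrite -powRM ?powR_ge0 ?sphmean_powR_ge0//.
rewrite -(sphmeanZ n0 _ (sphcont_powR_norm p1 cg)); congr (_ `^ _).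
by apply: eq_sphmean => z _; rewrite normrM powRM.
Qed.

(** Minkowski's inequality by normalization: [f / a] and [g / b] have norm at most one, so the mean
    of the convex combination above is at most one. *)
Lemma sphnorm_add_le f g a b : sphcont f -> sphcont g -> 0 < a -> 0 < b ->
  sphnorm p f <= a -> sphnorm p g <= b -> sphnorm p (fun z => f z + g z) <= a + b.
Proof.
move=> cf cg a0 b0 fa gb; have ab0 : 0 < a + b by exact: addr_gt0.
have cfp := sphcont_powR_norm p1 cf; have cgp := sphcont_powR_norm p1 cg.
have pow_div (x c : R) : 0 < c -> `|x| / c = `|x / c|.
  by move=> c0; rewrite normf_div (gtr0_norm c0).
have normalized h c : sphcont h -> 0 < c -> sphnorm p h <= c ->
    sphcont (fun z => (`|h z| / c) `^ p) /\
    sphmean (fun z => (`|h z| / c) `^ p) <= 1.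
  move=> ch c0 hc; have chc : sphcont (fun z => c^-1 * h z).
    exact: (sphcontM (@sphcont_cst R n _) ch).
  have E : (fun z => (`|h z| / c) `^ p) = fun z : 'rV[R]_n => `|c^-1 * h z| `^ p.
    by apply/funext => z; rewrite pow_div// mulrC.
  rewrite E; split; first exact: sphcont_powR_norm.
  have <- : 1 `^ p = 1 :> R by rewrite powR1.
  rewrite -sphnorm_leP// sphnormZ// ger0_norm ?invr_ge0 ?(ltW c0)//.
  by rewrite mulrC ler_pdivrMr// mul1r.
have [cA mA] := normalized f a cf a0 fa; have [cB mB] := normalized g b cg b0 gb.
have cA' := sphcontM (@sphcont_cst R n (a / (a + b))) cA.
have cB' := sphcontM (@sphcont_cst R n (b / (a + b))) cB.
rewrite sphnorm_leP ?(ltW ab0)//.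
apply: (@le_trans _ _ (sphmean (fun z => (a + b) `^ p *
    (a / (a + b) * (`|f z| / a) `^ p + b / (a + b) * (`|g z| / b) `^ p)))).
  apply: (sphmean_le n0).
  - exact: sphcont_powR_norm p1 (sphcontD cf cg).
  - exact: sphcontM (@sphcont_cst R n _) (sphcontD cA' cB').
  move=> z _; apply: le_trans (powR_convex_comb p1 a0 b0 _ _) => //.
  by apply: powR_mono; [exact: ltW|exact: normr_ge0|exact: ler_normD].
rewrite (sphmeanZ n0 _ (sphcontD cA' cB')) (sphmeanD n0 cA' cB').
rewrite (sphmeanZ n0 _ cA) (sphmeanZ n0 _ cB) ler_piMr ?powR_ge0//.
have wa : 0 <= a / (a + b) by rewrite divr_ge0 ?ltW.
have wb : 0 <= b / (a + b) by rewrite divr_ge0 ?ltW.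
apply: le_trans (lerD (ler_wpM2l wa mA) (ler_wpM2l wb mB)) _.
by rewrite !mulr1 -mulrDl divff ?gt_eqF.
Qed.

Lemma sphnormD f g : sphcont f -> sphcont g ->
  sphnorm p (fun z => f z + g z) <= sphnorm p f + sphnorm p g.
Proof.
move=> cf cg; apply/ler_addgt0Pr => e e0.
(* [sphnorm_add_le] takes strictly positive bounds, while either norm may vanish. *)
have e20 : 0 < e / 2 by exact: divr_gt0.
have := sphnorm_add_le cf cg (ltr_wpDl (sphnorm_ge0 p f) e20)
  (ltr_wpDl (sphnorm_ge0 p g) e20).
move: (sphnorm p f) (sphnorm p g) (sphnorm p (fun z => f z + g z)) => x y w.
rewrite !lerDl (ltW e20) => /(_ isT isT) H; apply: le_trans H _; lra.
Qed.

Lemma sphnorm_sum (I : Type) (s : seq I) (F : I -> 'rV[R]_n -> R) :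
  (forall i, sphcont (F i)) ->
  sphcont (fun z => \sum_(i <- s) F i z) /\
  sphnorm p (fun z => \sum_(i <- s) F i z) <= \sum_(i <- s) sphnorm p (F i).
Proof.
move=> cF; elim: s => [|i s [ihc ih]].
  rewrite big_nil (_ : (fun z => _) = fun=> 0); last by apply/funext => z; rewrite big_nil.
  by rewrite sphnorm_cst normr0; split => //; exact: sphcont_cst.
rewrite (_ : (fun z => _) = fun z => F i z + \sum_(i <- s) F i z); last first.
  by apply/funext => z; rewrite big_cons.
split; first exact: sphcontD.
by rewrite big_cons; apply: le_trans (sphnormD (cF i) ihc) _; rewrite lerD2l.
Qed.

End fixed_exponent.
End spherical_norm.

Section hardy_norm_sphnorm.
Context {R : realType} (n m : nat) (p : R) (F : 'rV[R]_n -> 'rV[R]_m).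
Hypothesis n0 : (0 < n)%N.
Hypothesis p1 : 1 <= p.
Hypothesis cF : forall k x, eball n x -> {for x, continuous (component F k)}.
Let p0 : 0 < p := lt_le_trans ltr01 p1.

Lemma sphcont_enorm (r : R) : 0 <= r < 1 -> sphcont (fun z => enorm (F (r *: z))).
Proof.
move=> /andP[r0 r1] z zS.
apply: (@continuous_comp _ _ _ (fun z : 'rV[R]_n =>
  \sum_k component F k (r *: z) * component F k (r *: z)) (@Num.sqrt R)); last first.
  exact: sqrt_continuous.
apply: (sphcont_sum (fun k => _)) zS => k.
by apply: sphcontM; apply: sphcont_scale; rewrite ?ger0_norm//; exact: cF.
Qed.

Let enorm_normE r : (fun z : 'rV[R]_n => enorm (F (r *: z)) `^ p) =
  fun z => `|enorm (F (r *: z))| `^ p.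
Proof. by apply/funext => z; rewrite (ger0_norm (enorm_ge0 _)). Qed.

Lemma integrable_enorm_powR (r : R) : 0 <= r < 1 ->
  (surface_measure n).-integrable (esphere n) (fun z => (enorm (F (r *: z)) `^ p)%:E).
Proof.
move=> r01.
have := sphcont_integrable n0 (sphcont_powR_norm p1 (sphcont_enorm r01)).
by rewrite -enorm_normE.
Qed.

Lemma Mp_sphnorm (r : R) : 0 <= r < 1 ->
  Mp p F r = (sphnorm p (fun z => enorm (F (r *: z))))%:E.
Proof.
move=> r01; rewrite /Mp /sphnorm -enorm_normE /sphmean -poweR_EFin; congr (_ `^ _)%E.
rewrite /Rintegral fineK//.
exact: (integrable_fin_num (@measurable_esphere R n) (integrable_enorm_powR r01)).
Qed.

Lemma hardy_norm_le (N : R) :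
  (forall r, 0 < r < 1 -> sphnorm p (fun z => enorm (F (r *: z))) <= N) ->
  (hardy_norm p F <= N%:E)%E.
Proof.
move=> H; apply: ge_ereal_sup => _ [r /= + <-]; rewrite in_itv/= => /[dup] /H FN.
by move=> /andP[r0 r1]; rewrite Mp_sphnorm ?lee_fin// (ltW r0).
Qed.

Lemma sphnorm_le_hardy_norm (r : R) : 0 < r < 1 ->
  ((sphnorm p (fun z => enorm (F (r *: z))))%:E <= hardy_norm p F)%E.
Proof.
move=> r01; have /andP[r0 r1] := r01; rewrite -Mp_sphnorm ?(ltW r0)//.
by apply: ereal_sup_ubound; exists r => //=; rewrite in_itv.
Qed.

(** The radius [1/2] shows that the supremum is not over the empty set, which rules out the value
    [-oo] and gives [0 <= N]. *)
Lemma hardy_norm_fin : (hardy_norm p F < +oo)%E ->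
  exists N, [/\ 0 <= N, hardy_norm p F = N%:E &
    forall r, 0 < r < 1 -> sphnorm p (fun z => enorm (F (r *: z))) <= N].
Proof.
have h12 : 0 < (2^-1 : R) < 1 by rewrite invr_gt0 ltr0n invf_lt1 ?ltr1n ?ltr0n.
move: sphnorm_le_hardy_norm; case: (hardy_norm p F) => [N|//|] H _.
  have HN (r : R) : 0 < r < 1 -> sphnorm p (fun z => enorm (F (r *: z))) <= N.
    by move=> /H; rewrite lee_fin.
  by exists N; split => //; exact: le_trans (sphnorm_ge0 _ _) (HN _ h12).
by have := H _ h12; rewrite leeNy_eq.
Qed.

Lemma hardy_intro : (hardy_norm p F < +oo)%E -> hardy p F.
Proof.
move=> FN; split => //; last exact: integrable_enorm_powR.
have mF (i : 'I_m) : measurable_fun (eball n) (fun x => F x 0 i).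
  by apply: continuous_at_measurable; [exact: measurable_eball|exact: cF].
pose G := \big[setU/set0]_(i < m)
  preimage_set_system setT (fun x : 'rV[R]_m => x 0 i) measurable.
apply: (@measurability _ _ _ 'rV[R]_m (eball n) F G); first by [].
move=> _ [B + <-]; rewrite /G -bigcup_seq => -[i _ [C mC <-]].
by rewrite setTI; apply: mF => //; exact: measurable_eball.
Qed.

End hardy_norm_sphnorm.

(** * The two norm estimates *)

Section conjugate_type_estimates.
Context {R : realType}.

Lemma component_to_rV1 n (u : 'rV[R]_n -> R) k : component (to_rV1 u) k = u.
Proof. by apply/funext => x; rewrite /component /to_rV1 ord1 mxE eqxx. Qed.

Lemma enorm_to_rV1 n (u : 'rV[R]_n -> R) x : enorm (to_rV1 u x) = `|u x|.
Proof. by rewrite /enorm /dotp big_ord1 !mxE eqxx -expr2 sqrtr_sqr. Qed.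

(** Cauchy-Schwarz against the vector of ones; this is the source of [sqrt n] in the estimate for
    [p > 2]. *)
Lemma sum_abs_le_enorm n (x : 'rV[R]_n) : \sum_i `|x 0 i| <= Num.sqrt n%:R * enorm x.
Proof.
pose a : 'rV[R]_n := \row_i `|x 0 i|; pose b : 'rV[R]_n := \row_(i < n) 1.
have aE : enorm a = enorm x.
  congr Num.sqrt; apply: eq_bigr => i _.
  by rewrite !mxE -!expr2 real_normK ?num_real.
have bE : enorm b = Num.sqrt n%:R.
  congr Num.sqrt; rewrite /dotp (eq_bigr (fun=> 1)); last by move=> i _; rewrite !mxE mulr1.
  by rewrite sumr_const card_ord.
have := le_trans (ler_norm _) (cauchy_schwarz b a); rewrite aE bE; apply: le_trans.
by apply: ler_sum => i _; rewrite !mxE mul1r.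
Qed.

Variables (n : nat) (K : R) (f : 'rV[R]_n -> 'rV[R]_n) (j : 'I_n) (p : R).
Hypothesis n2 : (2 <= n)%N.
Hypothesis K1 : 1 <= K.
Hypothesis hf : inv_harmonic_quasiregular K f.
Hypothesis p1 : 1 < p.
Hypothesis hj : hardy p (to_rV1 (component f j)).
Let n0 : (0 < n)%N := ltnW n2.
Let K0 : 0 < K := lt_le_trans ltr01 K1.
Let p0 : 0 < p := lt_trans ltr01 p1.
Let oB : open (@eball R n) := @open_eball R n.

Let Cf i : Ck 2 (eball n) (component f i).
Proof. by have [_ /(_ i)[]] := hf. Qed.

Let cf i x : eball n x -> {for x, continuous (component f i)}.
Proof. exact: Ck_continuous. Qed.

Let cfj k x : eball n x -> {for x, continuous (component (to_rV1 (component f j)) k)}.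
Proof. by rewrite component_to_rV1; exact: cf. Qed.

Let gradK i x : eball n x ->
  enorm (grad (component f i) x) <= K * enorm (grad (component f j) x).
Proof.
have [qf _] := hf; move=> xB; apply: (quasiregular_grad_le i j (ltW K0) qf _ xB) => k.
exact: Ck_le (Cf k).
Qed.

Let half01 : 0 < (2^-1 : R) < 1.
Proof. by rewrite invr_gt0 ltr0n invf_lt1 ?ltr1n ?ltr0n. Qed.

Lemma hardy_component_bound : exists N, [/\ 0 <= N,
  hardy_norm p (to_rV1 (component f j)) = N%:E &
  forall r, 0 < r < 1 -> sphnorm p (fun z => component f j (r *: z)) <= N].
Proof.
have [_ _ Noo] := hj; have [N [N0 NE HN]] := hardy_norm_fin n0 (ltW p1) cfj Noo.
have E r : sphnorm p (fun z => enorm (to_rV1 (component f j) (r *: z))) =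
    sphnorm p (fun z => component f j (r *: z)).
  rewrite /sphnorm /sphmean; congr (Rintegral _ _ _ `^ _); apply/funext => z.
  by rewrite enorm_to_rV1 normr_id.
by exists N; split=> [||r r01]; [exact: N0|exact: NE|rewrite -E; exact: HN].
Qed.

(** Replacing the mean of [|f_j|^p] by [N^p] gives a bound [Q] independent of the radius. The norm
    is a supremum of [p]-th roots, so it is compared with [Q^(1/p)] before raising to the power
    [p]. *)
Lemma hardy_low_exponent : p <= 2 ->
  (hardy_norm p f `^ p <= (enorm (f 0) `^ p)%:E +
     ((1 + (n%:R - 1) * K ^+ 2) / (p - 1))%:E *
     (hardy_norm p (to_rV1 (component f j)) `^ p - (`|component f j 0| `^ p)%:E))%E.
Proof.
move=> p2; have [N [N0 -> HN]] := hardy_component_bound.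
set C := _ / (p - 1).
have C0 : 0 <= C.
  apply: divr_ge0; last by rewrite subr_ge0 ltW.
  by rewrite addr_ge0// mulr_ge0 ?sqr_ge0// subr_ge0 ler1n.
rewrite poweR_EFin -EFinB -EFinM -EFinD.
set Q := _ + C * _.
have HQ r : 0 < r < 1 -> sphmean (fun z => `|enorm (f (r *: z))| `^ p) <= Q.
  move=> r01; have /andP[r0 r1] := r01.
  have r01' : 0 <= r < 1 by rewrite (ltW r0).
  have p12 : 1 < p <= 2 by rewrite p1.
  have [_ hi] := hf.
  have := low_exponent_mean n2 hi p12 gradK r01'.
  have := HN r r01; rewrite (sphnorm_leP (ltW p1) _ N0) => H1.
  have E : (fun z => Num.sqrt (\sum_i component f i (r *: z) * component f i (r *: z)) `^ p)
      = fun z : 'rV[R]_n => `|enorm (f (r *: z))| `^ p.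
    by apply/funext => z; rewrite (ger0_norm (enorm_ge0 _)).
  rewrite E => H2; apply: le_trans H2 _; rewrite lerD2l; apply: ler_wpM2l; first exact: C0.
  by rewrite lerD2r; exact: H1.
have Q0 : 0 <= Q by apply: le_trans (HQ _ half01); exact: sphmean_powR_ge0.
have QE : (Q `^ p^-1) `^ p = Q by rewrite -powRrM mulVf ?gt_eqF// powRr1.
rewrite -QE -poweR_EFin; apply: gt0_ler_poweR; first exact: ltW.
- rewrite in_itv/= leey andbT.
  apply: le_trans (sphnorm_le_hardy_norm n0 (ltW p1) cf half01).
  by rewrite lee_fin sphnorm_ge0.
- by rewrite in_itv/= leey andbT lee_fin powR_ge0.
apply: hardy_norm_le => // [|r r01]; first exact: ltW.
rewrite (sphnorm_leP (ltW p1) _ (powR_ge0 _ _)) QE.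
exact: HQ.
Qed.

Let tau := high_cst p `^ p^-1.

(** As [|f| <= \sum_i |f_i|], Minkowski bounds the norm by the component norms: [N] for [f_j], and
    [tau K N + |f_i(0)|] for each of the other [n - 1]. *)
Lemma hardy_high_exponent : 2 < p ->
  (hardy_norm p f <=
     (tau * K * (n%:R - 1) + 1)%:E * hardy_norm p (to_rV1 (component f j)) -
     `|component f j 0|%:E + (Num.sqrt n%:R * enorm (f 0))%:E)%E.
Proof.
move=> p2; have [N [N0 -> HN]] := hardy_component_bound.
have tau0 : 0 <= tau by exact: powR_ge0.
rewrite -EFinM -EFinB -EFinD; apply: hardy_norm_le => // [|r r01]; first exact: ltW.
have /andP[r0 r1] := r01; have r01' : 0 <= r < 1 by rewrite (ltW r0).
have H1 := HN r r01.
have cfr i : sphcont (fun z => component f i (r *: z)) by exact: Ck_sphcont r01' (Cf i).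
have p1' := ltW p1.
have bound i : i != j ->
    sphnorm p (fun z => component f i (r *: z)) <= tau * K * N + `|component f i 0|.
  move=> ij; pose u y := K^-1 * (component f i y - component f i 0).
  have cu1 : Ck 2 (eball n) (fun y => component f i y - component f i 0).
    exact: (Ck_add oB (Cf i) (Ck_cst oB 2 _)).
  have cK := Ck_cst oB 2 K^-1.
  have hu : invariant_harmonic u.
    split; first exact: (Ck_mul oB cK cu1).
    move=> x xB; rewrite (inv_laplacianZ _ cu1 xB).
    rewrite (inv_laplacianD (Cf i) (Ck_cst oB 2 _) xB) inv_laplacian_cst addr0.
    by have [_ /(_ i)[_ ->]] := hf; rewrite ?mulr0.
  have gu x : eball n x -> enorm (grad u x) <= enorm (grad (component f j) x).
    move=> xB; rewrite (gradM (Ck_cst oB 1 K^-1) (Ck_le (isT : (1 <= 2)%N) cu1) xB) grad_cst.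
    rewrite (gradD (Ck_le (isT : (1 <= 2)%N) (Cf i)) (Ck_cst oB 1 _) xB) grad_cst.
    rewrite scaler0 add0r addr0 enormZ ger0_norm ?invr_ge0 ?(ltW K0)//.
    by rewrite ler_pdivrMl//; exact: gradK.
  have u0 : u 0 = 0 by rewrite /u subrr mulr0.
  have [_ hi] := hf.
  have := high_exponent_mean n2 hu (hi j) p2 gu u0 r01'.
  have cur : sphcont (fun z => u (r *: z)) by have [cu _] := hu; exact: Ck_sphcont r01' cu.
  have E : (fun z => component f i (r *: z)) =
      fun z : 'rV[R]_n => K * u (r *: z) + component f i 0.
    by apply/funext => z; rewrite /u mulrA mulfV ?gt_eqF// mul1r subrK.
  have h0 : 0 <= high_cst p by exact/ltW/high_cst_gt0.
  have tp : high_cst p = tau `^ p by rewrite /tau -powRrM mulVf ?gt_eqF// powRr1.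
  rewrite tp => H2.
  have {}H2 : sphnorm p (fun z => u (r *: z)) <= tau * N.
    rewrite (sphnorm_leP p1' _ (mulr_ge0 tau0 N0)) powRM//.
    apply: le_trans H2 _; rewrite ler_wpM2l ?powR_ge0//.
    by rewrite -(sphnorm_leP p1' _ N0).
  rewrite E; apply: le_trans (sphnormD n0 p1' (sphcontM (@sphcont_cst R n K) cur)
    (@sphcont_cst R n _)) _.
  rewrite (sphnorm_cst n0 p1') lerD2r (sphnormZ n0 p1' _ cur) (gtr0_norm K0).
  by rewrite (mulrC tau) -mulrA ler_wpM2l// ltW.
have [cs Hs] := sphnorm_sum n0 p1' (index_enum 'I_n) (fun i z zS =>
   norm_continuous_fun (cfr i z zS)).
apply: (@le_trans _ _ (\sum_i sphnorm p (fun z => `|component f i (r *: z)|))).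
  apply: le_trans Hs; apply: (sphnorm_le n0 p1' (sphcont_enorm cf r01') cs) => z _.
  have s0 : 0 <= \sum_i `|component f i (r *: z)| by rewrite sumr_ge0.
  rewrite (ger0_norm (enorm_ge0 _)) (ger0_norm s0).
  rewrite -ler_sqr ?nnegrE ?enorm_ge0// sqr_enorm.
  rewrite expr2 mulr_suml; apply: ler_sum => i _.
  rewrite -expr2 -real_normK ?num_real// expr2 ler_wpM2l//.
  by rewrite (bigD1 i)//= lerDl sumr_ge0.
have normE i : sphnorm p (fun z => `|component f i (r *: z)|) =
    sphnorm p (fun z => component f i (r *: z)).
  by rewrite /sphnorm /sphmean; congr (Rintegral _ _ _ `^ _); apply/funext => z; rewrite normr_id.
rewrite (eq_bigr _ (fun i _ => normE i)) (bigD1 j)//=.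
apply: le_trans (lerD H1 (ler_sum _ bound)) _.
rewrite big_split/= sumr_const cardC1 card_ord.
(* The values [|f_i(0)|] occur only for [i != j]; bounding the complete sum by [sqrt n |f(0)|]
   therefore leaves the term [- |f_j(0)|]. *)
have := sum_abs_le_enorm (f 0); rewrite (bigD1 j)//=.
have -> : tau * K * N *+ n.-1 = tau * K * (n%:R - 1) * N.
  by rewrite -mulr_natr -subn1 natrB// mulrAC.
rewrite /component mulrDl mul1r.
have combine (a b c d M : R) : d + a <= b -> M + (c + a) <= c + M - d + b.
  by move=> H; rewrite addrA [M + c]addrC -(addrA _ (- d)) lerD2l [- d + b]addrC lerBrDl.
exact: combine.
Qed.

End conjugate_type_estimates.

Section hardy_transfer.
Context {R : realType}.

Lemma hardy_conjugate n (K : R) (f : 'rV[R]_n -> 'rV[R]_n) (j : 'I_n) (p : R) :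
  (2 <= n)%N -> 1 <= K -> inv_harmonic_quasiregular K f -> 1 < p ->
  hardy p (to_rV1 (component f j)) -> hardy p f.
Proof.
move=> n2 K1 hf p1 hj; have n0 := ltnW n2; have p1' := ltW p1.
have cf i x : eball n x -> {for x, continuous (component f i)}.
  by have [_ /(_ i)[+ _]] := hf; exact: Ck_continuous.
have [N [N0 NE _]] := hardy_component_bound n2 hf p1 hj.
apply: hardy_intro => //.
have [p2|p2] := leP p 2.
  have := hardy_low_exponent n2 K1 hf p1 hj p2; rewrite NE poweR_EFin -EFinB -EFinM -EFinD.
  move=> /le_lt_trans/(_ (ltry _)); apply: lty_poweRy.
  by rewrite gt_eqF// (lt_trans ltr01).
have := hardy_high_exponent n2 K1 hf p1 hj p2; rewrite NE -EFinM -EFinB -EFinD.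
by move=> /le_lt_trans; apply; exact: ltry.
Qed.

End hardy_transfer.

(** * The mapping 1 / (1 - z) *)

Section cauchy_kernel.
Context {R : realType}.
Let B := @eball R 2.
Let oB : open B := @open_eball R 2.

Lemma is_derive_coord_basis n (i k : 'I_n) (x : 'rV[R]_n) :
  is_derive x (basis_vec k) (fun y : 'rV[R]_n => y 0 i) (k == i)%:R.
Proof. by apply: is_derive_eq; first exact: is_derive_coord; rewrite !mxE eqxx/= eq_sym. Qed.

Lemma Ck_coord n k (Omega : set 'rV[R]_n) (i : 'I_n) : open Omega ->
  Ck k Omega (fun y => y 0 i).
Proof.
move=> oO; have cc (x : 'rV[R]_n) : {for x, continuous (fun y : 'rV[R]_n => y 0 i)}.
  exact: coord_continuous_rV.
case: k => [|k]; first by move=> x _; exact: cc.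
apply: (CkS_intro oO (f' := fun k' _ => (k' == i)%:R)) => [x _|k' x _|k'].
- exact: cc.
- exact: is_derive_coord_basis.
- exact: Ck_cst.
Qed.

Lemma grad_coord n (i : 'I_n) (x : 'rV[R]_n) : grad (fun y => y 0 i) x = basis_vec i.
Proof.
apply/rowP => k; rewrite mxE; have /@derive_val -> := is_derive_coord_basis i k x.
by rewrite !mxE eqxx/=.
Qed.

Lemma laplacian_coord n (i : 'I_n) (x : 'rV[R]_n) : laplacian (fun y => y 0 i) x = 0.
Proof.
rewrite /laplacian big1// => k _.
rewrite (_ : 'D_(basis_vec k) (fun y : 'rV[R]_n => y 0 i) = fun=> (k == i)%:R).
  exact: derive_cst.
by apply/funext => y; have /@derive_val -> := is_derive_coord_basis i k y.
Qed.

(* With w = 1 - z, the kernel is 1 / w = (Re w - i Im w) / |w|^2; [re_part] is Re w,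
   [im_part] is - Im w and [sqdist1] is |w|^2. *)
Definition re_part (x : 'rV[R]_2) : R := 1 + (-1) * x 0 0.
Definition im_part (x : 'rV[R]_2) : R := x 0 1.
Definition sqdist1 (x : 'rV[R]_2) : R := re_part x * re_part x + im_part x * im_part x.

Lemma re_part_gt0 x : B x -> 0 < re_part x.
Proof.
move=> xB; rewrite /re_part mulN1r subr_gt0.
exact: le_lt_trans (ler_norm _) (le_lt_trans (coord_le_enorm x 0) xB).
Qed.

Lemma sqdist1_gt0 x : B x -> 0 < sqdist1 x.
Proof. by move=> /re_part_gt0 a0; rewrite ltr_pwDl ?mulr_gt0// -expr2 sqr_ge0. Qed.

Lemma Ck_re_part k : Ck k B re_part.
Proof.
exact: (Ck_add oB (Ck_cst oB k 1) (Ck_mul oB (Ck_cst oB k (-1)) (Ck_coord k 0 oB))).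
Qed.

Lemma Ck_im_part k : Ck k B im_part. Proof. exact: Ck_coord. Qed.

Lemma Ck_sqdist1 k : Ck k B sqdist1.
Proof.
exact: (Ck_add oB (Ck_mul oB (Ck_re_part k) (Ck_re_part k))
                  (Ck_mul oB (Ck_im_part k) (Ck_im_part k))).
Qed.

(** A real power rather than an inverse, so that the calculus of [powR] applies. *)
Definition isqdist1 (x : 'rV[R]_2) : R := sqdist1 x `^ (-1).

Lemma Ck_isqdist1 k : Ck k B isqdist1.
Proof. exact: (Ck_powR oB _ sqdist1_gt0 (Ck_sqdist1 k)). Qed.

Lemma grad_re_part x : B x -> grad re_part x = (-1) *: basis_vec 0.
Proof.
move=> xB; rewrite (gradD (Ck_cst oB 1 1) (Ck_mul oB (Ck_cst oB 1 (-1)) (Ck_coord 1 0 oB)) xB).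
rewrite (gradM (Ck_cst oB 1 (-1)) (Ck_coord 1 0 oB) xB) !grad_cst grad_coord.
by rewrite scaler0 !add0r.
Qed.

Lemma grad_im_part x : grad im_part x = basis_vec 1.
Proof. exact: grad_coord. Qed.

Lemma dotp_basis n (i k : 'I_n) : dotp (basis_vec i) (basis_vec k) = (i == k)%:R :> R.
Proof.
rewrite /dotp (bigD1 i)//= big1 ?addr0 => [|l li]; last by rewrite !mxE (negbTE li) mul0r.
by rewrite !mxE !eqxx mul1r.
Qed.

Lemma inv_laplacian2 u (x : 'rV[R]_2) : inv_laplacian u x = (1 - enorm x ^+ 2) ^+ 2 * laplacian u x.
Proof. by rewrite /inv_laplacian subrr mulr0 !mul0r addr0. Qed.

Lemma inv_laplacian_re_part x : B x -> inv_laplacian re_part x = 0.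
Proof.
move=> xB.
rewrite (inv_laplacianD (Ck_cst oB 2 1) (Ck_mul oB (Ck_cst oB 2 (-1)) (Ck_coord 2 0 oB)) xB).
rewrite inv_laplacian_cst (inv_laplacianZ _ (Ck_coord 2 0 oB) xB) inv_laplacian2.
by rewrite laplacian_coord !mulr0 addr0.
Qed.

Lemma inv_laplacian_im_part x : inv_laplacian im_part x = 0.
Proof. by rewrite inv_laplacian2 laplacian_coord mulr0. Qed.

Lemma grad_sqdist1 x : B x ->
  grad sqdist1 x = (- (2 * re_part x)) *: basis_vec 0 + (2 * im_part x) *: basis_vec 1.
Proof.
move=> xB; have ca := Ck_re_part 1; have cb := Ck_im_part 1.
rewrite (gradD (Ck_mul oB ca ca) (Ck_mul oB cb cb) xB).
rewrite (gradM ca ca xB) (gradM cb cb xB) (grad_re_part xB) grad_im_part.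
by rewrite -!scalerDl -!mulr2n scalerA mulrN1 !mulr_natl.
Qed.

Lemma inv_laplacian_sqdist1 x : B x ->
  inv_laplacian sqdist1 x = 4 * (1 - enorm x ^+ 2) ^+ 2.
Proof.
move=> xB; have ca := Ck_re_part 2; have cb := Ck_im_part 2.
rewrite (inv_laplacianD (Ck_mul oB ca ca) (Ck_mul oB cb cb) xB).
rewrite (inv_laplacianM ca ca xB) (inv_laplacianM cb cb xB).
rewrite (inv_laplacian_re_part xB) inv_laplacian_im_part (grad_re_part xB) grad_im_part.
rewrite dotpZl dotpZr !dotp_basis !eqxx !mulr0 !add0r mulr1n.
by move: (1 - _) => w; ring.
Qed.

Lemma dotp_grad_sqdist1 x : B x -> dotp (grad sqdist1 x) (grad sqdist1 x) = 4 * sqdist1 x.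
Proof.
move=> xB; rewrite (grad_sqdist1 xB) !(dotpDl, dotpDr, dotpZl, dotpZr) !dotp_basis/=.
by rewrite /sqdist1; move: (re_part x) (im_part x) => a b; ring.
Qed.

Lemma isqdist1M x : B x -> sqdist1 x * isqdist1 x = 1.
Proof.
by move=> /sqdist1_gt0 D0; rewrite /isqdist1 powR_inv1 ?(ltW D0)// mulfV ?gt_eqF.
Qed.

Lemma powR_sqdist1 x k : B x -> sqdist1 x `^ (- k.+1%:R) = isqdist1 x ^+ k.+1.
Proof.
by move=> /sqdist1_gt0 D0; rewrite /isqdist1 -powR_mulrn ?powR_ge0// -powRrM mulN1r.
Qed.

Lemma grad_isqdist1 x : B x -> grad isqdist1 x = (- isqdist1 x ^+ 2) *: grad sqdist1 x.
Proof.
move=> xB; rewrite (grad_powR _ sqdist1_gt0 (Ck_sqdist1 1) xB) -(powR_sqdist1 1 xB).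
by rewrite mulN1r; congr (- (_ `^ _) *: _); lra.
Qed.

(** With [D = sqdist1], [Delta D = 4] and [|grad D|^2 = 4 D], the two terms of [Delta (1/D)] are
    [-4 / D^2] and [8 / D^2]. *)
Lemma inv_laplacian_isqdist1 x : B x ->
  inv_laplacian isqdist1 x = 4 * (1 - enorm x ^+ 2) ^+ 2 * isqdist1 x ^+ 2.
Proof.
move=> xB; rewrite (inv_laplacian_powR _ sqdist1_gt0 (Ck_sqdist1 2) xB).
rewrite (inv_laplacian_sqdist1 xB) (dotp_grad_sqdist1 xB).
have -> : -1 - 1 = - 2%:R :> R by lra.
have -> : -1 - 2 = - 3%:R :> R by lra.
rewrite (powR_sqdist1 1 xB) (powR_sqdist1 2 xB).
have := isqdist1M xB; move: (sqdist1 x) (isqdist1 x) (1 - _) => D I w DI.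
transitivity (-4 * I ^+ 2 * w ^+ 2 + 8 * I ^+ 2 * w ^+ 2 * (D * I)); first by ring.
by rewrite DI; ring.
Qed.

(** The gradient of [sqdist1] is twice the position vector from the pole [(1, 0)], so the last
    hypothesis is Euler's identity for degree one. It makes the cross term cancel [l] times the
    Laplacian of [isqdist1]. *)
Lemma invariant_harmonic_kernel (l : 'rV[R]_2 -> R) : Ck 2 B l ->
  (forall x, B x -> inv_laplacian l x = 0) ->
  (forall x, B x -> dotp (grad l x) (grad sqdist1 x) = 2 * l x) ->
  invariant_harmonic (fun x => l x * isqdist1 x).
Proof.
move=> cl l0 gl; split; first exact: (Ck_mul oB cl (Ck_isqdist1 2)).
move=> x xB; rewrite (inv_laplacianM cl (Ck_isqdist1 2) xB) l0// mulr0 add0r.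
rewrite (inv_laplacian_isqdist1 xB) (grad_isqdist1 xB) dotpZr gl//.
by move: (1 - _) (l x) (isqdist1 x) => w a I; ring.
Qed.

Definition kernel_re (x : 'rV[R]_2) : R := re_part x * isqdist1 x.
Definition kernel_im (x : 'rV[R]_2) : R := im_part x * isqdist1 x.

Lemma invariant_harmonic_kernel_re : invariant_harmonic kernel_re.
Proof.
apply: invariant_harmonic_kernel => [|x xB|x xB]; first exact: Ck_re_part.
  exact: inv_laplacian_re_part.
rewrite (grad_sqdist1 xB) (grad_re_part xB) !(dotpDl, dotpDr, dotpZl, dotpZr).
by rewrite !dotp_basis/=; move: (re_part x) => a; ring.
Qed.

Lemma invariant_harmonic_kernel_im : invariant_harmonic kernel_im.
Proof.
apply: invariant_harmonic_kernel => [|x xB|x xB]; first exact: Ck_im_part.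
  exact: inv_laplacian_im_part.
rewrite (grad_sqdist1 xB) grad_im_part !(dotpDl, dotpDr, dotpZl, dotpZr).
by rewrite !dotp_basis/=; move: (im_part x) => a; ring.
Qed.

Lemma grad_kernel (l : 'rV[R]_2 -> R) x : Ck 1 B l -> B x ->
  grad (fun x => l x * isqdist1 x) x =
  isqdist1 x *: grad l x - (l x * isqdist1 x ^+ 2) *: grad sqdist1 x.
Proof.
move=> cl xB; rewrite (gradM cl (Ck_isqdist1 1) xB) (grad_isqdist1 xB).
by rewrite scalerA mulrN scaleNr.
Qed.

Lemma cauchy_riemann x : B x ->
  'D_(basis_vec 0) kernel_re x = 'D_(basis_vec 1) kernel_im x /\
  'D_(basis_vec 1) kernel_re x = - 'D_(basis_vec 0) kernel_im x.
Proof.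
move=> xB.
have gr := grad_kernel (Ck_re_part 1) xB; have gi := grad_kernel (Ck_im_part 1) xB.
have re_i i : 'D_(basis_vec i) kernel_re x = grad kernel_re x 0 i by rewrite mxE.
have im_i i : 'D_(basis_vec i) kernel_im x = grad kernel_im x 0 i by rewrite mxE.
rewrite !re_i !im_i {}gr {}gi (grad_re_part xB) grad_im_part (grad_sqdist1 xB).
rewrite !mxE/=; have := isqdist1M xB; rewrite /sqdist1.
move: (re_part x) (im_part x) (isqdist1 x) => a b I H; split; last by ring.
transitivity (- I + 2 * (a ^+ 2 * I ^+ 2)); first by ring.
transitivity (- I + 2 * I * ((a * a + b * b) * I) - 2 * (b ^+ 2 * I ^+ 2)); first by ring.
by rewrite H; ring.
Qed.

End cauchy_kernel.

Section step_functions.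
Context {d} {T : measurableType d} {R : realType} (mu : {measure set T -> \bar R}).

(** Such a sum over nested boxes is the minorant that shows the means of the kernel to be
    unbounded. *)
Lemma Rintegral_sum_indic (D : set T) (A : nat -> set T) (c : nat -> R) M :
  measurable D -> (mu D < +oo)%E -> (forall k, measurable (A k)) ->
  (forall k, A k `<=` D) ->
  mu.-integrable D (fun x => (\sum_(k < M) c k * \1_(A k) x)%:E) /\
  \int[mu]_(x in D) (\sum_(k < M) c k * \1_(A k) x) = \sum_(k < M) c k * fine (mu (A k)).
Proof.
move=> mD Doo mA AD; elim: M => [|M [iM EM]].
  have E : (fun x : T => \sum_(k < 0) c k * \1_(A k) x) = fun=> 0 :> R.
    by apply/funext => x; rewrite big_ord0.
  rewrite E big_ord0 (_ : (fun x => _) = cst 0%E); last first.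
    by apply/funext => x; rewrite big_ord0.
  by split; [exact: integrable0|rewrite Rintegral_cst// mul0r].
have iI : mu.-integrable D (EFin \o (\1_(A M) : T -> R)).
  apply: measurable_bounded_integrable => //.
  exists 1; split; first exact: num_real.
  by move=> N N1 x _; rewrite /= indicE ger0_norm// (le_trans _ (ltW N1))// lern1 leq_b1.
have icI : mu.-integrable D (fun x => (c M * \1_(A M) x)%:E).
  by apply: (integrableZl mD (c M) iI).
have E x : \sum_(k < M.+1) c k * \1_(A k) x =
    \sum_(k < M) c k * \1_(A k) x + c M * \1_(A M) x by rewrite big_ord_recr.
split.
  apply: (@eq_integrable _ _ _ _ _ mD
    (fun x => (\sum_(k < M) c k * \1_(A k) x)%:E + (c M * \1_(A M) x)%:E)%E).
    by move=> x _; rewrite E.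
  exact: integrableD.
rewrite [RHS]big_ord_recr/= -EM.
rewrite (_ : (fun x : T => _) =
    fun x => \sum_(k < M) c k * \1_(A k) x + c M * \1_(A M) x); last exact/funext/E.
rewrite (RintegralD mD iM icI) (RintegralZl _ mD iI); congr (_ + _ * _).
by rewrite /Rintegral integral_indic// setIidl.
Qed.

End step_functions.

Section cauchy_kernel_mapping.
Context {R : realType}.
Let B := @eball R 2.
Let oB : open B := @open_eball R 2.

Lemma Ck_Lp_loc n k p (g : 'rV[R]_n -> R) : (0 < n)%N -> 1 <= p ->
  Ck k (eball n) g -> Lp_loc p (eball n) g.
Proof.
move=> n0 p1 cg.
have cgx x : eball n x -> {for x, continuous g} by exact: Ck_continuous cg.
split; first by apply: continuous_at_measurable; [exact: measurable_eball|exact: cgx].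
move=> C cC CB; have mC := compact_measurable_rV cC.
have cgp x : C x -> {for x, continuous (fun x => `|g x| `^ p)}.
  move=> xC; apply: (@continuous_comp _ _ _ g (fun t : R => `|t| `^ p)).
    by apply: cgx; exact: CB.
  exact: powR_norm_continuous.
have [M M0 gM] := compact_bounded_fun cC cgp.
apply: (@measurable_bounded_integrable _ _ _ _ (fun x => `|g x| `^ p)) => //.
- apply: le_lt_trans (lebesgue_eball_lty n); apply: le_measure; rewrite ?inE//.
  exact: measurable_eball.
- exact: continuous_at_measurable.
- exists M; split; first exact: num_real.
  by move=> N MN x /gM h; exact: le_trans h (ltW MN).
Qed.

Lemma I2_case (i : 'I_2) : i = 0 \/ i = 1.
Proof. by case: i => -[|[|//]] Hi; [left|right]; exact/val_inj. Qed.

Definition kernel_map (x : 'rV[R]_2) : 'rV[R]_2 :=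
  \row_i (if i == 0 then kernel_re x else kernel_im x).

Lemma component_kernel_map0 : component kernel_map 0 = kernel_re.
Proof. by apply/funext => x; rewrite /component mxE. Qed.

Lemma component_kernel_map1 : component kernel_map 1 = kernel_im.
Proof. by apply/funext => x; rewrite /component mxE. Qed.

Lemma invariant_harmonic_kernel_map i : invariant_harmonic (component kernel_map i).
Proof.
have [->|->] := I2_case i.
  by rewrite component_kernel_map0; exact: invariant_harmonic_kernel_re.
by rewrite component_kernel_map1; exact: invariant_harmonic_kernel_im.
Qed.

(** The Cauchy-Riemann form makes [A] a similarity: [|v A|^2 = |v|^2 \det A]. *)
Lemma opnorm_conformal (A : 'M[R]_2) : A 0 0 = A 1 1 -> A 1 0 = - A 0 1 ->
  opnorm A ^+ 2 <= \det A.
Proof.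
move=> h1 h2.
have o1 : lift ord0 ord0 = 1 :> 'I_2 by exact/val_inj.
have o0 : lift 1 ord0 = 0 :> 'I_2 by exact/val_inj.
have z0 : ord0 = 0 :> 'I_2 by exact/val_inj.
have dA : \det A = A 1 1 ^+ 2 + A 0 1 ^+ 2.
  rewrite (expand_det_row A 0) !big_ord_recl big_ord0 /cofactor !det_mx11 !mxE !o1 !z0 o0.
  by rewrite h1 h2 /=; ring.
have d0 : 0 <= \det A by rewrite dA addr_ge0 ?sqr_ge0.
have vA v : enorm (v *m A) ^+ 2 = enorm v ^+ 2 * \det A.
  rewrite !sqr_enorm /dotp !big_ord_recl !big_ord0/= !mxE !big_ord_recl !big_ord0/=.
  by rewrite o1 z0 dA h1 h2; ring.
have bound : forall y, [set enorm (v *m A) | v in [set v : 'rV[R]_2 | enorm v <= 1]] y ->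
    y <= Num.sqrt (\det A).
  move=> _ [v /= v1 <-]; rewrite -ler_sqr ?nnegrE ?enorm_ge0 ?sqrtr_ge0//.
  rewrite [leRHS]sqr_sqrtr// vA ler_piMl//.
  by rewrite -(expr1n _ 2) ler_sqr ?nnegrE ?enorm_ge0.
have in0 : [set enorm (v *m A) | v in [set v : 'rV[R]_2 | enorm v <= 1]] 0.
  by exists 0; rewrite ?mul0mx /= ?enorm0.
rewrite -[leRHS]sqr_sqrtr// ler_sqr ?nnegrE ?sqrtr_ge0//.
  by apply: ge_sup => //; exists 0.
by apply: ub_le_sup => //; exists (Num.sqrt (\det A)).
Qed.

Lemma quasiregular_kernel_map : quasiregular 1 B kernel_map.
Proof.
have cC k : Ck 2 B (component kernel_map k) by have [] := invariant_harmonic_kernel_map k.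
split.
  by move=> x xB; apply: continuous_rV => i; exact: (Ck_continuous (cC i) xB).
exists (fun x => \matrix_(i, j) 'D_(basis_vec i) (component kernel_map j) x); split.
  have n1 : 1 <= 2%:R :> R by rewrite ler1n.
  split=> [j|i j]; first exact: (Ck_Lp_loc _ n1 (cC j)).
  rewrite (_ : (fun x => _) = 'D_(basis_vec i) (component kernel_map j)); last first.
    by apply/funext => x; rewrite mxE.
  split; last exact: (Ck_Lp_loc _ n1 (Ck_partial i (cC j))).
  exact: C1_weak_partial (Ck_le (isT : (1 <= 2)%N) (cC j)).
apply: aeW => x xB; rewrite mul1r; have [H1 H2] := cauchy_riemann xB.
apply: opnorm_conformal; rewrite !mxE component_kernel_map0 component_kernel_map1//.
Qed.

Lemma inv_harmonic_quasiregular_kernel_map : inv_harmonic_quasiregular 1 kernel_map.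
Proof. by split; [exact: quasiregular_kernel_map|exact: invariant_harmonic_kernel_map]. Qed.

Lemma hardy_kernel_re : hardy 1 (to_rV1 (component kernel_map 0)).
Proof.
have [ck hk] := invariant_harmonic_kernel_re (R := R).
rewrite component_kernel_map0.
have cF k x : eball 2 x -> {for x, continuous (component (to_rV1 (@kernel_re R)) k)}.
  by rewrite component_to_rV1; exact: Ck_continuous ck.
have n2 : (1 < 2)%N by []; have n0 : (0 < 2)%N by [].
apply: hardy_intro => //.
apply: (@le_lt_trans _ _ (kernel_re 0)%:E); last exact: ltry.
apply: hardy_norm_le => // r r01.
have r01' : 0 <= r < 1 by have /andP[/ltW -> ->] := r01.
(* The mean value inequality bounds the centre by the mean; applied to the negative of the kernel it
   bounds the mean by the centre. *)
have L x : B x -> 0 <= inv_laplacian (fun y => -1 * kernel_re y) x.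
  by move=> xB; rewrite (inv_laplacianZ _ ck xB) hk// mulr0.
have := sphmean_ge_center n0 (Ck_mul oB (Ck_cst oB 2 (-1)) ck) n2 L r01'.
rewrite (sphmeanZ n0 _ (Ck_sphcont r01' ck)) !mulN1r lerN2; apply: le_trans.
rewrite /sphnorm invr1 powRr1; last exact: sphmean_powR_ge0.
rewrite le_eqVlt; apply/orP; left; apply/eqP; apply: eq_sphmean => z zS.
rewrite enorm_to_rV1 normr_id powRr1// ger0_norm//.
have zB : B (r *: z) by apply: eballZ => //; rewrite zS.
by rewrite mulr_ge0 ?powR_ge0// ltW// re_part_gt0.
Qed.

End cauchy_kernel_mapping.

(** * Divergence of the first-power means of 1 / (1 - z) *)

Section cauchy_kernel_divergence.
Context {R : realType}.
Let B := @eball R 2.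

Lemma sqr_enorm_kernel_map (y : 'rV[R]_2) : B y ->
  enorm (kernel_map y) ^+ 2 = isqdist1 y.
Proof.
move=> yB; rewrite sqr_enorm /dotp !big_ord_recl big_ord0 !mxE/=.
have := isqdist1M yB; rewrite /kernel_re /kernel_im /sqdist1.
move: (re_part y) (im_part y) (isqdist1 y) => a b I H.
by transitivity (((a * a + b * b) * I) * I); [ring|rewrite H mul1r].
Qed.

(** The sides of nested boxes whose points have direction within order [2^-k] of the pole [(1, 0)].
    The first side stays away from the origin, and its bound [3/4] keeps the box in the disc, as
    [9/16 + 1/4 < 1]. *)
Definition near_one_box (k : nat) (i : 'I_2) : set R :=
  if i == 0 then `[2^-1, 3 / 4]%classic else `[0, (2^-1) ^+ k.+1]%classic.

Definition near_one (k : nat) : set 'rV[R]_2 :=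
  [set x | forall i, near_one_box k i (x 0 i)].

Lemma near_oneP k (x : 'rV[R]_2) : near_one k x ->
  2^-1 <= x 0 0 <= 3 / 4 /\ 0 <= x 0 1 <= (2^-1) ^+ k.+1.
Proof. by move=> H; have := H 0; have := H 1; rewrite /near_one_box/= !in_itv/=. Qed.

Lemma measurable_near_one_box k i : measurable (near_one_box k i).
Proof. by rewrite /near_one_box; case: ifPn => _; exact: measurable_itv. Qed.

Lemma measurable_near_one k : measurable (near_one k).
Proof.
rewrite (_ : near_one k = \big[setI/setT]_(i < 2)
    ((fun y : 'rV[R]_2 => y 0 i) @^-1` near_one_box k i)); last first.
  apply/seteqP; split => y; rewrite -bigcap_seq/=; first by move=> H i _; exact: H.
  by move=> H i; apply: (H i); rewrite /= mem_index_enum.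
apply: bigsetI_measurable => i _; rewrite -[X in measurable X]setTI.
by apply: measurable_coord => //; exact: measurable_near_one_box.
Qed.

Lemma lebesgue_near_one k : lebesgue_rV 2 (near_one k) = (4^-1 * (2^-1) ^+ k.+1)%:E.
Proof.
have h0 : 0 < (2^-1 : R) ^+ k.+1 by rewrite exprn_gt0// invr_gt0.
have E0 : lebesgue_measure (near_one_box k 0) = (4^-1)%:E.
  rewrite /near_one_box/= lebesgue_measure_itv/= lte_fin ifT; last by lra.
  by rewrite -EFinD; congr _%:E; lra.
have E1 : lebesgue_measure (near_one_box k 1) = ((2^-1) ^+ k.+1)%:E.
  by rewrite /near_one_box/= lebesgue_measure_itv/= lte_fin h0 -EFinD subr0.
have mb := measurable_near_one_box k.
rewrite /near_one (lebesgue_rV_boxS mb).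
rewrite (@lebesgue_rV_boxS R 0 (fun i => near_one_box k (lift ord0 i)))//.
have o1 : lift ord0 ord0 = 1 :> 'I_2 by exact/val_inj.
have z0 : ord0 = 0 :> 'I_2 by exact/val_inj.
rewrite o1 z0 E0 E1 (_ : [set _ | _] = setT); first by rewrite lebesgue_rV0 mule1 -EFinM.
by apply/seteqP; split => // x _ [].
Qed.

Lemma near_one_punctured k : near_one k `<=` punctured 2.
Proof.
move=> x /near_oneP[/andP[h1 h2] /andP[h3 h4]]; split; last first.
  by move=> x0; move: h1; rewrite x0 mxE; lra.
have h5 : (2^-1 : R) ^+ k.+1 <= 2^-1.
  by rewrite exprS ler_piMr ?invr_ge0// exprn_ile1 ?invr_ge0// invf_le1 ?ler1n.
have o1 : lift ord0 ord0 = 1 :> 'I_2 by exact/val_inj.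
have z0 : ord0 = 0 :> 'I_2 by exact/val_inj.
rewrite /eball/= -(@ltr_pXn2r _ 2)// ?nnegrE ?enorm_ge0// sqr_enorm expr1n.
rewrite /dotp !big_ord_recl big_ord0 o1 z0 addr0.
move: (x 0 0) (x 0 1) h1 h2 h3 (le_trans h4 h5) => a b; nra.
Qed.

(** Here [(a, b)] has norm [e], and [I a] is the cosine of its angle. The left side is
    [(1 - r)^2 + 2 r (1 - I a)]; since [e + a >= 1], [e - a = b^2 / (e + a)] gives
    [1 - I a <= 2 b^2], of order [q^2]. *)
Lemma sqdist1_near_one (a b e I q r : R) : e ^+ 2 = a ^+ 2 + b ^+ 2 -> e * I = 1 ->
  0 < e -> 2^-1 <= a -> 0 <= b -> b <= 2^-1 * q -> 0 < q -> 0 <= r -> r < 1 ->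
  1 - r <= q ->
  (1 + -1 * (r * (I * a))) * (1 + -1 * (r * (I * a))) +
  r * (I * b) * (r * (I * b)) <= 4 * q ^+ 2.
Proof.
move=> e2 eI e0 ha hb bq q0 r0 r1 rq.
have I0 : 0 < I by rewrite -(pmulr_rgt0 I e0) eI.
have -> : (1 + -1 * (r * (I * a))) * (1 + -1 * (r * (I * a))) +
    r * (I * b) * (r * (I * b)) = (1 - r) ^+ 2 + 2 * r * (1 - I * a).
  transitivity (1 - 2 * r * (I * a) + r ^+ 2 * (I ^+ 2 * (a ^+ 2 + b ^+ 2))); first by ring.
  rewrite -e2 -exprMn mulrC [I * e]mulrC eI; ring.
have ae : a <= e by nra.
have H : 1 - I * a <= 2 * b ^+ 2.
  have E : 1 - I * a = I * (e - a) by rewrite -eI; ring.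
  have ea : (e - a) * (e + a) = b ^+ 2 by rewrite -subr_sqr e2; ring.
  have : e - a <= 2 * b ^+ 2 * e by nra.
  rewrite E => h; rewrite mulrC -ler_pdivlMr//.
  by rewrite (_ : I^-1 = e)// -[LHS]mul1r -eI mulfK// gt_eqF.
have H2 : 0 <= 1 - I * a.
  by rewrite subr_ge0 -eI mulrC ler_wpM2r// ltW.
have : b ^+ 2 <= (2^-1 * q) ^+ 2 by rewrite ler_sqr ?nnegrE// mulr_ge0 ?invr_ge0 ?ltW.
have : (1 - r) ^+ 2 <= q ^+ 2 by rewrite ler_sqr ?nnegrE ?subr_ge0 ?(ltW r1) ?(ltW q0).
nra.
Qed.

Lemma kernel_map_near_one (r : R) m (x : 'rV[R]_2) : 0 <= r < 1 ->
  1 - r <= (2^-1) ^+ m -> near_one m x ->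
  2 ^+ m / 2 <= enorm (kernel_map (r *: direction x)).
Proof.
move=> r01 rm xm; have [xB x0] := near_one_punctured xm.
have /near_oneP[/andP[h1 _] /andP[h3]] := xm.
have -> : 2 ^+ m / 2 = (2 * (2^-1 : R) ^+ m)^-1.
  by rewrite exprVn invfM invrK mulrC.
rewrite exprS; set q := (2^-1) ^+ m => h4.
have q0 : 0 < q by rewrite exprn_gt0// invr_gt0.
have yB : B (r *: direction x).
  by apply: eballZ => //; rewrite enorm_direction//; exact/eqP.
have x0' : 0 < enorm x by rewrite enorm_gt0; exact/eqP.
have o1 : lift ord0 ord0 = 1 :> 'I_2 by exact/val_inj.
have z0 : ord0 = 0 :> 'I_2 by exact/val_inj.
have D4 : sqdist1 (r *: direction x) <= 4 * q ^+ 2.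
  have e2 : enorm x ^+ 2 = x 0 0 ^+ 2 + x 0 1 ^+ 2.
    by rewrite sqr_enorm /dotp !big_ord_recl big_ord0 o1 z0 addr0 -!expr2.
  rewrite /sqdist1 /re_part /im_part !mxE.
  have eI : enorm x * (enorm x)^-1 = 1 by rewrite mulfV ?gt_eqF.
  move: e2 eI x0' h1 h3 h4 q0 r01 rm.
  move: (enorm x) (enorm x)^-1 (x 0 0) (x 0 1) => e I a b e2 eI e0 h1 h3 h4 q0.
  move=> /andP[r0 r1] rm.
  exact: (sqdist1_near_one e2 eI e0 h1 h3 h4 q0 r0 r1 rm).
have := sqr_enorm_kernel_map yB; have := enorm_ge0 (kernel_map (r *: direction x)).
have := isqdist1M yB; have := sqdist1_gt0 yB; move: D4.
move: (sqdist1 _) (isqdist1 _) (enorm _) => D I F D4 D0 DI F0 FI.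
have I0 : 0 < I by rewrite -(pmulr_rgt0 I D0) DI.
rewrite -ler_sqr ?nnegrE ?invr_ge0 ?mulr_ge0 ?(ltW q0)// FI exprVn.
rewrite -[leLHS]mul1r ler_pdivrMr; last by rewrite exprn_gt0// mulr_gt0.
have := ler_wpM2l (ltW I0) D4; rewrite (mulrC I D) DI.
by rewrite (_ : 4 * q ^+ 2 = (2 * q) ^+ 2)//; ring.
Qed.

(* The box [near_one k] has area 2^-k / 8 and the weight 2^k / 4 on it, so that each
   of the M nested boxes contributes 1 / 32. *)
Lemma sphmean_kernel_map_ge (M : nat) (r : R) : 0 <= r < 1 -> 1 - r <= (2^-1) ^+ M ->
  M%:R / 32 <= ballvol 2 * sphmean (fun z : 'rV[R]_2 => enorm (kernel_map (r *: z))).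
Proof.
move=> r01 rM; have n0 : (0 < 2)%N by [].
have cF k x : eball 2 x -> {for x, continuous (component (@kernel_map R) k)}.
  by have [ck _] := invariant_harmonic_kernel_map (R := R) k; exact: Ck_continuous ck.
have cE := sphcont_enorm cF r01.
have [C C0 EC] := compact_bounded_fun (@compact_esphere R 2) cE.
have [_ iF ->] := sphere_direction_integral n0 (sphcont_measurable cE) EC.
have bv0 := @ballvol_gt0 R 2.
rewrite mulVKf ?gt_eqF//.
have mD := @measurable_punctured R 2.
have Doo : (lebesgue_rV 2 (@punctured R 2) < +oo)%E by rewrite lebesgue_punctured// ltry.
have [iS ES] := Rintegral_sum_indic (fun k => 2 ^+ k / 4) M mD Doo measurable_near_one
  near_one_punctured.
have -> : M%:R / 32 = \sum_(k < M) 2 ^+ k / 4 * fine (lebesgue_rV 2 (near_one k)).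
  rewrite (eq_bigr (fun=> 32^-1)).
    by rewrite sumr_const card_ord mulr_natl.
  move=> k _; rewrite lebesgue_near_one/= exprS exprVn.
  have : (2 : R) ^+ k != 0 by rewrite expf_neq0.
  by move: (2 ^+ k) => t t0; field.
rewrite -ES; apply: (le_Rintegral mD iS iF) => x Dx /=.
(* Outside the last box its term vanishes. Inside it, the earlier terms add up to at most [2^M / 4]
   by the geometric sum, so the total is at most [2^M / 2], the lower bound of the kernel there. *)
elim: M rM {iS ES} => [|M ih] rM; first by rewrite big_ord0 enorm_ge0.
have rM' : 1 - r <= 2^-1 ^+ M.
  apply: le_trans rM _; rewrite exprS ler_piMl ?exprn_ge0 ?invr_ge0//.
  by rewrite invf_le1 ?ler1n.
rewrite big_ord_recr/= indicE; have [xM|xM] := boolP (x \in near_one M); last first.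
  by rewrite mulr0 addr0; exact: ih.
have := kernel_map_near_one r01 rM' (set_mem xM); apply: le_trans.
rewrite mulr1; apply: (@le_trans _ _ (\sum_(k < M) 2 ^+ k / 4 + 2 ^+ M / 4)).
  rewrite lerD2r; apply: ler_sum => k _.
  by rewrite ler_piMr ?divr_ge0 ?exprn_ge0// indicE lern1 leq_b1.
have geom : \sum_(k < M) 2 ^+ k / 4 <= 2 ^+ M / 4 :> R.
  elim: M {ih rM rM' xM} => [|M ih]; first by rewrite big_ord0 divr_ge0.
  by rewrite big_ord_recr/=; apply: le_trans (lerD ih (lexx _)) _; rewrite exprS; lra.
by apply: le_trans (lerD geom (lexx _)) _; move: (2 ^+ M) => t; lra.
Qed.

Lemma not_hardy_kernel_map : ~ hardy 1 (@kernel_map R).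
Proof.
move=> [_ _ Noo]; have n0 : (0 < 2)%N by [].
have cF k x : eball 2 x -> {for x, continuous (component (@kernel_map R) k)}.
  by have [ck _] := invariant_harmonic_kernel_map (R := R) k; exact: Ck_continuous ck.
have [N [N0 _ HN]] := hardy_norm_fin n0 (lexx 1) cF Noo.
have bv0 := @ballvol_gt0 R 2.
have x0 : 0 <= 32 * (ballvol 2 * N) by rewrite !mulr_ge0// ltW.
(* [M] is so large that [M / 32] exceeds [ballvol 2 * N]; the exponent [M.+1] below makes [r]
   positive for every [M]. *)
have := archi_boundP x0; set M := Num.bound _ => HM.
have q0 : 0 < (2^-1 : R) ^+ M.+1 by rewrite exprn_gt0// invr_gt0.
have q1 : (2^-1 : R) ^+ M.+1 < 1 by rewrite exprn_ilt1// ?invr_ge0// invf_lt1 ?ltr1n.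
pose r := 1 - (2^-1 : R) ^+ M.+1.
have r01 : 0 < r < 1 by rewrite /r subr_gt0 q1/= ltrBlDr ltrDl.
have r01' : 0 <= r < 1 by have /andP[/ltW -> ->] := r01.
have rM : 1 - r <= (2^-1) ^+ M.+1 by rewrite /r subKr.
have := sphmean_kernel_map_ge r01' rM.
have := HN r r01; rewrite /sphnorm invr1 powRr1; last exact: sphmean_powR_ge0.
have -> : (fun z : 'rV[R]_2 => `|enorm (kernel_map (r *: z))| `^ 1) =
    fun z : 'rV[R]_2 => enorm (kernel_map (r *: z)).
  by apply/funext => z; rewrite powRr1// ger0_norm// enorm_ge0.
move=> H1 H2; have := le_trans H2 (ler_wpM2l (ltW bv0) H1).
rewrite ler_pdivrMr// [X in _ <= X]mulrC => H3.
have H4 : M%:R <= M.+1%:R :> R by rewrite ler_nat.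
by have := lt_le_trans HM (le_trans H4 H3); rewrite ltxx.
Qed.

End cauchy_kernel_divergence.

Theorem theorem1p6 (R : realType) :
  [/\ (* f_j in H^p for some p > 1 implies f in H^p *)
      forall (n : nat) (K : R) (f : 'rV[R]_n -> 'rV[R]_n) (j : 'I_n) (p : R),
        (2 <= n)%N -> 1 <= K -> inv_harmonic_quasiregular K f -> 1 < p ->
        hardy p (to_rV1 (component f j)) -> hardy p f,
      (* sharpness of p_0 = 1 *)
      forall p0 : R, p0 < 1 ->
        ~ (forall (n : nat) (K : R) (f : 'rV[R]_n -> 'rV[R]_n) (j : 'I_n) (p : R),
             (2 <= n)%N -> 1 <= K -> inv_harmonic_quasiregular K f ->
             0 < p -> p0 < p ->
             hardy p (to_rV1 (component f j)) -> hardy p f),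
      (* (B_1) *)
      forall (n : nat) (K : R) (f : 'rV[R]_n -> 'rV[R]_n) (j : 'I_n) (p : R),
        (2 <= n)%N -> 1 <= K -> inv_harmonic_quasiregular K f ->
        1 < p <= 2 -> hardy p (to_rV1 (component f j)) ->
        (hardy_norm p f `^ p <=
           (enorm (f 0) `^ p)%:E +
           ((1 + (n%:R - 1) * K ^+ 2) / (p - 1))%:E *
           (hardy_norm p (to_rV1 (component f j)) `^ p -
            (`|component f j 0| `^ p)%:E))%E &
      (* (B_2) *)
      forall (n : nat) (p : R), (2 <= n)%N -> 2 < p ->
        exists tau2 : R, 0 < tau2 /\
          forall (K : R) (f : 'rV[R]_n -> 'rV[R]_n) (j : 'I_n),
            1 <= K -> inv_harmonic_quasiregular K f ->
            hardy p (to_rV1 (component f j)) ->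
            (hardy_norm p f <=
               (tau2 * K * (n%:R - 1) + 1)%:E *
                 hardy_norm p (to_rV1 (component f j)) -
               `|component f j 0|%:E +
               (Num.sqrt n%:R * enorm (f 0))%:E)%E].
Proof.
split.
- by move=> n K f j p n2 K1 hf p1 hj; exact: hardy_conjugate n2 K1 hf p1 hj.
(* For every [p0 < 1] the exponent [p = 1] is admissible, so one mapping with [n = 2], [K = 1] and
   [j = 0] refutes all these [p0] at once. *)
- move=> p0 p01 H; apply: (@not_hardy_kernel_map R).
  exact: (H 2 1 _ 0 1 isT (lexx 1) (@inv_harmonic_quasiregular_kernel_map R)
    ltr01 p01 (@hardy_kernel_re R)).
- move=> n K f j p n2 K1 hf /andP[p1 p2] hj.
  exact: hardy_low_exponent n2 K1 hf p1 hj p2.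
- move=> n p n2 p2; have p1 : 1 < p by apply: lt_trans p2; rewrite ltr1n.
  (* The [p]-th root passes from the comparison of [p]-th power means to norms; the constant is
     fixed before [K], [f] and [j]. *)
  exists (high_cst p `^ p^-1).
  split; first by rewrite powR_gt0// high_cst_gt0// (lt_trans ltr01).
  by move=> K f j K1 hf hj; exact: hardy_high_exponent n2 K1 hf p1 hj p2.
Qed.
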